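(* Let $G=(V,E,w)$ be a connected graph with $n$ vertices and $m$ edges and let $T$ be a spanning tree of $G$. For a given parameter $\beta$, define the graph $H$ with $V(H)=E(T)$ and $E(H)=\{\{e,f\}: e,f\in E(T),\ e\neq f,\ \mathrm{cost}(e,f)\le\beta \text{ and } \mathrm{cut}(e,f) \text{ non-trivial}\}$. There is a deterministic algorithm that, given adjacency list access to $G$ and $T$, outputs a spanning forest of $H$ in $\mathcal{O}(m\log^4 n)$ time.
   Context: $G$ is undirected with positive edge weights $w$; $\Delta(S)$ is the set of edges of $G$ with exactly one endpoint in $S$ and $w(F)=\sum_{e\in F}w(e)$. For distinct $e,f\in E(T)$, removing $e$ and $f$ from $T$ splits $T$ into three components, exactly one of which, with vertex set $C$, is incident in $T$ to both $e$ and $f$; $\mathrm{cut}(e,f)=\Delta(C)$ is the 2-respecting cut defined by $e,f$, and $\mathrm{cost}(e,f)=w(\mathrm{cut}(e,f))$. (Equivalently, rooting $T$ at $r$ and writing $e^\downarrow$ for the vertices of the component of $T-e$ not containing $r$: $\mathrm{cut}(e,f)=\Delta(e^\downarrow\setminus f^\downarrow)$ if $f$ lies in the subtree below $e$, and $\Delta(e^\downarrow\cup f^\downarrow)$ if neither edge lies below the other.) A cut $\Delta(S)$ is non-trivial if $|S|\ge 2$ and $|V\setminus S|\ge 2$. A spanning forest of $H$ is a forest subgraph of $H$ whose connected components have the same vertex sets as those of $H$. *)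

(* Defs.v *)
From HB Require Import structures.
From mathcomp Require Import all_boot all_order all_algebra.
From mathcomp Require Import reals.

Set Implicit Arguments.
Unset Strict Implicit.
Unset Printing Implicit Defensive.

Import Order.TTheory GRing.Theory Num.Theory.

(** * Graphs *)

(* A graph on a subset X of a finite type is given by its set E of edges, an
   edge being the pair of its endpoints. *)

Section Graphs.
Variable V : finType.
Implicit Types (X S : {set V}) (E F T : {set {set V}}).

Definition is_graph X E : Prop :=
  forall e, e \in E -> #|e| = 2 /\ e \subset X.

Definition adj E : rel V := [rel x y | [set x; y] \in E].

Definition component X E (x : V) : {set V} :=
  [set y in X | connect (adj E) x y].

Definition components X E : {set {set V}} := [set component X E x | x in X].

Definition connected_graph X E : Prop :=
  X != set0 /\ {in X &, forall x y, connect (adj E) x y}.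

Definition acyclic E : Prop :=
  forall p : seq V, 2 < size p -> ~ ucycle (adj E) p.

Definition spanning_tree X E T : Prop :=
  [/\ T \subset E, connected_graph X T & acyclic T].

Definition spanning_forest X E F : Prop :=
  [/\ F \subset E, acyclic F & components X F = components X E].

Definition Delta E S : {set {set V}} := [set e in E | #|e :&: S| == 1].

Definition nontrivial S : bool := (1 < #|S|) && (1 < #|~: S|).

(* The vertex set of the component of T - e - f incident to both e and f.  It
   is unique when T is a spanning tree and e, f are distinct edges of T. *)
Definition middle T (e f : {set V}) : {set V} :=
  odflt set0 [pick C in components setT (T :\: [set e; f])
             | (C :&: e != set0) && (C :&: f != set0)].

Definition cut E T (e f : {set V}) : {set {set V}} := Delta E (middle T e f).

Definition cost (R : realType) E T (w : {set V} -> R) (e f : {set V}) : R :=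
  (\sum_(g in cut E T e f) w g)%R.

(* The edge set of H; its vertex set is T. *)
Definition Hedges (R : realType) E T (w : {set V} -> R) (beta : R) :
    {set {set {set V}}} :=
  [set [set e; f] | e in T, f in T
    & [&& e != f, (cost E T w e f <= beta)%R & nontrivial (middle T e f)]].

End Graphs.

(** * Adjacency list access *)

Definition adjlists (n : nat) := 'I_n -> seq 'I_n.

(* The neighbours may be listed in any order. *)
Definition adjlists_of n (E : {set {set 'I_n}}) (L : adjlists n) : Prop :=
  forall v, uniq (L v) /\ (forall u, (u \in L v) = adj E v u).

(* Queries are made with arbitrary numbers and answer 0 out of range. *)

Definition nbrs n (L : adjlists n) (a : nat) : seq 'I_n := oapp L [::] (insub a).

Definition query_deg n (L : adjlists n) (a : nat) : nat := size (nbrs L a).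

Definition query_nbr n (L : adjlists n) (a i : nat) : nat :=
  nth 0 [seq val u | u <- nbrs L a] i.

Definition query_wt (R : realType) n (L : adjlists n) (w : {set 'I_n} -> R)
    (a i : nat) : R :=
  if insub a is Some v then
    if onth (L v) i is Some u then w [set v; u] else 0%R
  else 0%R.

(** * Random access machine *)

(* A unit-cost word RAM, extended with a second memory for weights.  Cells of
   the word memory M hold numbers below 2 ^ W, results being reduced modulo
   2 ^ W; cells of the weight memory Z hold real numbers, on which the only
   operations are addition, subtraction and comparison.  Indirect addresses
   into both memories are words. *)

Inductive wordop := Add | Sub | Mul | Div | Mod.

Definition word_eval (o : wordop) : nat -> nat -> nat :=
  match o with
  | Add => addn
  | Sub => subn
  | Mul => muln
  | Div => divn
  | Mod => modn
  end.

Inductive input := InG | InT.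

Inductive instr :=
  | Const of nat & nat            (* M[d] := k *)
  | Op of wordop & nat & nat & nat (* M[d] := M[a] op M[b] *)
  | Read of nat & nat             (* M[d] := M[M[a]] *)
  | Write of nat & nat            (* M[M[a]] := M[b] *)
  | JumpLe of nat & nat & nat     (* if M[a] <= M[b] goto l *)
  | WAdd of nat & nat & nat       (* Z[d] := Z[a] + Z[b] *)
  | WSub of nat & nat & nat       (* Z[d] := Z[a] - Z[b] *)
  | WRead of nat & nat            (* Z[d] := Z[M[a]] *)
  | WWrite of nat & nat           (* Z[M[a]] := Z[b] *)
  | WJumpLe of nat & nat & nat    (* if Z[a] <= Z[b] goto l *)
  | Deg of input & nat & nat      (* M[d] := degree of M[a] *)
  | Nbr of input & nat & nat & nat (* M[d] := neighbour number M[b] of M[a] *)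
  | Wt of nat & nat & nat         (* Z[d] := weight of the edge of G from M[a]
                                     to its neighbour number M[b] *)
  | Out of nat.                   (* append M[a] to the output *)

Definition program := seq instr.

Record config (R : realType) := Config {
  pc : nat;
  wordmem : nat -> nat;
  weightmem : nat -> R;
  output : seq nat
}.

Section Machine.
Variables (R : realType) (P : program) (W n : nat).
Variables (LG LT : adjlists n) (w : {set 'I_n} -> R).
Implicit Type c : config R.

Definition lists (g : input) : adjlists n := if g is InG then LG else LT.

Definition setword c (d v : nat) : config R :=
  Config (pc c).+1 [eta wordmem c with d |-> v %% 2 ^ W] (weightmem c) (output c).

Definition setweight c (d : nat) (x : R) : config R :=
  Config (pc c).+1 (wordmem c) [eta weightmem c with d |-> x] (output c).

Definition jump_if c (b : bool) (l : nat) : config R :=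
  Config (if b then l else (pc c).+1) (wordmem c) (weightmem c) (output c).

Definition exec (i : instr) c : config R :=
  let M := wordmem c in
  let Z := weightmem c in
  match i with
  | Const d k => setword c d k
  | Op o d a b => setword c d (word_eval o (M a) (M b))
  | Read d a => setword c d (M (M a))
  | Write a b => setword c (M a) (M b)
  | JumpLe a b l => jump_if c (M a <= M b) l
  | WAdd d a b => setweight c d (Z a + Z b)%R
  | WSub d a b => setweight c d (Z a - Z b)%R
  | WRead d a => setweight c d (Z (M a))
  | WWrite a b => setweight c (M a) (Z b)
  | WJumpLe a b l => jump_if c (Z a <= Z b)%R l
  | Deg g d a => setword c d (query_deg (lists g) (M a))
  | Nbr g d a b => setword c d (query_nbr (lists g) (M a) (M b))
  | Wt d a b => setweight c d (query_wt LG w (M a) (M b))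
  | Out a => Config (pc c).+1 M Z (rcons (output c) (M a))
  end.

Definition halted c : bool := size P <= pc c.

Definition step c : config R :=
  if onth P (pc c) is Some i then exec i c else c.

Definition init (beta : R) : config R :=
  Config 0 [eta fun=> 0 with 0 |-> n] [eta fun=> 0%R with 0 |-> beta] [::].

Definition run (beta : R) (t : nat) : config R := iter t step (init beta).

End Machine.

(* Words of k * (floor(log2 n) + 1) bits; for k > 0 every vertex, and n itself,
   fits in a word. *)
Definition word_size (k n : nat) : nat := k * (trunc_log 2 n).+1.

(* Every edge {{a, b}, {c, d}} of F is output exactly once, as a, b, c, d. *)
Definition outputs n (s : seq nat) (F : {set {set {set 'I_n}}}) : Prop :=
  exists l : seq (('I_n * 'I_n) * ('I_n * 'I_n)),
    let edges := [seq [set [set q.1.1; q.1.2]; [set q.2.1; q.2.2]] | q <- l] in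
    [/\ s = flatten [seq [:: val q.1.1; val q.1.2; val q.2.1; val q.2.2] | q <- l],
        uniq edges & F = [set x in edges]].

(* Main.v *)
(* For tree edges e, f let M(e, f) be twice the weight of the edges of G that
   cross exactly one of the two fundamental cuts, so M = 2 cost(e, f); a cut is
   trivial exactly when e and f are the two tree edges at a vertex of degree
   two, and M(e, f) is made larger than 2 beta for these pairs.  Number the
   vertices along the heavy paths of T.  A tree path is then a union of
   O(log n) intervals of edges, so each edge of G contributes to M a sum of
   O(log^2 n) point masses, M being the matrix of two-dimensional prefix
   sums.  Sweep the rows e of M with a segment tree over the columns f that
   keeps, at each node, the two smallest prefix sums lying in different
   components of the forest built so far: as long as the row has an entry at
   most 2 beta outside the component of e, output that edge and merge the two
   components, relabelling the smaller one.  This takes O(m log^3 n) steps. *)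

Require Import Defs.
From HB Require Import structures.
From mathcomp Require Import all_boot all_order all_algebra.
From mathcomp Require Import reals.
From mathcomp Require Import zify ring lra.

Set Implicit Arguments.
Unset Strict Implicit.
Unset Printing Implicit Defensive.

Import Order.TTheory GRing.Theory Num.Theory.

(** * A structured language over the machine *)

(** The running time concerns one concrete instruction list. The algorithm is therefore written in a
    structured language, verified by weakest preconditions and compiled; only loop iterations are
    counted, since between two of them the machine runs forward through code of constant size.
    Weights can only be added, subtracted and compared, and no positive constant is available. The
    penalty for trivial pairs is therefore [2 beta + w(g)] for some edge [g]. It exceeds [2 beta],
    and it is non-negative when [beta >= 0]; for [beta < 0] the graph [H] has no edges. The penalty
    is a path contribution too: the tree path between the two neighbours of a degree-two vertex
    consists of exactly the edges [e] and [f], so the product of its indicators at the row and at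
    the column marks this pair. Edges of the graph use the identity [A xor B = A + B - 2 A B]:
    linear and product terms are prefix sums of signed masses at interval ends, and the adjacency
    lists show every edge twice, whence the factor two. Merging is paid for by a potential, the sum
    over all columns of the logarithm of the class size. *)

Inductive ex :=
  | Cn of nat
  | Vr of nat
  | Bn of wordop & ex & ex
  | Lq of ex & ex
  | Eq of ex & ex
  | Ld of nat & ex
  | Dg of input & ex
  | Nb of input & ex & ex.

Inductive wex :=
  | Wz
  | Wv of nat
  | Wad of wex & wex
  | Wsb of wex & wex
  | Wld of nat & ex
  | Wwt of ex & ex.

Inductive cmd :=
  | Skip
  | Set_ of nat & ex
  | Sto of nat & ex & ex
  | WSet of nat & wex
  | WSto of nat & ex & wex
  | Pr of ex
  | Sq of cmd & cmd
  | Ife of ex & cmd & cmd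
  | Ifw of wex & wex & cmd & cmd
  | Wh of ex & cmd.

Notation "c1 ';;' c2" := (Sq c1 c2) (at level 60, right associativity).

Definition upd (T : Type) (f : nat -> T) (i : nat) (v : T) : nat -> T :=
  fun j => if j == i then v else f j.

(* Unlike [upd], meant to be computed away: register and array numbers are
   always literals. *)
Definition updn (T : Type) (f : nat -> T) (i : nat) (v : T) : nat -> T :=
  fun j => if Nat.eqb j i then v else f j.

Lemma updnE (T : Type) (f : nat -> T) i v j :
  updn f i v j = if j == i then v else f j.
Proof.
by rewrite /updn; case: eqP => [->|/PeanoNat.Nat.eqb_neq ->] //; rewrite PeanoNat.Nat.eqb_refl.
Qed.

Lemma upd_same (T : Type) (f : nat -> T) i v : upd f i v i = v.
Proof. by rewrite /upd eqxx. Qed.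

Lemma upd_diff (T : Type) (f : nat -> T) i v j : j <> i -> upd f i v j = f j.
Proof. by rewrite /upd => /eqP/negbTE ->. Qed.

(* Besides the contents of memory, a state counts the loop iterations made. *)
Record st (R : realType) := St {
  rg : nat -> nat;
  ar : nat -> nat -> nat;
  wr : nat -> R;
  wa : nat -> nat -> R;
  out : seq nat;
  tk : nat
}.

Section Language.
Variables (R : realType) (W n Ix : nat).
Variables (LG LT : adjlists n) (w : {set 'I_n} -> R).
Implicit Types (s : st R) (Q : st R -> Prop).

Definition sr s r v := St (updn (rg s) r v) (ar s) (wr s) (wa s) (out s) (tk s).
Definition sa s a i v :=
  St (rg s) (updn (ar s) a (upd (ar s a) i v)) (wr s) (wa s) (out s) (tk s).
Definition swr s r v := St (rg s) (ar s) (updn (wr s) r v) (wa s) (out s) (tk s).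
Definition swa s a i v :=
  St (rg s) (ar s) (wr s) (updn (wa s) a (upd (wa s a) i v)) (out s) (tk s).
Definition spr s v := St (rg s) (ar s) (wr s) (wa s) (rcons (out s) v) (tk s).
Definition tick s := St (rg s) (ar s) (wr s) (wa s) (out s) (tk s).+1.

Fixpoint ev s (e : ex) : nat :=
  match e with
  | Cn k => k
  | Vr r => rg s r
  | Bn o e1 e2 => word_eval o (ev s e1) (ev s e2)
  | Lq e1 e2 => ev s e1 <= ev s e2
  | Eq e1 e2 => ev s e1 == ev s e2
  | Ld a e => ar s a (ev s e)
  | Dg g e => query_deg (lists LG LT g) (ev s e)
  | Nb g e1 e2 => query_nbr (lists LG LT g) (ev s e1) (ev s e2)
  end.

(** Expressions are evaluated in unbounded naturals; under these conditions the result agrees with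
    arithmetic modulo [2 ^ W]. Truncated subtraction, division and remainder never exceed their
    first argument, so only [Add] and [Mul] are restricted. *)
Fixpoint ok s (e : ex) : Prop :=
  match e with
  | Cn _ | Vr _ => True
  | Bn o e1 e2 => ok s e1 /\ ok s e2 /\
      (match o with
       | Add => ev s e1 + ev s e2 < 2 ^ W
       | Mul => ev s e1 * ev s e2 < 2 ^ W
       | _ => True
       end)
  | Lq e1 e2 | Eq e1 e2 | Nb _ e1 e2 => ok s e1 /\ ok s e2
  | Ld a e => ok s e /\ ev s e < Ix
  | Dg _ e => ok s e
  end.

Fixpoint wev s (e : wex) : R :=
  match e with
  | Wz => 0%R
  | Wv r => wr s r
  | Wad e1 e2 => (wev s e1 + wev s e2)%R
  | Wsb e1 e2 => (wev s e1 - wev s e2)%R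
  | Wld a e => wa s a (ev s e)
  | Wwt e1 e2 => query_wt LG w (ev s e1) (ev s e2)
  end.

Fixpoint wok s (e : wex) : Prop :=
  match e with
  | Wz | Wv _ => True
  | Wad e1 e2 | Wsb e1 e2 => wok s e1 /\ wok s e2
  | Wld a e => ok s e /\ ev s e < Ix
  | Wwt e1 e2 => ok s e1 /\ ok s e2
  end.

Inductive exec : cmd -> st R -> st R -> Prop :=
  | xSkip s : exec Skip s s
  | xSet s r e : ok s e -> exec (Set_ r e) s (sr s r (ev s e))
  | xSto s a e1 e2 : ok s e1 -> ok s e2 -> ev s e1 < Ix ->
      exec (Sto a e1 e2) s (sa s a (ev s e1) (ev s e2))
  | xWSet s r e : wok s e -> exec (WSet r e) s (swr s r (wev s e))
  | xWSto s a e1 e2 : ok s e1 -> wok s e2 -> ev s e1 < Ix ->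
      exec (WSto a e1 e2) s (swa s a (ev s e1) (wev s e2))
  | xPr s e : ok s e -> exec (Pr e) s (spr s (ev s e))
  | xSq s1 s2 s3 c1 c2 : exec c1 s1 s2 -> exec c2 s2 s3 -> exec (Sq c1 c2) s1 s3
  | xIfe s s' e c1 c2 : ok s e -> exec (if 0 < ev s e then c1 else c2) s s' ->
      exec (Ife e c1 c2) s s'
  | xIfw s s' e1 e2 c1 c2 : wok s e1 -> wok s e2 ->
      exec (if (wev s e1 <= wev s e2)%R then c1 else c2) s s' ->
      exec (Ifw e1 e2 c1 c2) s s'
  | xWh0 s e c : ok s e -> ~~ (0 < ev s e) -> exec (Wh e c) s s
  | xWhS s s' s'' e c : ok s e -> 0 < ev s e -> exec c s s' ->
      exec (Wh e c) (tick s') s'' -> exec (Wh e c) s s''.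

(** A loop has no structural weakest precondition, so total correctness is stated by a terminating
    execution; invariants and variants enter through [wp_while]. *)
Definition wpw e c Q s : Prop := exists2 s', exec (Wh e c) s s' & Q s'.

Fixpoint wp (c : cmd) Q s : Prop :=
  match c with
  | Skip => Q s
  | Set_ r e => ok s e /\ Q (sr s r (ev s e))
  | Sto a e1 e2 =>
      [/\ ok s e1, ok s e2, ev s e1 < Ix & Q (sa s a (ev s e1) (ev s e2))]
  | WSet r e => wok s e /\ Q (swr s r (wev s e))
  | WSto a e1 e2 =>
      [/\ ok s e1, wok s e2, ev s e1 < Ix & Q (swa s a (ev s e1) (wev s e2))]
  | Pr e => ok s e /\ Q (spr s (ev s e))
  | Sq c1 c2 => wp c1 (wp c2 Q) s
  | Ife e c1 c2 => ok s e /\ (if 0 < ev s e then wp c1 Q s else wp c2 Q s)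
  | Ifw e1 e2 c1 c2 => [/\ wok s e1, wok s e2 &
      if (wev s e1 <= wev s e2)%R then wp c1 Q s else wp c2 Q s]
  | Wh e c => wpw e c Q s
  end.

Lemma wpP c Q s : wp c Q s <-> exists2 s', exec c s s' & Q s'.
Proof.
split.
- elim: c Q s => [|r e|a e1 e2|r e|a e1 e2|e|c1 IH1 c2 IH2|e c1 IH1 c2 IH2
    |e1 e2 c1 IH1 c2 IH2|e c IH] Q s //=.
  + by move=> ?; exists s => //; constructor.
  + by case=> ? ?; eexists; [constructor|].
  + by case=> ? ? ? ?; eexists; [constructor|].
  + by case=> ? ?; eexists; [constructor|].
  + by case=> ? ? ? ?; eexists; [constructor|].
  + by case=> ? ?; eexists; [constructor|].
  + by case/IH1=> s1 X1 /IH2 [s2 X2 ?]; exists s2 => //; apply: xSq X1 X2.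
  + case=> Ho; case: ifP => b => [/IH1|/IH2] [s' X ?]; exists s' => //;
      by constructor; rewrite ?b.
  + case=> ? ?; case: ifP => b => [/IH1|/IH2] [s' X ?]; exists s' => //;
      by constructor; rewrite ?b.
- case=> s' X; elim: X Q => //=.
  + by move=> s1 s2 s3 c1 c2 _ IH1 _ IH2 Q ?; apply/IH1/IH2.
  + by move=> s1 s2 e c1 c2 ? _; case: ifP => _ IH Q ?; split=> //; apply: IH.
  + by move=> s1 s2 e1 e2 c1 c2 ? ? _; case: ifP => _ IH Q ?; split=> //; apply: IH.
  + by move=> s1 e c0 ? ? Q ?; exists s1 => //; constructor.
  + by move=> s1 s2 s3 e c0 ? ? X1 _ X2 _ Q ?; exists s3 => //; apply: xWhS X1 X2.
Qed.

(* Reducing [wp] by conversion is exponential on sequences of conditionals. *)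
Lemma wp_seq c1 c2 Q s : wp c1 (wp c2 Q) s -> wp (c1 ;; c2) Q s.
Proof. by []. Qed.

Lemma wp_while_step e c Q s :
  ok s e ->
  (if 0 < ev s e then wp c (fun s' => wpw e c Q (tick s')) s else Q s) ->
  wpw e c Q s.
Proof.
move=> Hok; case: ifP => He; last by exists s => //; constructor; rewrite ?He.
case/wpP=> s1 X1 [s2 X2 HQ]; exists s2 => //; exact: xWhS X1 X2.
Qed.

Fixpoint mr c : seq nat :=
  match c with
  | Set_ r _ => [:: r]
  | Sq c1 c2 | Ife _ c1 c2 | Ifw _ _ c1 c2 => mr c1 ++ mr c2
  | Wh _ c => mr c
  | _ => [::]
  end.

Fixpoint ma c : seq nat :=
  match c with
  | Sto a _ _ => [:: a]
  | Sq c1 c2 | Ife _ c1 c2 | Ifw _ _ c1 c2 => ma c1 ++ ma c2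
  | Wh _ c => ma c
  | _ => [::]
  end.

Fixpoint mwr c : seq nat :=
  match c with
  | WSet r _ => [:: r]
  | Sq c1 c2 | Ife _ c1 c2 | Ifw _ _ c1 c2 => mwr c1 ++ mwr c2
  | Wh _ c => mwr c
  | _ => [::]
  end.

Fixpoint mwa c : seq nat :=
  match c with
  | WSto a _ _ => [:: a]
  | Sq c1 c2 | Ife _ c1 c2 | Ifw _ _ c1 c2 => mwa c1 ++ mwa c2
  | Wh _ c => mwa c
  | _ => [::]
  end.

Fixpoint mout c : bool :=
  match c with
  | Pr _ => true
  | Sq c1 c2 | Ife _ c1 c2 | Ifw _ _ c1 c2 => mout c1 || mout c2
  | Wh _ c => mout c
  | _ => false
  end.

(** The written registers and arrays are read off the syntax, so that facts about untouched memory
    follow by computation and need not be repeated in every invariant. The tick counter is left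
    out. *)
Record frame c s s' : Prop := Frame {
  fr_rg : forall r, r \notin mr c -> rg s' r = rg s r;
  fr_ar : forall a, a \notin ma c -> ar s' a = ar s a;
  fr_wr : forall r, r \notin mwr c -> wr s' r = wr s r;
  fr_wa : forall a, a \notin mwa c -> wa s' a = wa s a;
  fr_out : ~~ mout c -> out s' = out s
}.

Lemma frame_refl c s : frame c s s. Proof. by []. Qed.

Lemma frame_trans c s1 s2 s3 : frame c s1 s2 -> frame c s2 s3 -> frame c s1 s3.
Proof.
case=> h1 h2 h3 h4 h5 [g1 g2 g3 g4 g5]; split=> [r hr|a ha|r hr|a ha|ho].
- by rewrite g1 // h1.
- by rewrite g2 // h2.
- by rewrite g3 // h3.
- by rewrite g4 // h4.
- by rewrite g5 // h5.
Qed.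

Lemma exec_frame c s s' : exec c s s' -> frame c s s'.
Proof.
elim=> {c s s'} //=.
- by move=> s r e ?; split=> //= x; rewrite inE updnE => /negbTE->.
- by move=> s r e ? ? ? ?; split=> //= x; rewrite inE updnE => /negbTE->.
- by move=> s r e ?; split=> //= x; rewrite inE updnE => /negbTE->.
- by move=> s r e ? ? ? ?; split=> //= x; rewrite inE updnE => /negbTE->.
- move=> s1 s2 s3 c1 c2 _ [h1 h2 h3 h4 h5] _ [g1 g2 g3 g4 g5].
  split=> [r|a|r|a|] /=; rewrite ?mem_cat ?negb_or => /andP[i1 i2].
  + by rewrite g1 // h1.
  + by rewrite g2 // h2.
  + by rewrite g3 // h3.
  + by rewrite g4 // h4.
  + by rewrite g5 // h5.
- move=> s s' e c1 c2 _ _; case: ifP => _ [h1 h2 h3 h4 h5];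
  split=> [r|a|r|a|] /=; rewrite ?mem_cat ?negb_or => /andP[i1 i2]; auto.
- move=> s s' e1 e2 c1 c2 _ _ _; case: ifP => _ [h1 h2 h3 h4 h5];
  split=> [r|a|r|a|] /=; rewrite ?mem_cat ?negb_or => /andP[i1 i2]; auto.
- move=> s s' s'' e c _ _ _ [h1 h2 h3 h4 h5] _ [g1 g2 g3 g4 g5].
  split=> [r hr|a ha|r hr|a ha|ho].
  + by rewrite g1 // h1.
  + by rewrite g2 // h2.
  + by rewrite g3 // h3.
  + by rewrite g4 // h4.
  + by rewrite g5 // h5.
Qed.

Lemma wpw_use e c Q1 Q s :
  wpw e c Q1 s -> (forall s', frame (Wh e c) s s' -> Q1 s' -> Q s') -> wpw e c Q s.
Proof. by case=> s' X H1 H; exists s' => //; apply: H => //; apply: exec_frame. Qed.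

Lemma wp_use c Q1 Q s :
  wp c Q1 s -> (forall s', frame c s s' -> Q1 s' -> Q s') -> wp c Q s.
Proof.
by move=> /wpP[s' X H1] H; apply/wpP; exists s' => //; apply: H => //; apply: exec_frame.
Qed.

(* In the loop body the frame relative to the start of the loop is known. *)
Lemma wp_while (I : st R -> Prop) (mu : st R -> nat) e c Q s :
  I s ->
  (forall s', frame (Wh e c) s s' -> I s' -> ok s' e /\
     if 0 < ev s' e then wp c (fun s'' => I (tick s'') /\ mu (tick s'') < mu s') s'
     else Q s') ->
  wpw e c Q s.
Proof.
move=> Is H; suff G k s0 : mu s0 < k -> I s0 -> frame (Wh e c) s s0 -> wpw e c Q s0.
  by apply: (G (mu s).+1) => //; apply: frame_refl.
elim: k s0 => // k IH s0 lek Is0 F0.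
have [Hok Hs] := H _ F0 Is0; apply: wp_while_step => //; move: Hs; case: ifP => // He.
move=> Hs; apply: (wp_use Hs) => s' F [Is' lt].
apply: IH => //; first by apply: leq_trans lt _.
apply: frame_trans F0 _; case: F => ? ? ? ? ?; split=> //.
Qed.

(** * Compilation *)

(* Cells below 32 are registers, cells 32 to 62 temporaries, and cell 63 is
   always zero; the arrays are interleaved above. *)
Definition addr a i := 64 * i.+1 + a.

(** The offset is folded into the constant [64 + a], which stays below 128 for [a < 64] and so fits
    in a word under [bigW]. *)
Definition addrcode a d :=
  [:: Const d.+1 64; Op Mul d d d.+1; Const d.+1 (64 + a); Op Add d d d.+1].

Arguments addrcode : simpl never.

(** Stack discipline: the value ends in cell [d] and the cells below [d] are preserved, so the first
    operand survives the evaluation of the second in [d.+1]. Truncated subtraction gives the tests: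
    [a <= b] is [1 - (a - b)], and [a = b] is [1 - ((a - b) + (b - a))]. Adding the zero cell 63
    copies a register. *)
Fixpoint cx (d : nat) (e : ex) : program :=
  match e with
  | Cn k => [:: Const d k]
  | Vr r => [:: Op Add d r 63]
  | Bn o e1 e2 => cx d e1 ++ cx d.+1 e2 ++ [:: Op o d d d.+1]
  | Lq e1 e2 => cx d e1 ++ cx d.+1 e2 ++
      [:: Op Defs.Sub d d d.+1; Const d.+1 1; Op Defs.Sub d d.+1 d]
  | Eq e1 e2 => cx d e1 ++ cx d.+1 e2 ++
      [:: Op Defs.Sub d.+2 d d.+1; Op Defs.Sub d d.+1 d; Op Add d d d.+2;
          Const d.+1 1; Op Defs.Sub d d.+1 d]
  | Ld a e => cx d e ++ addrcode a d ++ [:: Read d d]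
  | Dg g e => cx d e ++ [:: Deg g d d]
  | Nb g e1 e2 => cx d e1 ++ cx d.+1 e2 ++ [:: Nbr g d d d.+1]
  end.

Fixpoint cw (d : nat) (e : wex) : program :=
  match e with
  | Wz => [:: WAdd d 63 63]
  | Wv r => [:: WAdd d r 63]
  | Wad e1 e2 => cw d e1 ++ cw d.+1 e2 ++ [:: WAdd d d d.+1]
  | Wsb e1 e2 => cw d e1 ++ cw d.+1 e2 ++ [:: WSub d d d.+1]
  | Wld a e => cx 32 e ++ addrcode a 32 ++ [:: WRead d 32]
  | Wwt e1 e2 => cx 32 e1 ++ cx 33 e2 ++ [:: Wt d 32 33]
  end.

(** Jump targets are absolute, hence the load address [p]. [JumpLe 63 63] is an unconditional jump,
    and [JumpLe 32 63] tests whether cell 32 is zero. In [Ifw] the branch for a true comparison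
    comes last, because the weight comparison jumps when it holds. *)
Fixpoint cc (p : nat) (c : cmd) : program :=
  match c with
  | Skip => [::]
  | Set_ r e => cx 32 e ++ [:: Op Add r 32 63]
  | Sto a e1 e2 => cx 32 e1 ++ addrcode a 32 ++ cx 33 e2 ++ [:: Write 32 33]
  | WSet r e => cw 32 e ++ [:: WAdd r 32 63]
  | WSto a e1 e2 => cw 32 e2 ++ cx 32 e1 ++ addrcode a 32 ++ [:: WWrite 32 32]
  | Pr e => cx 32 e ++ [:: Out 32]
  | Sq c1 c2 => let k1 := cc p c1 in k1 ++ cc (p + size k1) c2
  | Ife e c1 c2 =>
      let t := cx 32 e in
      let k1 := cc (p + (size t).+1) c1 in
      let k2 := cc (p + (size t + size k1).+2) c2 in
      t ++ JumpLe 32 63 (p + (size t + size k1).+2) :: k1 ++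
      JumpLe 63 63 (p + (size t + size k1 + size k2).+2) :: k2
  | Ifw e1 e2 c1 c2 =>
      let t := cw 32 e1 ++ cw 33 e2 in
      let k2 := cc (p + (size t).+1) c2 in
      let k1 := cc (p + (size t + size k2).+2) c1 in
      t ++ WJumpLe 32 33 (p + (size t + size k2).+2) :: k2 ++
      JumpLe 63 63 (p + (size t + size k2 + size k1).+2) :: k1
  | Wh e c =>
      let t := cx 32 e in
      let k := cc (p + (size t).+1) c in
      t ++ JumpLe 32 63 (p + (size t + size k).+2) :: k ++ [:: JumpLe 63 63 p]
  end.

(** Code at level [d] touches cells up to [d.+2], so [d < 60] keeps it away from the zero cell
    63. *)
Fixpoint wfx d (e : ex) : bool :=
  match e with
  | Cn k => (d < 60) && (k <= 64)
  | Vr r => (d < 60) && (r < 32)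
  | Bn _ e1 e2 | Lq e1 e2 | Eq e1 e2 | Nb _ e1 e2 => wfx d e1 && wfx d.+1 e2
  | Ld a e => (a < 64) && wfx d e
  | Dg _ e => wfx d e
  end.

Fixpoint wfw d (e : wex) : bool :=
  match e with
  | Wz => d < 60
  | Wv r => (d < 60) && (r < 32)
  | Wad e1 e2 | Wsb e1 e2 => wfw d e1 && wfw d.+1 e2
  | Wld a e => [&& d < 60, a < 64 & wfx 32 e]
  | Wwt e1 e2 => [&& d < 60, wfx 32 e1 & wfx 33 e2]
  end.

Fixpoint wfc (c : cmd) : bool :=
  match c with
  | Skip => true
  | Set_ r e => (r < 32) && wfx 32 e
  | Sto a e1 e2 => [&& a < 64, wfx 32 e1 & wfx 33 e2]
  | WSet r e => (r < 32) && wfw 32 e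
  | WSto a e1 e2 => [&& a < 64, wfx 32 e1 & wfw 32 e2]
  | Pr e => wfx 32 e
  | Sq c1 c2 => wfc c1 && wfc c2
  | Ife e c1 c2 => [&& wfx 32 e, wfc c1 & wfc c2]
  | Ifw e1 e2 c1 c2 => [&& wfw 32 e1, wfw 33 e2, wfc c1 & wfc c2]
  | Wh e c => wfx 32 e && wfc c
  end.

Hypothesis bigW : 128 * Ix.+1 <= 2 ^ W.
Hypothesis deg_small : forall g a, query_deg (lists LG LT g) a < 2 ^ W.
Hypothesis nbr_small : forall g a i, query_nbr (lists LG LT g) a i < 2 ^ W.

(** [sim_b] is there because copying a cell is an addition, which reduces modulo [2 ^ W]. *)
Record sim s (c : config R) : Prop := Sim {
  sim_rg : forall r, r < 32 -> wordmem c r = rg s r;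
  sim_ar : forall a i, a < 64 -> wordmem c (addr a i) = ar s a i;
  sim_z : wordmem c 63 = 0;
  sim_b : forall x, wordmem c x < 2 ^ W;
  sim_wr : forall r, r < 32 -> weightmem c r = wr s r;
  sim_wa : forall a i, a < 64 -> weightmem c (addr a i) = wa s a i;
  sim_wz : weightmem c 63 = 0%R;
  sim_out : Defs.output c = out s
}.

Notation mexec := (Defs.exec W LG LT w).
Definition xs (c : config R) (l : program) := foldl (fun c i => mexec i c) c l.

Lemma xs_cat c l1 l2 : xs c (l1 ++ l2) = xs (xs c l1) l2.
Proof. exact: foldl_cat. Qed.

Record keep d (c c' : config R) : Prop := Keep {
  kp_w : forall x, (x < d) || (62 < x) -> wordmem c' x = wordmem c x;
  kp_z : weightmem c' = weightmem c;
  kp_o : Defs.output c' = Defs.output c;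
  kp_b : forall x, wordmem c' x < 2 ^ W
}.

Lemma keep_sim d s c c' : 32 <= d -> keep d c c' -> sim s c -> sim s c'.
Proof.
move=> hd [k1 k2 k3 k4] [h1 h2 h3 h4 h5 h6 h7 h8]; split=> //; rewrite ?k2 ?k3 //.
- by move=> r hr; rewrite k1 ?h1 //; apply/orP; left; lia.
- by move=> a i ha; rewrite k1 ?h2 // /addr; apply/orP; right; lia.
- by rewrite k1 // orbT.
Qed.

Lemma keep_trans d d' c1 c2 c3 :
  d <= d' -> keep d c1 c2 -> keep d' c2 c3 -> keep d c1 c3.
Proof.
move=> hd [k1 k2 k3 k4] [l1 l2 l3 l4]; split; rewrite ?l2 ?l3 //.
by move=> x hx; rewrite l1 ?k1 //; move: hx => /orP[] ?; apply/orP; [left; lia|right].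
Qed.

Definition tmpi d (i : instr) : bool :=
  match i with
  | Const x _ | Op _ x _ _ | Read x _ | Deg _ x _ | Nbr _ x _ _ => d <= x <= 62
  | _ => false
  end.

Lemma xs_keep d l c :
  (forall y, wordmem c y < 2 ^ W) -> all (tmpi d) l -> keep d c (xs c l).
Proof.
elim: l c => [|i l IH] c hb; first by split.
case/andP=> hi hl; rewrite -[xs c _]/(xs (mexec i c) l).
have [x [v [-> hx]]] : exists x v, mexec i c = setword W c x v /\ d <= x <= 62.
  by case: i hi => //= [x v|o x a b|x a|g x a|g x a b] hx; exists x; eexists.
have K : keep d c (setword W c x v).
  split=> //= y; last by case: eqP => // _; rewrite ltn_mod expn_gt0.
  by case: eqP => // -> /orP[]; lia.
apply: (keep_trans (leqnn d) K); apply: IH => //; exact: kp_b K.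
Qed.

Lemma wfx_lt d e : wfx d e -> d < 60.
Proof.
by elim: e d => [k|r|o e1 IH1 e2 _|e1 IH1 e2 _|e1 IH1 e2 _|a e IH|g e IH|g e1 IH1 e2 _] d /=;
  [case/andP|case/andP|case/andP=> /IH1|case/andP=> /IH1|case/andP=> /IH1
  |case/andP=> _ /IH|move/IH|case/andP=> /IH1].
Qed.

Lemma wfx_tmp d e : wfx d e -> all (tmpi d) (cx d e).
Proof.
have mono l d1 : all (tmpi d1.+1) l -> all (tmpi d1) l.
  by apply: sub_all => -[] //= *; lia.
elim: e d => [k|r|o e1 IH1 e2 IH2|e1 IH1 e2 IH2|e1 IH1 e2 IH2|a e IH|g e IH|g e1 IH1 e2 IH2] d /=.
- by rewrite andbT; lia.
- by rewrite andbT; lia.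
- case/andP=> h1 h2; have := wfx_lt h2; rewrite !all_cat IH1 // mono ?IH2 //= => ?; lia.
- case/andP=> h1 h2; have := wfx_lt h2; rewrite !all_cat IH1 // mono ?IH2 //= => ?; lia.
- case/andP=> h1 h2; have := wfx_lt h2; rewrite !all_cat IH1 // mono ?IH2 //= => ?; lia.
- case/andP=> h1 h2; have := wfx_lt h2; rewrite !all_cat IH // /addrcode /= => ?; lia.
- by move=> h; have := wfx_lt h; rewrite !all_cat IH //= => ?; lia.
- case/andP=> h1 h2; have := wfx_lt h2; rewrite !all_cat IH1 // mono ?IH2 //= => ?; lia.
Qed.

Lemma cx_keep d e c :
  (forall y, wordmem c y < 2 ^ W) -> wfx d e -> keep d c (xs c (cx d e)).
Proof. by move=> hb hw; apply: xs_keep => //; apply: wfx_tmp. Qed.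

Lemma addr_keep d a c :
  (forall y, wordmem c y < 2 ^ W) -> d < 60 -> keep d c (xs c (addrcode a d)).
Proof. by move=> hb hd; apply: xs_keep => //; rewrite /addrcode /=; lia. Qed.

Lemma addrcode_ok a d c i :
  a < 64 -> wordmem c d = i -> i < Ix -> wordmem (xs c (addrcode a d)) d = addr a i.
Proof.
move=> ha hi hI; have hE : (d == d.+1) = false by lia.
rewrite /addrcode /= !eqxx !hE /= hi.
rewrite (@modn_small 64); last by lia.
rewrite (@modn_small (i * 64)); last by lia.
rewrite (@modn_small (64 + a)); last by lia.
by rewrite modn_small /addr; lia.
Qed.

Lemma cx_ok e d s c :
  32 <= d -> wfx d e -> sim s c -> ok s e -> wordmem (xs c (cx d e)) d = ev s e.
Proof.
have two d0 e1 e2 s0 c0 :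
  (forall d s c, 32 <= d -> wfx d e1 -> sim s c -> ok s e1 ->
     wordmem (xs c (cx d e1)) d = ev s e1) ->
  (forall d s c, 32 <= d -> wfx d e2 -> sim s c -> ok s e2 ->
     wordmem (xs c (cx d e2)) d = ev s e2) ->
  32 <= d0 -> wfx d0 e1 -> wfx d0.+1 e2 -> sim s0 c0 -> ok s0 e1 -> ok s0 e2 ->
  let c1 := xs (xs c0 (cx d0 e1)) (cx d0.+1 e2) in
  [/\ wordmem c1 d0 = ev s0 e1, wordmem c1 d0.+1 = ev s0 e2,
     ev s0 e1 < 2 ^ W & ev s0 e2 < 2 ^ W].
  move=> I1 I2 hd w1 w2 hs o1 o2 c1.
  have K1 := cx_keep (sim_b hs) w1.
  have S1 := keep_sim hd K1 hs.
  have K2 := cx_keep (sim_b S1) w2.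
  have E1 : wordmem c1 d0 = ev s0 e1 by rewrite (kp_w K2) ?ltnSn // (I1 _ s0).
  have E2 : wordmem c1 d0.+1 = ev s0 e2 by rewrite (I2 _ s0) //; lia.
  by split=> //; rewrite -?E1 -?E2; apply: kp_b K2 _.
elim: e d s c => [k|r|o e1 IH1 e2 IH2|e1 IH1 e2 IH2|e1 IH1 e2 IH2|a e IH|g e IH|g e1 IH1 e2 IH2] d s c hd /=.
- by move=> hw hs _; rewrite eqxx modn_small //; lia.
- by case/andP=> h1 h2 hs _; rewrite eqxx (sim_z hs) addn0 modn_small ?(sim_b hs) // (sim_rg hs).
- case/andP=> w1 w2 hs [o1 [o2 o3]]; rewrite !xs_cat.
  have [E1 E2 l1 l2] := two _ _ _ _ _ IH1 IH2 hd w1 w2 hs o1 o2.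
  rewrite /= eqxx E1 E2 modn_small //; case: o o3 => //= _.
  + by apply: leq_ltn_trans l1; lia.
  + by apply: leq_ltn_trans l1; apply: leq_div.
  + by apply: leq_ltn_trans l1; apply: leq_mod.
- case/andP=> w1 w2 hs [o1 o2]; rewrite !xs_cat.
  have [E1 E2 l1 l2] := two _ _ _ _ _ IH1 IH2 hd w1 w2 hs o1 o2.
  have hE : (d == d.+1) = false by lia.
  rewrite /= !eqxx !hE /= E1 E2 (@modn_small 1); last lia.
  by rewrite (@modn_small (_ - _)) ?modn_small; lia.
- case/andP=> w1 w2 hs [o1 o2]; rewrite !xs_cat.
  have [E1 E2 l1 l2] := two _ _ _ _ _ IH1 IH2 hd w1 w2 hs o1 o2.
  have hE : (d == d.+1) = false by lia.
  have hE2 : (d.+2 == d) = false by lia.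
  have hE3 : (d.+1 == d.+2) = false by lia.
  have hE4 : (d == d.+2) = false by lia.
  have hE5 : (d.+1 == d) = false by lia.
  rewrite /= !(eqxx, hE, hE2, hE3, hE4, hE5) /= E1 E2 (@modn_small 1); last lia.
  rewrite (@modn_small (ev s e1 - ev s e2)); last lia.
  rewrite (@modn_small (ev s e2 - ev s e1)); last lia.
  rewrite (@modn_small (_ + _)); last lia.
  by rewrite modn_small; lia.
- case/andP=> ha wx hs [o1 o2]; rewrite -[_ :: _]/(addrcode a d ++ [:: Read d d]) !xs_cat.
  have K1 := cx_keep (sim_b hs) wx.
  have K2 := addr_keep a (kp_b K1) (wfx_lt wx).
  have S2 := keep_sim hd K2 (keep_sim hd K1 hs).
  have E := addrcode_ok ha (IH _ _ _ hd wx hs o1) o2.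
  move: (xs _ (addrcode a d)) K2 S2 E => c2 K2 S2 E.
  by rewrite /= eqxx E -(sim_ar S2) // modn_small // (kp_b K2).
- move=> wx hs o1; rewrite !xs_cat /= eqxx (IH _ s) // modn_small //.
- case/andP=> w1 w2 hs [o1 o2]; rewrite !xs_cat.
  have [E1 E2 l1 l2] := two _ _ _ _ _ IH1 IH2 hd w1 w2 hs o1 o2.
  by rewrite /= eqxx E1 E2 modn_small.
Qed.

Record wkeep d (c c' : config R) : Prop := WKeep {
  wk_w : forall x, (x < 32) || (62 < x) -> wordmem c' x = wordmem c x;
  wk_z : forall x, (x < d) || (62 < x) -> weightmem c' x = weightmem c x;
  wk_o : Defs.output c' = Defs.output c;
  wk_b : forall x, wordmem c' x < 2 ^ W
}.

Lemma wkeep_sim d s c c' : 32 <= d -> wkeep d c c' -> sim s c -> sim s c'.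
Proof.
move=> hd [k1 k2 k3 k4] [h1 h2 h3 h4 h5 h6 h7 h8]; split=> //; rewrite ?k3 //.
- by move=> r hr; rewrite k1 ?h1 // hr.
- by move=> a i ha; rewrite k1 ?h2 // /addr; apply/orP; right; lia.
- by rewrite k1 // orbT.
- by move=> r hr; rewrite k2 ?h5 //; apply/orP; left; lia.
- by move=> a i ha; rewrite k2 ?h6 // /addr; apply/orP; right; lia.
- by rewrite k2 // orbT.
Qed.

Lemma keep_wkeep d c c' : keep 32 c c' -> wkeep d c c'.
Proof. by case=> h1 h2 h3 h4; split=> // x _; rewrite h2. Qed.

Lemma wkeep_trans d d' c1 c2 c3 :
  d <= d' -> wkeep d c1 c2 -> wkeep d' c2 c3 -> wkeep d c1 c3.
Proof.
move=> hd [k1 k2 k3 k4] [l1 l2 l3 l4]; split; rewrite ?l3 //.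
  by move=> x hx; rewrite l1 ?k1.
by move=> x hx; rewrite l2 ?k2 //; move: hx => /orP[] ?; apply/orP; [left; lia|right].
Qed.

Lemma wkeep_set d x v c :
  (forall y, wordmem c y < 2 ^ W) -> d <= x <= 62 -> wkeep d c (setweight c x v).
Proof. by move=> hb hx; split=> //= y; case: eqP => // -> /orP[]; lia. Qed.

Lemma wfw_lt d e : wfw d e -> d < 60.
Proof.
by elim: e d => [|r|e1 IH1 e2 _|e1 IH1 e2 _|a e|e1 e2] d //=;
  [case/andP|case/andP=> /IH1|case/andP=> /IH1|case/and3P|case/and3P].
Qed.

Lemma index_ok a e s c :
  a < 64 -> wfx 32 e -> sim s c -> ok s e -> ev s e < Ix ->
  let c' := xs (xs c (cx 32 e)) (addrcode a 32) in
  [/\ keep 32 c c', sim s c' & wordmem c' 32 = addr a (ev s e)].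
Proof.
move=> ha wx hs o1 o2 c'.
have K1 := cx_keep (sim_b hs) wx.
have K2 := addr_keep a (kp_b K1) (wfx_lt wx).
have K := keep_trans (leqnn 32) K1 K2; split=> //; first exact: keep_sim K hs.
by apply: addrcode_ok => //; apply: cx_ok.
Qed.

Lemma cw_ok e d s c :
  32 <= d -> wfw d e -> sim s c -> wok s e ->
  wkeep d c (xs c (cw d e)) /\ weightmem (xs c (cw d e)) d = wev s e.
Proof.
elim: e d s c => [|r|e1 IH1 e2 IH2|e1 IH1 e2 IH2|a e|e1 e2] d s c hd /=.
- move=> hw hs _; rewrite eqxx (sim_wz hs) GRing.addr0; split=> //.
  by apply: wkeep_set; [exact: sim_b hs | lia].
- case/andP=> hw hr hs _; rewrite eqxx (sim_wz hs) GRing.addr0 (sim_wr hs) //; split=> //.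
  by apply: wkeep_set; [exact: sim_b hs | lia].
- case/andP=> w1 w2 hs [o1 o2]; rewrite !xs_cat.
  have [K1 E1] := IH1 _ _ _ hd w1 hs o1.
  have [|K2 E2] := IH2 _ _ _ _ w2 (wkeep_sim hd K1 hs) o2; first lia.
  rewrite /= eqxx E2 (wk_z K2) ?ltnSn // E1; split=> //.
  have K12 := wkeep_trans (leqnSn d) K1 K2; have := wfw_lt w1 => ?.
  by apply: (wkeep_trans (leqnn d) K12); apply: wkeep_set (wk_b K2) _; lia.
- case/andP=> w1 w2 hs [o1 o2]; rewrite !xs_cat.
  have [K1 E1] := IH1 _ _ _ hd w1 hs o1.
  have [|K2 E2] := IH2 _ _ _ _ w2 (wkeep_sim hd K1 hs) o2; first lia.
  rewrite /= eqxx E2 (wk_z K2) ?ltnSn // E1; split=> //.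
  have K12 := wkeep_trans (leqnSn d) K1 K2; have := wfw_lt w1 => ?.
  by apply: (wkeep_trans (leqnn d) K12); apply: wkeep_set (wk_b K2) _; lia.
- case/and3P=> ld ha wx hs [o1 o2].
  rewrite -[Const 33 64 :: _]/(addrcode a 32 ++ [:: WRead d 32]) !xs_cat.
  have [K S E] := index_ok ha wx hs o1 o2.
  rewrite /= !eqxx; split; last by rewrite -(sim_wa S) // -E.
  by apply: (wkeep_trans (leqnn d) (keep_wkeep d K)); apply: wkeep_set (kp_b K) _; lia.
- case/and3P=> ld w1 w2 hs [o1 o2]; rewrite !xs_cat.
  have K1 := cx_keep (sim_b hs) w1; have S1 := keep_sim (leqnn 32) K1 hs.
  have K2 := cx_keep (sim_b S1) w2.
  have K := keep_trans (leqnSn 32) K1 K2.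
  rewrite /= eqxx (kp_w K2) // (cx_ok _ w1 hs) // (cx_ok _ w2 S1) //; split=> //.
  by apply: (wkeep_trans (leqnn d) (keep_wkeep d K)); apply: wkeep_set (kp_b K) _; lia.
Qed.

Definition straight (i : instr) : bool :=
  match i with JumpLe _ _ _ | WJumpLe _ _ _ => false | _ => true end.

Definition code_at (P : program) p (l : program) :=
  forall i, i < size l -> onth P (p + i) = onth l i.

Lemma code_at_cat P p l1 l2 :
  code_at P p (l1 ++ l2) -> code_at P p l1 /\ code_at P (p + size l1) l2.
Proof.
move=> H; split=> i hi.
  by rewrite H ?size_cat ?ltn_addr // !onthE map_cat nth_cat size_map hi.
rewrite -addnA H ?size_cat ?ltn_add2l // !onthE map_cat nth_cat size_map.
by rewrite ltnNge leq_addr addKn.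
Qed.

(** * Executing compiled code *)

Section Run.
Variable P : program.
Notation mstep := (step P W LG LT w).

Lemma step_at p i l c : code_at P p (i :: l) -> pc c = p -> mstep c = mexec i c.
Proof. by move=> /(_ 0 isT); rewrite addn0 /step => H ->; rewrite H. Qed.

Lemma run_straight p l c :
  code_at P p l -> all straight l -> pc c = p ->
  iter (size l) mstep c = xs c l /\ pc (xs c l) = p + size l.
Proof.
elim: l p c => [|i l IH] p c; first by rewrite addn0.
move=> H /andP[hi hl] hp; rewrite [size _]/= iterSr (step_at H hp) addnS -addSn.
apply: IH => //; first by move=> j hj; rewrite addSnnS H.
by case: i hi {H} => //= *; rewrite hp.
Qed.

Lemma cx_straight d e : all straight (cx d e).
Proof. by elim: e d => //= *; rewrite ?all_cat; do ![apply/andP; split]. Qed.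

Lemma cw_straight d e : all straight (cw d e).
Proof. by elim: e d => //= *; rewrite ?all_cat ?cx_straight; do ![apply/andP; split]. Qed.

(** Between two loop iterations control only moves forward and meets each instruction at most once.
    One code length per tick, plus one, therefore bounds the machine steps. *)
Definition simulated c s s' :=
  forall p m, wfc c -> code_at P p (cc p c) -> pc m = p -> sim s m ->
  exists t, [/\ sim s' (iter t mstep m), pc (iter t mstep m) = p + size (cc p c),
    tk s <= tk s' & t <= size (cc p c) * (tk s' - tk s).+1].

Lemma simulated_straight c s s' :
  tk s' = tk s -> (forall p, all straight (cc p c)) ->
  (forall p m, wfc c -> sim s m -> sim s' (xs m (cc p c))) -> simulated c s s'.
Proof.
move=> ht hc H p m hw hp hm hs; exists (size (cc p c)).
have [-> ->] := run_straight hp (hc p) hm; split=> //; first exact: H.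
- by rewrite ht.
- by rewrite ht subnn muln1.
Qed.

Lemma sim_setword s c r v : 
  r < 32 -> sim s c -> v < 2 ^ W -> sim (sr s r v) (setword W c r v).
Proof.
move=> hr [h1 h2 h3 h4 h5 h6 h7 h8] hv; split=> //=; rewrite ?(modn_small hv).
- by move=> x hx; rewrite updnE; case: eqP => // _; apply: h1.
- by move=> a i ha; case: eqP => [|_]; [rewrite /addr; lia | apply: h2].
- by case: eqP => // ?; lia.
- by move=> x; case: eqP.
Qed.

Lemma addr_inj a a' i i' : a < 64 -> a' < 64 -> addr a i = addr a' i' -> a = a' /\ i = i'.
Proof. rewrite /addr; lia. Qed.

Lemma sim_setarr s c a i v : 
  a < 64 -> sim s c -> v < 2 ^ W -> sim (sa s a i v) (setword W c (addr a i) v).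
Proof.
move=> ha [h1 h2 h3 h4 h5 h6 h7 h8] hv; split=> //=; rewrite ?(modn_small hv).
- by move=> x hx; case: eqP => [|_]; [rewrite /addr; lia | apply: h1].
- move=> a' i' ha'; rewrite updnE; case: eqP => [/addr_inj[]// -> ->|ne].
    by rewrite eqxx upd_same.
  case: eqP => [E|_]; last exact: h2.
  by rewrite -E upd_diff ?h2 // => E'; apply: ne; rewrite E E'.
- by case: eqP => // E; move: E; rewrite /addr; lia.
- by move=> x; case: eqP.
Qed.

Lemma sim_setweight s c r v :
  r < 32 -> sim s c -> sim (swr s r v) (setweight c r v).
Proof.
move=> hr [h1 h2 h3 h4 h5 h6 h7 h8]; split=> //=.
- by move=> x hx; rewrite updnE; case: eqP => // _; apply: h5.
- by move=> a i ha; case: eqP => [|_]; [rewrite /addr; lia | apply: h6].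
- by case: eqP => // ?; lia.
Qed.

Lemma sim_setwarr s c a i v : 
  a < 64 -> sim s c -> sim (swa s a i v) (setweight c (addr a i) v).
Proof.
move=> ha [h1 h2 h3 h4 h5 h6 h7 h8]; split=> //=.
- by move=> x hx; case: eqP => [|_]; [rewrite /addr; lia | apply: h5].
- move=> a' i' ha'; rewrite updnE; case: eqP => [/addr_inj[]// -> ->|ne].
    by rewrite eqxx upd_same.
  case: eqP => [E|_]; last exact: h6.
  by rewrite -E upd_diff ?h6 // => E'; apply: ne; rewrite E E'.
- by case: eqP => // E; move: E; rewrite /addr; lia.
Qed.

Lemma sim_jump s c b l : sim s c -> sim s (jump_if c b l).
Proof. by case=> *; split. Qed.

Lemma exec_simulated c s s' : exec c s s' -> simulated c s s'.
Proof.
elim=> {c s s'}.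
- by move=> s; apply: simulated_straight.
- move=> s r e o; apply: simulated_straight => //= [p|p m /andP[hr wx] hs].
    by rewrite all_cat cx_straight.
  have K := cx_keep (sim_b hs) wx; have S := keep_sim (leqnn 32) K hs.
  rewrite xs_cat /= (cx_ok _ wx hs) // (sim_z S) addn0; apply: sim_setword => //.
  by rewrite -(cx_ok _ wx hs) // (kp_b K).
- move=> s a e1 e2 o1 o2 lI; apply: simulated_straight => //= [p|p m /and3P[ha w1 w2] hs].
    by rewrite !(all_cat, cx_straight) /= all_cat cx_straight.
  rewrite -[Const 33 64 :: _]/(addrcode a 32 ++ cx 33 e2 ++ [:: Write 32 33]) !xs_cat.
  have [K S E] := index_ok ha w1 hs o1 lI.
  move: (xs (xs m (cx 32 e1)) (addrcode a 32)) K S E => c1 K S E.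
  have K2 := cx_keep (sim_b S) w2; have S2 := keep_sim (leqnSn 32) K2 S.
  rewrite /= (cx_ok _ w2 S) // (kp_w K2) // E; apply: sim_setarr => //.
  by rewrite -(cx_ok _ w2 S) // (kp_b K2).
- move=> s r e o; apply: simulated_straight => //= [p|p m /andP[hr wx] hs].
    by rewrite all_cat cw_straight.
  have [K E] := cw_ok (leqnn 32) wx hs o; have S := wkeep_sim (leqnn 32) K hs.
  by rewrite xs_cat /= E (sim_wz S) GRing.addr0; apply: sim_setweight.
- move=> s a e1 e2 o1 o2 lI; apply: simulated_straight => //= [p|p m /and3P[ha w1 w2] hs].
    by rewrite !(all_cat, cx_straight, cw_straight).
  rewrite -[Const 33 64 :: _]/(addrcode a 32 ++ [:: WWrite 32 32]) xs_cat xs_cat.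
  have [K E] := cw_ok (leqnn 32) w2 hs o2; have S := wkeep_sim (leqnn 32) K hs.
  rewrite xs_cat.
  have [K2 S2 E2] := index_ok ha w1 S o1 lI.
  move: (xs (xs _ (cx 32 e1)) (addrcode a 32)) K2 S2 E2 => c1 K2 S2 E2.
  by rewrite /= E2 (kp_z K2) E; apply: sim_setwarr.
- move=> s e o; apply: simulated_straight => //= [p|p m wx hs].
    by rewrite all_cat cx_straight.
  have K := cx_keep (sim_b hs) wx; have S := keep_sim (leqnn 32) K hs.
  rewrite xs_cat /= (cx_ok _ wx hs) //.
  by case: S => h1 h2 h3 h4 h5 h6 h7 h8; split=> //=; rewrite h8.
- move=> s1 s2 s3 c1 c2 _ IH1 _ IH2 p m /= /andP[w1 w2] /code_at_cat[H1 H2] hp hs.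
  have [t1 [S1 p1 k1 l1]] := IH1 _ _ w1 H1 hp hs.
  have [t2 [S2 p2 k2 l2]] := IH2 _ _ w2 H2 p1 S1.
  exists (t2 + t1); rewrite iterD size_cat p2 addnA; split=> //; first lia.
  set a := size _ in l1 *; set b := size _ in l2 *.
  apply: leq_trans (leq_add l2 l1) _; rewrite mulnDl addnC leq_add // leq_mul //; lia.
- move=> s s' e c1 c2 o _ IH p m /= /and3P[wx w1 w2].
  set t := cx 32 e; set k1 := cc _ c1; set k2 := cc _ c2.
  move=> /code_at_cat[Ht Hr] hp hs.
  have K := cx_keep (sim_b hs) wx; have S := keep_sim (leqnn 32) K hs.
  have [rt pt] := run_straight Ht (cx_straight _ _) hp.
  have /= st1 := step_at Hr pt.
  rewrite -/t (cx_ok _ wx hs) // (sim_z S) leqn0 -leqn0 leqNgt in st1.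
  move: Hr; rewrite -cat1s => /code_at_cat[_]; rewrite addn1 => /code_at_cat[H1].
  move=> Hr; move: (Hr); rewrite -cat1s => /code_at_cat[_ H2].
  rewrite ?size_cat /= ?size_cat /=.
  move: IH; case: ifP st1 => b st1 IH.
  + have [||||t1 [S1 p1 l1 l2]] := IH (p + (size t).+1) (iter (size t).+1 mstep m) => //.
    * by rewrite -addnS in H1.
    * by rewrite iterS rt st1 /= pt addnS.
    * by rewrite iterS rt st1; apply: sim_jump.
    rewrite -/k1 in p1 l2.
    exists (1 + (t1 + (size t).+1)); rewrite iterD (iterD t1) /=.
    have p1' : pc (iter t1 mstep (mstep (iter (size t) mstep m))) = (p + size t).+1 + size k1.
      by rewrite -iterS p1 addnS.
    rewrite (step_at Hr p1') /= leqnn; split=> //.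
    * exact: sim_jump.
    * lia.
    * by move: l2; nia.
  + have [||||t1 [S1 p1 l1 l2]] := IH (p + (size t + size k1).+2) (iter (size t).+1 mstep m) => //.
    * have E : (p + size t).+1 + size k1 + 1 = p + (size t + size k1).+2 by lia.
      by rewrite /= E in H2.
    * by rewrite iterS rt st1.
    * by rewrite iterS rt st1; apply: sim_jump.
    rewrite -/k2 in p1 l2.
    exists (t1 + (size t).+1); rewrite iterD; split=> //; first by rewrite p1; lia.
    by move: l2; nia.
- move=> s s' e1 e2 c1 c2 o1 o2 _ IH p m /= /and4P[wx1 wx2 w1 w2].
  set t := cw 32 e1 ++ cw 33 e2; set k2 := cc _ c2; set k1 := cc _ c1.
  move=> /code_at_cat[Ht Hr] hp hs.
  have [K1 E1] := cw_ok (leqnn 32) wx1 hs o1; have S1 := wkeep_sim (leqnn 32) K1 hs.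
  have [K2 E2] := cw_ok (leqnSn 32) wx2 S1 o2; have S := wkeep_sim (leqnSn 32) K2 S1.
  have [|rt pt] := run_straight Ht _ hp; first by rewrite all_cat !cw_straight.
  have /= st1 := step_at Hr pt.
  rewrite -xs_cat -/t in E2 S K2.
  rewrite E2 (wk_z K2) // E1 in st1.
  move: Hr; rewrite -cat1s => /code_at_cat[_]; rewrite addn1 => /code_at_cat[H1].
  move=> Hr; move: (Hr); rewrite -cat1s => /code_at_cat[_ H2].
  rewrite (size_cat t) [size (_ :: _)]/= (size_cat k2) [size (_ :: _)]/=.
  move: IH; case: ifP st1 => b st1 IH.
  + have [||||t1 [S1' p1 l1 l2]] := IH (p + (size t + size k2).+2) (iter (size t).+1 mstep m) => //.
    * have E : (p + size t).+1 + size k2 + 1 = p + (size t + size k2).+2 by lia.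
      by rewrite /= E in H2.
    * by rewrite iterS rt st1.
    * by rewrite iterS rt st1; apply: sim_jump.
    rewrite -/k1 in p1 l2.
    exists (t1 + (size t).+1); rewrite iterD; split=> //; first by rewrite p1; lia.
    by move: l2; nia.
  + have [||||t1 [S1' p1 l1 l2]] := IH (p + (size t).+1) (iter (size t).+1 mstep m) => //.
    * by rewrite -addnS in H1.
    * by rewrite iterS rt st1 /= pt addnS.
    * by rewrite iterS rt st1; apply: sim_jump.
    rewrite -/k2 in p1 l2.
    exists (1 + (t1 + (size t).+1)); rewrite iterD (iterD t1) /=.
    have p1' : pc (iter t1 mstep (mstep (iter (size t) mstep m))) = (p + size t).+1 + size k2.
      by rewrite -iterS p1 addnS.
    rewrite (step_at Hr p1') /= leqnn; split=> //.
    * exact: sim_jump.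
    * lia.
    * by move: l2; nia.
- move=> s e c o b p m /= /andP[wx w1].
  set t := cx 32 e; set k := cc _ c; move=> /code_at_cat[Ht Hr] hp hs.
  have K := cx_keep (sim_b hs) wx; have S := keep_sim (leqnn 32) K hs.
  have [rt pt] := run_straight Ht (cx_straight _ _) hp.
  have /= st1 := step_at Hr pt.
  rewrite -/t (cx_ok _ wx hs) // (sim_z S) leqn0 -leqn0 leqNgt b in st1.
  exists (size t).+1; rewrite iterS rt st1 !size_cat /= size_cat /=; split=> //.
  + exact: sim_jump.
  + lia.
  + by rewrite subnn muln1; lia.
- move=> s s1 s2 e c o b _ IH1 _ IH2 p m /= /andP[wx w1].
  have := IH2 p; rewrite /= => {}IH2.
  set t := cx 32 e in IH2 *; set k := cc _ c in IH2 *; move=> H0 hp hs.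
  have /code_at_cat[Ht Hr] := H0.
  have K := cx_keep (sim_b hs) wx; have S := keep_sim (leqnn 32) K hs.
  have [rt pt] := run_straight Ht (cx_straight _ _) hp.
  have /= st1 := step_at Hr pt.
  rewrite -/t (cx_ok _ wx hs) // (sim_z S) leqn0 -leqn0 leqNgt b /= in st1.
  move: Hr; rewrite -cat1s => /code_at_cat[_]; rewrite addn1 => /code_at_cat[H1 Hr].
  have [||||t1 [S1 p1 l1 l2]] := IH1 (p + (size t).+1) (iter (size t).+1 mstep m) => //.
  + by rewrite -addnS in H1.
  + by rewrite iterS rt st1 /= pt addnS.
  + by rewrite iterS rt st1; apply: sim_jump.
  rewrite -/k -iterD in S1 p1 l2.
  have p1' : pc (iter (t1 + (size t).+1) mstep m) = (p + size t).+1 + size k.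
    by rewrite p1 addnS.
  have /= st2 := step_at Hr p1'; rewrite leqnn in st2.
  have [||||t2 [S2 p2 k2 l2']] := IH2 (iter (t1 + (size t).+1).+1 mstep m) => //.
  + by rewrite wx w1.
  + by rewrite iterS st2.
  + by rewrite iterS st2; apply: sim_jump; case: S1 => *; split.
  rewrite -iterD in S2 p2.
  exists (t2 + (t1 + (size t).+1).+1); split=> //; first by move: k2 => /=; lia.
  move: k2 l2' => /= k2.
  rewrite ?size_cat /= ?size_cat /= => l2'.
  set x := size t + (size k + 1).+1 in l2' *.
  (* The ticks split into those of the first iteration, including its own, and the rest; each share
     pays for its own part of the run. *)
  have -> : tk s2 - tk s = (tk s2 - (tk s1).+1) + (tk s1 - tk s).+1 by lia.
  rewrite -[X in _ <= x * X]addSn mulnDr; apply: leq_add => //; apply: leq_trans (_ : x * (tk s1 - tk s).+1 <= _) => //.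
  rewrite /x; move: l2; set y := tk s1 - tk s; nia.
Qed.

End Run.
End Language.

Lemma injective_bound (m n : nat) (f : nat -> nat) :
  (forall k, k < m -> f k < n) ->
  (forall k l, k < m -> l < m -> f k = f l -> k = l) -> m <= n.
Proof.
move=> lt inj; rewrite -(size_iota 0 m) -(size_map f) -(size_iota 0 n).
apply: uniq_leq_size.
  rewrite map_inj_in_uniq ?iota_uniq // => k l; rewrite !mem_iota /= !add0n.
  exact: inj.
by move=> _ /mapP[k +] ->; rewrite !mem_iota /= !add0n; apply: lt.
Qed.

Lemma sum_upd m (f : nat -> nat) p v : p < m ->
  (\sum_(0 <= k < m) (upd f p v k).+1) + f p = (\sum_(0 <= k < m) (f k).+1) + v.
Proof.
move=> pm; have inm : p \in index_iota 0 m by rewrite mem_index_iota.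
rewrite !(bigD1_seq p inm (iota_uniq _ _)) /= upd_same.
rewrite (eq_bigr (fun k => (f k).+1)); first lia.
by move=> k kp; rewrite upd_diff //; apply/eqP.
Qed.

Notation "a '+~' b" := (Bn Add a b) (at level 50, left associativity).
Notation "a '-~' b" := (Bn Defs.Sub a b) (at level 50, left associativity).
Notation "a '&&~' b" := (Bn Mul a b) (at level 57).
Notation "a '/~' b" := (Bn Div a b) (at level 40, left associativity).
Notation "a '<=~' b" := (Lq a b) (at level 55).
Notation "a '<~' b" := (Lq (Bn Add a (Cn 1)) b) (at level 55).
Notation "a '==~' b" := (Eq a b) (at level 55).
Notation "'$' r" := (Vr r) (at level 5, format "'$' r").
Notation "a '@' e" := (Ld a e) (at level 10).
Notation "r '<-~' e" := (Set_ r e) (at level 58).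

(** * Registers and arrays *)

Notation rNn := 0 (only parsing).
Notation rI := 1 (only parsing).
Notation rJ := 2 (only parsing).
Notation rT := 3 (only parsing).
Notation rU := 4 (only parsing).
Notation rV := 5 (only parsing).
Notation rP := 6 (only parsing).
Notation rN := 7 (only parsing).
Notation rK := 8 (only parsing).
Notation rC := 9 (only parsing).
Notation rA := 10 (only parsing).
Notation rB := 11 (only parsing).
Notation rX := 12 (only parsing).
Notation rE := 13 (only parsing).
Notation rF := 14 (only parsing).
Notation rM := 15 (only parsing).
Notation rG := 16 (only parsing).
Notation rL := 17 (only parsing).
Notation rI1 := 18 (only parsing).
Notation rI2 := 19 (only parsing).
Notation rCi := 20 (only parsing).
Notation rH := 21 (only parsing).

Notation aQ := 0 (only parsing).
Notation aVis := 1 (only parsing).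
Notation aBp := 2 (only parsing).
Notation aSz := 3 (only parsing).
Notation aHs := 4 (only parsing).
Notation aHv := 5 (only parsing).
Notation aPosb := 6 (only parsing).
Notation aPos := 7 (only parsing).
Notation aVert := 8 (only parsing).
Notation aHead := 9 (only parsing).
Notation aPp := 10 (only parsing).
Notation aMk := 11 (only parsing).
Notation aHd := 12 (only parsing).
Notation aNx := 13 (only parsing).
Notation aCol := 14 (only parsing).
Notation aI1 := 15 (only parsing).
Notation aI2 := 16 (only parsing).
Notation aComp := 17 (only parsing).
Notation aNxt := 18 (only parsing).
Notation aCsz := 19 (only parsing).
Notation aOrd := 20 (only parsing).

(** * Programs for breadth-first order, subtree sizes and heavy paths *)

Definition c_bfs :=
  Sto aVis (Cn 0) (Cn 1) ;; rT <-~ Cn 1 ;; rI <-~ Cn 0 ;;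
  Wh ($rI <~ $rT)
    (rJ <-~ Cn 0 ;;
     Wh ($rJ <~ Dg InT (aQ @ $rI))
       (rU <-~ Nb InT (aQ @ $rI) $rJ ;;
        Ife (aVis @ $rU ==~ Cn 0)
          (Sto aVis $rU (Cn 1) ;; Sto aQ $rT $rU ;; Sto aBp $rT $rI ;;
           rT <-~ $rT +~ Cn 1)
          Skip ;;
        rJ <-~ $rJ +~ Cn 1) ;;
     rI <-~ $rI +~ Cn 1).

(** [aSz] holds the subtree size minus one, so that the initial zeros are right for leaves. [aHv] is
    a child with largest subtree; 0 means none, as the root has queue position 0 and is nobody's
    child. *)
Definition c_sizes :=
  rI <-~ $rNn -~ Cn 1 ;;
  Wh (Cn 1 <=~ $rI)
    (rP <-~ aBp @ $rI ;; rX <-~ aSz @ $rI +~ Cn 1 ;;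
     Sto aSz $rP (aSz @ $rP +~ $rX) ;;
     Ife (aHs @ $rP <~ $rX) (Sto aHs $rP $rX ;; Sto aHv $rP $rI) Skip ;;
     rI <-~ $rI -~ Cn 1).

(** [aPosb] is stored at [$rU] before it is read at the parent of [$rU]. As the root is its own
    parent, its entry in [aPp] becomes 0. *)
Definition c_chain :=
  Wh $rG
    (Sto aHead $rC $rX ;; Sto aPosb $rU $rC ;; Sto aPos (aQ @ $rU) $rC ;;
     Sto aVert $rC (aQ @ $rU) ;; Sto aPp $rC (aPosb @ (aBp @ $rU)) ;;
     Sto aOrd $rC $rU ;;
     rC <-~ $rC +~ Cn 1 ;; rU <-~ aHv @ $rU ;; rG <-~ Cn 1 <=~ $rU).

(** In breadth-first order the parent of the head of a new path is already numbered, so every vertex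
    other than the root gets a larger number than its parent. *)
Definition c_chains :=
  rC <-~ Cn 0 ;; rI <-~ Cn 0 ;;
  Wh ($rI <~ $rNn)
    (Ife ((Cn 1 <=~ $rI) &&~ (aHv @ (aBp @ $rI) ==~ $rI)) Skip
       (rU <-~ $rI ;; rX <-~ $rC ;; rG <-~ Cn 1 ;; c_chain) ;;
     rI <-~ $rI +~ Cn 1).

Ltac wps := cbn [wp ev ok wev wok rg ar wr wa out tk sr sa swr swa spr tick updn
  Nat.eqb word_eval lists].

Ltac wp1 := cbn [wp].

Ltac spl := repeat match goal with
  | |- True => exact I
  | |- _ /\ _ => split
  | |- and3 _ _ _ => split
  | |- and4 _ _ _ _ => split
  | |- and5 _ _ _ _ _ => split
  end.

(** * Correctness of the heavy path layout *)

Section Layout.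
Variables (R : realType) (W n Ix : nat).
Variables (LG LT : adjlists n) (w : {set 'I_n} -> R).
Hypothesis bigW : 128 * Ix.+1 <= 2 ^ W.
Hypothesis n_gt0 : 0 < n.
Hypothesis nIx : 4 * n.+4 <= Ix.
Notation wp := (wp W Ix LG LT w).
Implicit Types s : st R.

Definition nb (L : adjlists n) v := [seq val u | u <- nbrs L v].

Lemma nb_lt L v u : u \in nb L v -> u < n.
Proof. by case/mapP=> x _ ->; apply: ltn_ord. Qed.

Lemma query_degE L v : query_deg L v = size (nb L v).
Proof. by rewrite size_map. Qed.

Lemma query_nbrE L v j : query_nbr L v j = nth 0 (nb L v) j.
Proof. by []. Qed.

Hypothesis deg_le : forall L v, L = LG \/ L = LT -> size (nb L v) <= n.

(** Connectivity of [T] as an induction from vertex 0, to be applied to the set of visited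
    vertices. *)
Hypothesis connT : forall P : nat -> Prop, P 0 ->
  (forall v u, v < n -> P v -> u \in nb LT v -> P u) -> forall v, v < n -> P v.

(** [bp] records queue positions, not vertices: a parent precedes its children numerically, so later
    passes run over indices instead of recursing. *)
Record bfs_inv (q vis bp : nat -> nat) t : Prop := BfsInv {
  bi_t : 0 < t;
  bi_q0 : q 0 = 0;
  bi_lt : forall k, k < t -> q k < n;
  bi_inj : forall k l, k < t -> l < t -> q k = q l -> k = l;
  bi_vis : forall v, 0 < vis v <-> exists2 k, k < t & q k = v;
  bi_bp : forall k, 0 < k < t -> bp k < k /\ q k \in nb LT (q (bp k));
  bi_bp0 : bp 0 = 0
}.

Lemma bfs_inv_step q vis bp t i u :
  bfs_inv q vis bp t -> i < t -> u \in nb LT (q i) -> vis u = 0 ->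
  bfs_inv (upd q t u) (upd vis u 1) (upd bp t i) t.+1 /\ t < n.
Proof.
move=> [h1 h2 h3 h4 h5 h6 h7] it uq vu.
have new k : k < t -> q k <> u.
  move=> kt E; suff : 0 < vis u by rewrite vu.
  by apply/h5; exists k.
have qt k : k < t -> upd q t u k = q k by move=> kt; rewrite upd_diff //; lia.
have lt k : k < t.+1 -> upd q t u k < n.
  rewrite ltnS leq_eqVlt => /orP[/eqP->|kt]; first by rewrite upd_same; apply: nb_lt uq.
  by rewrite qt // h3.
have inj k l : k < t.+1 -> l < t.+1 -> upd q t u k = upd q t u l -> k = l.
  move=> kt lt'; case: (ltngtP k t) => [k1|k1|->]; case: (ltngtP l t) => [l1|l1|->] //; try lia;
    rewrite ?upd_same ?qt //.
  - exact: h4.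
  - by move=> E; case: (new _ k1).
  - by move=> E; case: (new _ l1).
split; last exact: injective_bound inj.
split=> //.
- by rewrite qt.
- move=> v; rewrite /upd; split.
    case: eqP => [->|ne].
      by move=> _; exists t; rewrite ?ltnSn // eqxx.
    by case/h5=> k kt E; exists k; [lia | case: eqP => // ?; lia].
  case=> k; case: eqP => [->|ne] kt; first by move=> ->; rewrite eqxx.
  case: eqP => // _ E; apply/h5; exists k => //; lia.
- move=> k /andP[k0]; rewrite ltnS leq_eqVlt => /orP[/eqP->|kt].
    by rewrite !upd_same; split=> //; rewrite qt.
  have [|b1 b2] := h6 k; first by rewrite k0.
  rewrite [upd bp _ _ _]upd_diff; last lia.
  by split=> //; rewrite !qt //; lia.
- by rewrite upd_diff //; lia.
Qed.

Definition zero_arr s (l : seq nat) := forall a i, a \in l -> ar s a i = 0.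

Lemma bfs_inv_all q vis bp t :
  bfs_inv q vis bp t -> (forall k u, k < t -> u \in nb LT (q k) -> 0 < vis u) ->
  t = n /\ forall v, v < n -> exists2 k, k < n & q k = v.
Proof.
move=> I closed.
have all v : v < n -> 0 < vis v.
  move: v; apply: connT; first by apply/(bi_vis I); exists 0; [exact: bi_t I | exact: bi_q0 I].
  by move=> v u vn /(bi_vis I)[k kt <-]; apply: closed.
have tn : t = n; last first.
  by subst t; split=> // v /all /(bi_vis I).
apply/eqP; rewrite eqn_leq (injective_bound (bi_lt I) (bi_inj I)) /=.
suff : size (iota 0 n) <= size (map q (iota 0 t)) by rewrite size_map !size_iota.
apply: uniq_leq_size (iota_uniq _ _) _ => v; rewrite mem_iota /= add0n => /all/(bi_vis I)[k kt <-].
by apply/mapP; exists k; rewrite ?mem_iota.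
Qed.

Lemma bfs_spec s : rg s rNn = n -> zero_arr s [:: aQ; aVis; aBp] ->
  wp c_bfs (fun s' =>
    [/\ bfs_inv (ar s' aQ) (ar s' aVis) (ar s' aBp) n,
        forall v, v < n -> exists2 k, k < n & ar s' aQ k = v
      & tk s' <= tk s + n + \sum_(0 <= k < n) size (nb LT (ar s' aQ k))]) s.
Proof.
move=> hn hz; rewrite /c_bfs; wps; split=> //; first lia.
split=> //; split=> //.
pose I s' := [/\ bfs_inv (ar s' aQ) (ar s' aVis) (ar s' aBp) (rg s' rT), rg s' rI <= rg s' rT,
  (forall k u, k < rg s' rI -> u \in nb LT (ar s' aQ k) -> 0 < ar s' aVis u) &
  tk s' <= tk s + rg s' rI + \sum_(0 <= k < rg s' rI) size (nb LT (ar s' aQ k))].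
apply: (wp_while (I := I) (mu := fun s' => n - rg s' rI)).
  rewrite /I; wps; split=> //; last by rewrite big_geq // addn0 addn0.
  split=> //.
  - by rewrite hz.
  - by move=> k; case: k => // _; rewrite hz.
  - by move=> k l; lia.
  - move=> v; rewrite /upd; case: eqP => [->|ne].
      by split=> // _; exists 0 => //; rewrite hz.
    rewrite hz //; split=> // -[k k1]; rewrite hz // => E; lia.
  - by move=> k; lia.
  - by rewrite hz.
move=> s2 F [I1 I2 I3 I4]; wps.
have tn : rg s2 rT <= n := injective_bound (bi_lt I1) (bi_inj I1).
split; first by spl; lia.
rewrite lt0b addn1; case: ifP => it; last first.
  have E : rg s2 rI = rg s2 rT by lia.
  have [|E' all] := bfs_inv_all I1; first by rewrite -E.
  by rewrite E E' in I1 I4 *; split.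
split=> //.
pose J s' := [/\ bfs_inv (ar s' aQ) (ar s' aVis) (ar s' aBp) (rg s' rT),
  rg s2 rT <= rg s' rT, forall k, k < rg s2 rT -> ar s' aQ k = ar s2 aQ k,
  [/\ rg s' rJ <= size (nb LT (ar s2 aQ (rg s2 rI))),
  forall v, 0 < ar s2 aVis v -> 0 < ar s' aVis v &
  forall j, j < rg s' rJ -> 0 < ar s' aVis (nth 0 (nb LT (ar s2 aQ (rg s2 rI))) j)] &
  tk s' <= tk s2 + rg s' rJ].
apply: (@wpw_use _ _ _ _ _ _ _ _ _ (fun s' => J s' /\ rg s' rJ = size (nb LT (ar s2 aQ (rg s2 rI))))).
  apply: (wp_while (I := J) (mu := fun s' => size (nb LT (ar s2 aQ (rg s2 rI))) - rg s' rJ)).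
    by rewrite /J; wps; split=> //; lia.
  move=> s4 F4 [J1 J2 J3 [J4 J5 J6] J7]; wps.
  have EI : rg s4 rI = rg s2 rI by rewrite (fr_rg F4).
  have tn4 : rg s4 rT <= n := injective_bound (bi_lt J1) (bi_inj J1).
  have dn : size (nb LT (ar s2 aQ (rg s2 rI))) <= n by apply: deg_le; right.
  have Eq : ar s4 aQ (rg s4 rI) = ar s2 aQ (rg s2 rI) by rewrite EI J3.
  split; first by spl; lia.
  rewrite lt0b query_degE Eq; case: ifP => jt; last by split; [split | lia].
  have uin : nth 0 (nb LT (ar s2 aQ (rg s2 rI))) (rg s4 rJ) \in nb LT (ar s2 aQ (rg s2 rI)).
    by apply: mem_nth; rewrite -addn1.
  have un := nb_lt uin.
  split; first by spl; lia.
  rewrite query_nbrE; split; first by spl; lia.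
  rewrite lt0b; case: eqP => vis0; wps.
    have [||B Btn] := bfs_inv_step (i := rg s4 rI) J1 _ _ vis0; rewrite ?Eq //; first lia.
    rewrite /J; wps; spl; try lia; rewrite ?addn1 // /upd.
    - by move=> k kt; rewrite J3 //; case: eqP => // ?; lia.
    - by move=> v /J5; case: eqP.
    - move=> j; rewrite ltnS leq_eqVlt => /orP[/eqP->|/J6]; first by rewrite eqxx.
      by case: eqP.
  rewrite /J; wps; spl; try lia; rewrite ?addn1 //.
  by move=> j; rewrite ltnS leq_eqVlt => /orP[/eqP->|/J6] //; lia.
move=> s4 F4 [[J1 J2 J3 [J4 J5 J6] J7] Ej].
have EI : rg s4 rI = rg s2 rI by rewrite (fr_rg F4).
have tn4 : rg s4 rT <= n := injective_bound (bi_lt J1) (bi_inj J1).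
have QE k : k < (rg s2 rI).+1 -> ar s4 aQ k = ar s2 aQ k by move=> ?; apply: J3; lia.
split; first by spl; lia.
rewrite ?EI ?addn1; split; last by wps; lia.
split; wps => //; first lia.
- move=> k u; rewrite ltnS leq_eqVlt => /orP[/eqP->|kt].
    by rewrite QE // => /(nthP 0)[j jl <-]; apply: J6; rewrite Ej.
  by rewrite QE; [move=> /(I3 _ _ kt); apply: J5 | lia].
- rewrite big_nat_recr //= QE //.
  rewrite (eq_big_nat _ _ (F2 := fun k => size (nb LT (ar s2 aQ k)))); first lia.
  by move=> k hk; rewrite QE //; lia.
Qed.

(** The sum over the indices still to be processed stays [n], because a processed vertex hands its
    whole size to its parent; this bounds every size. The last clause of [zi_c] is the point: a
    light child and a sibling at least as large both fit below the parent, so passing a light edge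
    at least doubles the subtree size. *)
Record size_inv (bp sz hs hv : nat -> nat) i : Prop := SizeInv {
  zi_sum : \sum_(0 <= k < i.+1) (sz k).+1 = n;
  zi_hs : forall p, hs p <= sz p;
  zi_c : forall c, i < c < n -> [/\ sz c < n, (sz c).+1 <= hs (bp c) &
    c != hv (bp c) -> (sz c).+1 + hs (bp c) <= sz (bp c)];
  zi_hv : forall p, hv p != 0 -> [/\ i < hv p < n, bp (hv p) = p & (sz (hv p)).+1 = hs p]
}.

Lemma sizes_spec s : rg s rNn = n -> zero_arr s [:: aSz; aHs; aHv] ->
  (forall k, 0 < k < n -> ar s aBp k < k) ->
  wp c_sizes (fun s' =>
    size_inv (ar s' aBp) (ar s' aSz) (ar s' aHs) (ar s' aHv) 0 /\ tk s' <= tk s + n) s.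
Proof.
move=> hn hz hbp; rewrite /c_sizes; wps; split=> //; rewrite hn.
pose I s' := [/\ size_inv (ar s' aBp) (ar s' aSz) (ar s' aHs) (ar s' aHv) (rg s' rI),
  rg s' rI < n & tk s' + rg s' rI <= tk s + n].
apply: (wp_while (I := I) (mu := fun s' => rg s' rI)).
  rewrite /I; wps; split; [|lia..]; split=> [|p|c|p]; try lia.
  - rewrite subn1 prednK // (eq_bigr (fun=> 1)); last by move=> k _; rewrite hz.
    by rewrite sum_nat_const_nat subn0 muln1.
  - by rewrite !hz.
  - by rewrite hz.
move=> s2 F [[S1 S2 S3 S4] I2 I3]; wps; split=> //; rewrite lt0b; case: ifP => i0; last first.
  have E : rg s2 rI = 0 by lia.
  by rewrite E in S1 S2 S3 S4 I3; split; [split|lia].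
have EB : ar s2 aBp = ar s aBp by rewrite (fr_ar F).
have lt : ar s2 aBp (rg s2 rI) < rg s2 rI by rewrite EB; apply: hbp; lia.
set i := rg s2 rI in lt *; set p := ar s2 aBp i in lt *; set sz := ar s2 aSz in S1 S2 S3 S4 *.
set hs := ar s2 aHs in S1 S2 S3 S4 *; set hv := ar s2 aHv in S1 S2 S3 S4 *.
have Si : \sum_(0 <= k < i) (sz k).+1 + (sz i).+1 = n by rewrite -S1 big_nat_recr.
have Sp : (sz p).+1 <= \sum_(0 <= k < i) (sz k).+1.
  by rewrite (bigD1_seq p) ?mem_index_iota ?iota_uniq //= leq_addr.
set x := sz i + 1; have xE : x = (sz i).+1 by rewrite /x addn1.
have S1' : \sum_(0 <= k < i) (upd sz p (sz p + x) k).+1 = n.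
  by have := sum_upd sz (sz p + x) lt; lia.
have hsp := S2 p.
split; first by spl; lia.
split; first by spl; lia.
split; try by spl; lia.
split; first by spl; lia.
rewrite lt0b addn1; have pi : p != i by lia.
have i' : (i - 1).+1 = i by lia.
case: ifP => hsx; wps.
  rewrite /I; wps; spl; try lia; rewrite -/sz -/hs -/hv -/p; split=> //.
  - by rewrite i'.
  - by move=> q; rewrite /upd; case: eqP => // _; lia.
  - move=> c /andP[c1 c2]; case: (eqVneq c i) => [->|ci].
      rewrite -/p !upd_same [upd sz _ _ i]upd_diff; last lia.
      by split; [lia | lia | rewrite eqxx].
    have [|z1 z2 z3] := S3 c; first lia.
    rewrite [upd sz _ _ c]upd_diff; last lia.
    rewrite /upd; case: eqP => [E|_]; last by split.
    rewrite E in z2 z3; split=> //; first lia.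
    (* The size [x] of the new heavy child is added on both sides, so for an earlier child
       [(sz c).+1 <= hs p <= sz p] suffices. *)
    by case: (eqVneq c (hv p)) => [cE|/z3 ?] _; have := S2 p; lia.
  - move=> q; case: (eqVneq q p) => [->|/eqP qp].
      rewrite !upd_same => _; rewrite upd_diff; last lia.
      by split=> //; lia.
    rewrite !(upd_diff _ _ qp) => h; have [h1 h2 h3] := S4 q h; split=> //; first lia.
    by rewrite upd_diff //; lia.
rewrite /I; wps; spl; try lia; rewrite -/sz -/hs -/hv -/p; split=> //.
- by rewrite i'.
- by move=> q; rewrite /upd; case: eqP => [->|_] //; have := S2 p; lia.
- move=> c /andP[c1 c2]; case: (eqVneq c i) => [->|ci].
    rewrite -/p !upd_same [upd sz _ _ i]upd_diff; last lia.
    by split; [lia | lia | have := S2 p; lia].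
  have [|z1 z2 z3] := S3 c; first lia.
  rewrite [upd sz _ _ c]upd_diff; last lia.
  split=> // /z3; rewrite /upd; case: eqP => [<-|_] //; lia.
- move=> q h; have [h1 h2 h3] := S4 q h; split=> //; first lia.
  by rewrite upd_diff //; lia.
Qed.

(** By [ch_h] a position either starts a path, being the root or a light child, or continues the
    path of the preceding position as its heavy child. [ch_head] dates the heads by the outer loop
    index [i], which shows that [i] itself is not yet a head. *)
Record chain_inv (q bp hv posb pos vert h pp ord : nat -> nat) i c : Prop := ChainInv {
  ch_ord : forall k, k < c -> [/\ ord k < n, posb (ord k) = k, vert k = q (ord k)
    & pos (q (ord k)) = k];
  ch_pp : forall k, k < c -> 0 < ord k -> pp k < k /\ ord (pp k) = bp (ord k);
  ch_h : forall k, k < c ->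
    (h k = k /\ (ord k = 0 \/ hv (bp (ord k)) <> ord k)) \/
    [/\ 0 < k, pp k = k.-1, h k = h k.-1 & 0 < ord k /\ hv (ord k.-1) = ord k];
  ch_head : forall k, k < c -> h k = k -> ord k < i;
  ch_root : 0 < c -> ord 0 = 0 /\ pp 0 = 0
}.

Definition laid (ord posb : nat -> nat) c i := posb i < c /\ ord (posb i) = i.

Lemma laid_next ord posb d u j : (forall k, k < d -> ord k <> u) ->
  laid ord posb d j -> laid (upd ord d u) (upd posb u d) d.+1 j.
Proof.
move=> new [l1 l2]; have ju : j <> u by rewrite -l2; apply: new.
rewrite /laid (upd_diff _ _ ju) upd_diff; last lia.
by split=> //; apply: leqW.
Qed.

Lemma laid_new ord posb d u : laid (upd ord d u) (upd posb u d) d.+1 u.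
Proof. by rewrite /laid !upd_same. Qed.

Lemma chain_inv_leq q bp hv posb pos vert h pp ord i i' c :
  i <= i' -> chain_inv q bp hv posb pos vert h pp ord i c ->
  chain_inv q bp hv posb pos vert h pp ord i' c.
Proof.
by move=> ii [h1 h2 h3 h4 h5]; split=> // k kc hk; apply: leq_trans (h4 k kc hk) ii.
Qed.

Lemma chain_inv_inj q bp hv posb pos vert h pp ord i c k l :
  chain_inv q bp hv posb pos vert h pp ord i c -> k < c -> l < c ->
  ord k = ord l -> k = l.
Proof.
move=> I kc lc E; have [_ <- _ _] := ch_ord I kc; rewrite E.
by have [_ -> _ _] := ch_ord I lc.
Qed.

Lemma chain_inv_le q bp hv posb pos vert h pp ord i c :
  chain_inv q bp hv posb pos vert h pp ord i c -> c <= n.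
Proof.
move=> I; apply: (@injective_bound _ _ ord) => [k kc|k l kc lc].
  by have [] := ch_ord I kc.
exact: chain_inv_inj I kc lc.
Qed.

Lemma chain_inv_next q bp hv posb pos vert h pp ord i c u x :
  (forall k l, k < n -> l < n -> q k = q l -> k = l) ->
  (forall k, 0 < k < n -> bp k < k) -> bp 0 = 0 ->
  chain_inv q bp hv posb pos vert h pp ord i c ->
  u < n -> (forall k, k < c -> ord k <> u) ->
  (u = 0 -> c = 0) -> (0 < u -> laid ord posb c (bp u)) ->
  (x = c /\ (u = 0 \/ hv (bp u) <> u) /\ u < i) \/
    [/\ 0 < c, bp u = ord c.-1, x = h c.-1 & 0 < u /\ hv (ord c.-1) = u] ->
  chain_inv q bp hv (upd posb u c) (upd pos (q u) c) (upd vert c (q u)) (upd h c x)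
    (upd pp c (upd posb u c (bp u))) (upd ord c u) i c.+1.
Proof.
move=> qinj bplt bp0 I un new u0 par hd.
have old k (f : nat -> nat) v : k < c -> upd f c v k = f k.
  by move=> kc; rewrite upd_diff //; lia.
split.
- move=> k; rewrite ltnS leq_eqVlt => /orP[/eqP->|kc]; first by rewrite !upd_same.
  have [o1 o2 o3 o4] := ch_ord I kc; rewrite !old //.
  by split=> //; rewrite upd_diff //; [apply: new | move=> /qinj E; apply: (new k kc); apply: E].
- move=> k; rewrite ltnS leq_eqVlt => /orP[/eqP->|kc].
    rewrite !upd_same => u_gt; have [l1 l2] := par u_gt.
    have lt : bp u < u by apply: bplt; rewrite u_gt.
    by rewrite [upd posb _ _ _]upd_diff; [rewrite old | lia].
  rewrite (old k ord) // (old k pp) // => /(ch_pp I kc)[p1 p2]; split=> //; rewrite old //; lia.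
- move=> k; rewrite ltnS leq_eqVlt => /orP[/eqP->|kc].
    rewrite !upd_same; case: hd => [[-> [? _]]|[c0 bE -> [hu0 hE]]]; first by left.
    right; have [l1 l2] := par hu0; rewrite bE in l1 l2.
    have lt : bp u < u by apply: bplt; rewrite hu0.
    rewrite !old ?(@leq_pred c) //; try lia; split=> //.
    rewrite [upd posb _ _ _]upd_diff ?bE; last lia.
    by have [|_ -> _ _] := @ch_ord _ _ _ _ _ _ _ _ _ _ _ I c.-1; first lia.
  case: (ch_h I kc) => [H|[k0 p1 p2 p3]]; [left | right]; rewrite !old //; lia.
- move=> k; rewrite ltnS leq_eqVlt => /orP[/eqP->|kc]; last by rewrite !old //; apply: ch_head I _ kc.
  rewrite !upd_same; case: hd => [[-> [? ?]] //|[c0 _ -> _] E].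
  have [|_ o2 _ _] := @ch_ord _ _ _ _ _ _ _ _ _ _ _ I c.-1; first lia.
  have hl m : m < c -> h m <= m.
    elim: m => [|m IH] mc; case: (ch_h I mc) => [[-> _] //|[]] //= _ _ -> _.
    by apply: leqW; apply: IH; lia.
  by have := hl c.-1; lia.
- move=> _; case: (posnP c) => [c0|c0].
    case: hd => [[_ [hu _]]|[]]; last by rewrite c0.
    have uE : u = 0.
      by case: (posnP u) => // /par[]; rewrite c0.
    by rewrite c0 uE !upd_same bp0 !upd_same.
  by have [r1 r2] := ch_root I c0; rewrite !old.
Qed.

Lemma chains_spec s sz hs : rg s rNn = n ->
  (forall k l, k < n -> l < n -> ar s aQ k = ar s aQ l -> k = l) ->
  (forall k, k < n -> ar s aQ k < n) ->
  (forall k, 0 < k < n -> ar s aBp k < k) -> ar s aBp 0 = 0 ->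
  size_inv (ar s aBp) sz hs (ar s aHv) 0 ->
  wp c_chains (fun s' =>
   [/\ chain_inv (ar s' aQ) (ar s' aBp) (ar s' aHv) (ar s' aPosb) (ar s' aPos)
         (ar s' aVert) (ar s' aHead) (ar s' aPp) (ar s' aOrd) n n,
       (forall i, i < n -> laid (ar s' aOrd) (ar s' aPosb) n i)
     & tk s' <= tk s + n + n]) s.
Proof.
move=> hn qinj qlt bplt bp0 SI; rewrite /c_chains; wps; split=> //; split=> //.
pose CI s' := chain_inv (ar s aQ) (ar s aBp) (ar s aHv) (ar s' aPosb) (ar s' aPos)
         (ar s' aVert) (ar s' aHead) (ar s' aPp) (ar s' aOrd).
have hvP p : ar s aHv p != 0 -> 0 < ar s aHv p < n /\ ar s aBp (ar s aHv p) = p.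
  by case/(zi_hv SI).
(* Finished paths are closed under heavy children, so an index skipped as a heavy child was numbered
   right after its parent. *)
pose I s' := [/\ CI s' (rg s' rI) (rg s' rC), rg s' rI <= n,
  (forall i, i < rg s' rI -> laid (ar s' aOrd) (ar s' aPosb) (rg s' rC) i),
  (forall k, k < rg s' rC -> ar s aHv (ar s' aOrd k) != 0 ->
     laid (ar s' aOrd) (ar s' aPosb) (rg s' rC) (ar s aHv (ar s' aOrd k))) &
  (rg s' rI = 0 -> rg s' rC = 0) /\ tk s' <= tk s + rg s' rI + rg s' rC].
apply: (wp_while (I := I) (mu := fun s' => n - rg s' rI)).
  by rewrite /I /CI; wps; spl => //; try lia; split.
move=> s2 F [I1 I2 I3 I4 [I5 I6]]; have cn := chain_inv_le I1.
have EQ : ar s2 aQ = ar s aQ by rewrite (fr_ar F).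
have EB : ar s2 aBp = ar s aBp by rewrite (fr_ar F).
have EV : ar s2 aHv = ar s aHv by rewrite (fr_ar F).
have EN : rg s2 rNn = n by rewrite (fr_rg F).
wps; rewrite EN; split; first by spl; lia.
rewrite lt0b addn1; case: ifP => it; last first.
  have E : rg s2 rI = n by lia.
  rewrite EQ EB EV; have EC : rg s2 rC = n.
    apply/eqP; rewrite eqn_leq cn /=; apply: (@injective_bound _ _ (ar s2 aPosb)) => [k kn|k l kn ln].
      by case: (I3 k); rewrite ?E.
    by case: (I3 k); rewrite ?E // => _ e1; case: (I3 l); rewrite ?E // => _ e2 e; rewrite -e1 e e2.
  by rewrite E EC in I1 I3 I6; split=> //; lia.
rewrite EB EV; set i := rg s2 rI in it *; set c := rg s2 rC in cn *.
have bpi : ar s aBp i < n.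
  by case: (posnP i) => [->|i0]; [rewrite bp0 | have := bplt i; lia].
split.
  by spl; try lia; case: (0 < i); case: eqP => //=; rewrite ?expn_gt0; lia.
rewrite muln_gt0 !lt0b; case: ifP => [/andP[i0 /eqP hvi]|/negbT nh].
  split; first by spl; lia.
  split; last by lia.
  rewrite /I; wps; rewrite ?addn1; spl => //; try lia.
  - exact: chain_inv_leq I1.
  - move=> j; rewrite ltnS leq_eqVlt => /orP[/eqP->|/I3] //.
    rewrite -hvi; have [l1 l2] : laid (ar s2 aOrd) (ar s2 aPosb) c (ar s aBp i).
      by apply: I3; apply: bplt; lia.
    by rewrite -{1}l2; rewrite -l2 in hvi; apply: I4 => //; rewrite hvi; lia.
split=> //; split=> //; split=> //.
(* Three stages: nothing numbered yet, inside a path, finished. Closure under heavy children can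
   fail only at the last numbered vertex, while the path is open. *)
pose J s' := [/\ CI s' i.+1 (rg s' rC), c <= rg s' rC,
  (forall j, j < i -> laid (ar s' aOrd) (ar s' aPosb) (rg s' rC) j),
  (forall k, k.+1 < rg s' rC \/ (k < rg s' rC /\ (rg s' rG = 0 \/ rg s' rC = c)) -> ar s aHv (ar s' aOrd k) != 0 ->
     laid (ar s' aOrd) (ar s' aPosb) (rg s' rC) (ar s aHv (ar s' aOrd k))) &
  tk s' + c <= tk s2 + rg s' rC /\
  [\/ [/\ rg s' rC = c, rg s' rG = 1, rg s' rU = i, rg s' rX = c & forall k, k < c -> ar s' aOrd k <> i],
     [/\ c < rg s' rC, rg s' rG = 1, rg s' rU = ar s aHv (ar s' aOrd (rg s' rC).-1), rg s' rU != 0 &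
        rg s' rX = ar s' aHead (rg s' rC).-1 /\ laid (ar s' aOrd) (ar s' aPosb) (rg s' rC) i] |
     rg s' rG = 0 /\ laid (ar s' aOrd) (ar s' aPosb) (rg s' rC) i]].
rewrite /c_chain; wps.
apply: (@wpw_use _ _ _ _ _ _ _ _ _ (fun s' => J s' /\ rg s' rG = 0)); last first.
  move=> s4 F4 [[J1 J2 J3 J4 [J5 J6]] G0].
  have l_i : laid (ar s4 aOrd) (ar s4 aPosb) (rg s4 rC) i.
    by case: J6 => [[_ E]|[_ E]|[]] //; lia.
  have EI : rg s4 rI = i by rewrite (fr_rg F4).
  have cn4 := chain_inv_le J1.
  split; first by rewrite EI; spl; lia.
  split; last by wps; lia.
  rewrite /I; wps; rewrite ?EI ?addn1; spl => //; try lia.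
  - by move=> j; rewrite ltnS leq_eqVlt => /orP[/eqP->|/J3].
  - by move=> k kc; apply: J4; right; split=> //; left.
have iE : i = 0 -> c = 0 by exact: I5.
have nh' : i = 0 \/ ar s aHv (ar s aBp i) <> i.
  by move: nh; case: (posnP i) => [|i0] /=; [left | move/eqP; right].
apply: (wp_while (I := J) (mu := fun s' => n.+1 - rg s' rC)).
  rewrite /J /CI; wps; spl => //.
  - exact: chain_inv_leq I1.
  - by move=> k [kc|[kc _]]; apply: I4; lia.
  - constructor 1; split=> // k kc E; case: (ch_h I1 kc) => [[hk _]|[k0 _ _ [o0 hvo]]].
      by have := ch_head I1 kc hk; rewrite E; lia.
    have /hvP[_] : ar s aHv (ar s2 aOrd k.-1) != 0 by rewrite hvo; lia.
    rewrite hvo E => b; case: nh' => [i0|]; first by rewrite E i0 in o0.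
    by rewrite b hvo E.
move=> s4 F4 [J1 J2 J3 J4 [J5 J6]].
have EQ4 : ar s4 aQ = ar s aQ by rewrite (fr_ar F4).
have EB4 : ar s4 aBp = ar s aBp by rewrite (fr_ar F4).
have EV4 : ar s4 aHv = ar s aHv by rewrite (fr_ar F4).
wps; split=> //; case: (posnP (rg s4 rG)) => G0 //=.
set u := rg s4 rU in J6 *; set d := rg s4 rC in J1 J2 J3 J4 J5 J6 *.
have dn : d <= n := chain_inv_le J1.
have [un new u0 [lu hd]] : [/\ u < n, forall k, k < d -> ar s4 aOrd k <> u, (u = 0 -> d = 0) &
   (0 < u -> laid (ar s4 aOrd) (ar s4 aPosb) d (ar s aBp u)) /\
   ((rg s4 rX = d /\ (u = 0 \/ ar s aHv (ar s aBp u) <> u) /\ u < i.+1) \/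
    [/\ 0 < d, ar s aBp u = ar s4 aOrd d.-1, rg s4 rX = ar s4 aHead d.-1 &
      0 < u /\ ar s aHv (ar s4 aOrd d.-1) = u])].
  case: J6 => [[dE _ uE xE nw]|[cd _ uE un0 [xE l_i]]|[]]; last by move=> E; rewrite E in G0.
    rewrite uE; split=> //; [by rewrite dE|by rewrite dE|split; last by left; rewrite xE dE].
    by move=> i0; apply: J3; apply: bplt; lia.
  have [/andP[p1 p2] p3] : 0 < u < n /\ ar s aBp u = ar s4 aOrd d.-1.
    by have := hvP (ar s4 aOrd d.-1); rewrite -uE; apply.
  split=> //; [|lia|split].
  - move=> k kd E; case: (ch_h J1 kd) => [[hk]|[k0 _ _ [o0 hvo]]].
      by rewrite E p3 -uE; case; lia.
    have /hvP[_] : ar s aHv (ar s4 aOrd k.-1) != 0 by rewrite hvo; lia.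
    rewrite hvo E p3 => e; have := chain_inv_inj J1 _ _ e; lia.
  - move=> _; rewrite p3; have [|_ o2 _ _] := @ch_ord _ _ _ _ _ _ _ _ _ _ _ J1 d.-1; first lia.
    by rewrite /laid o2; split=> //; lia.
  - by right; split=> //; lia.
have li : laid (upd (ar s4 aOrd) d u) (upd (ar s4 aPosb) u d) d.+1 i.
  case: J6 => [[_ _ <- _ _]|[_ _ _ _ [_ l_i]]|[]]; first exact: laid_new.
    exact: laid_next.
  by move=> E; rewrite E in G0.
have bpu : ar s aBp u < n.
  by case: (posnP u) => [->|u_gt]; [rewrite bp0 | have := bplt u; lia].
have qu := qlt u un.
have NI := chain_inv_next qinj bplt bp0 J1 un new u0 lu hd.
have dlt : d < n := chain_inv_le NI.
rewrite EQ4 EB4 EV4 /J /CI; wps; spl; try lia; rewrite ?addn1 //.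
- by move=> j /J3; apply: laid_next.
- move=> k hk; case: (eqVneq k d) => [kE|kd].
    rewrite kE upd_same => hu0; rewrite kE in hk; exfalso; move: hk hu0; case: (ar s aHv u) => [|m] [|[_ []]] //; lia.
  have kd' : k < d by case: hk => [|[]]; lia.
  rewrite upd_diff; last lia.
  move=> hk0; case: (ltnP k.+1 d) => k1; first by apply: laid_next => //; apply: J4 => //; left.
  case: (eqVneq d c) => dc.
    by apply: laid_next => //; apply: J4 => //; right; split=> //; right.
  case: J6 => [[dE]|[_ _ uE _ _]|[E]]; [by rewrite dE eqxx in dc| |by rewrite E in G0].
  have -> : k = d.-1 by lia.
  rewrite -uE; exact: laid_new.
- case: (posnP (ar s aHv u)) => hu0; first by constructor 3.
  by constructor 2; rewrite /= !upd_same; split=> //; lia.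
Qed.

End Layout.

(** * Acyclicity and bridges *)

Section Forests.
Variable V : finType.
Implicit Types (E F : {set {set V}}) (u v a b : V).

Lemma adj_sym E : symmetric (adj E).
Proof. by move=> x y; rewrite /adj /= setUC. Qed.

Lemma connect_adj_sym E : connect_sym (adj E).
Proof. by apply: sym_connect_sym; apply: adj_sym. Qed.

Lemma connect_adj_sub E F u v :
  E \subset F -> connect (adj E) u v -> connect (adj F) u v.
Proof. by move=> sEF; apply: connect_sub => x y h; apply/connect1/(subsetP sEF). Qed.

(** A path avoiding the edge, once shortened, closes up with the edge to a simple cycle. It has a
    third vertex, since otherwise its only step would be the removed edge. *)
Lemma acyclic_bridge E u v :
  acyclic E -> [set u; v] \in E -> u != v ->
  ~~ connect (adj (E :\ [set u; v])) u v.
Proof.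
move=> acE uvE neq; apply/negP => /connectP[p]; case/shortenP=> q pq uq _ vq.
apply: (acE (u :: q)).
  case: q pq vq {uq} => [|x [|y q]] //=; first by move=> _ uv; rewrite uv eqxx in neq.
  by rewrite andbT => h vx; move: h; rewrite -vx /adj /= !inE eqxx.
rewrite /ucycle /ucycleb uq andbT /cycle rcons_path -vq adj_sym /adj /= uvE andbT.
by apply: sub_path pq => x y; rewrite /adj /= inE => /andP[].
Qed.

(** In a simple cycle [x, y, ...] the rest of the cycle leads from [y] back to [x] without the edge
    between them. *)
Lemma bridges_acyclic E :
  (forall u v, u != v -> [set u; v] \in E ->
     ~~ connect (adj (E :\ [set u; v])) u v) -> acyclic E.
Proof.
move=> H [|x [|y q]] //= sq /andP[/= /andP[xy]].
rewrite rcons_path => /andP[pq lx].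
rewrite inE negb_or => /andP[/andP[nxy xq] /andP[yq uq]].
case/negP: (H _ _ nxy xy); rewrite connect_adj_sym.
apply: (@connect_trans _ _ (last y q)).
  apply/connectP; exists q => //.
  apply: (sub_in_path (P := mem (y :: q)) (e := adj E)) pq; last exact/allP.
  move=> a b aq bq; rewrite /adj /= !inE => ->; rewrite andbT; apply/eqP => ab.
  have : x \in [set a; b] by rewrite ab !inE eqxx.
  have xyq : x \notin y :: q by rewrite inE negb_or nxy.
  by rewrite !inE => /orP[]/eqP xE; rewrite -xE in aq bq; case/negP: xyq.
apply: connect1; rewrite /adj /= !inE; move: lx; rewrite /adj /= => ->; rewrite andbT.
apply/eqP => E1; have lq : last y q \in q by case: (q) sq => //= z p _; rewrite mem_last.
have : y \in [set last y q; x] by rewrite E1 !inE eqxx orbT.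
rewrite !inE [y == x]eq_sym (negbTE nxy) orbF => /eqP yl.
by move: yq; rewrite {1}yl lq.
Qed.

Lemma set2_eq u v a b :
  [set u; v] = [set a; b] -> (u = a /\ v = b) \/ (u = b /\ v = a).
Proof.
move=> e; have hu : (u == a) || (u == b) by rewrite -in_set2 -e set21.
have hv : (v == a) || (v == b) by rewrite -in_set2 -e set22.
have ha : (a == u) || (a == v) by rewrite -in_set2 e set21.
have hb : (b == u) || (b == v) by rewrite -in_set2 e set22.
by move: hu hv ha hb; do 4![case/orP=> /eqP ?]; subst; auto.
Qed.

(** The three cases are stable under one more step, so the induction on the path needs no simple
    path. *)
Lemma connect_addE E a b u v :
  connect (adj ([set a; b] |: E)) u v ->
  [\/ connect (adj E) u v, connect (adj E) u a /\ connect (adj E) b v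
    | connect (adj E) u b /\ connect (adj E) a v].
Proof.
case/connectP=> p; elim/last_ind: p v => [|p x IH] v /=.
  by move=> _ ->; constructor 1.
rewrite rcons_path last_rcons => /andP[pp e] ->; move: e.
rewrite /adj /= !inE; have := IH _ pp erefl; set y := last u p => H /orP[/eqP/set2_eq|e].
  case=> -[yE xE]; rewrite yE ?xE in H *; case: H => [H|[H1 H2]|[H1 H2]].
  - by constructor 2.
  - by constructor 2.
  - by constructor 1.
  - by constructor 3.
  - by constructor 1.
  - by constructor 3.
have yx : connect (adj E) y x by apply: connect1.
case: H => [H|[H1 H2]|[H1 H2]].
- by constructor 1; apply: connect_trans yx.
- by constructor 2; split=> //; apply: connect_trans yx.
- by constructor 3; split=> //; apply: connect_trans yx.
Qed.

(** Every edge is a bridge afterwards: if an old edge could be bypassed through the new one, then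
    [a] and [b] would be joined in [E] by way of the old edge. *)
Lemma acyclic_add E a b :
  acyclic E -> ~~ connect (adj E) a b -> acyclic ([set a; b] |: E).
Proof.
move=> acE nab; apply: bridges_acyclic => u v nuv uvE.
have [/set2_eq uv|nE] := [set u; v] =P [set a; b].
  have : ~~ connect (adj E) u v by case: uv => -[-> ->] //; rewrite connect_adj_sym.
  apply: contra; apply: connect_adj_sub; apply/subsetP => e.
  rewrite !inE => /andP[ne] /orP[/eqP eE|] //.
  by case: uv ne => -[-> ->]; rewrite eE ?[[set b; a]]setUC eqxx.
have {}uvE : [set u; v] \in E by move: uvE; rewrite !inE => /orP[/eqP|].
have nc := acyclic_bridge acE uvE nuv.
have -> : ([set a; b] |: E) :\ [set u; v] = [set a; b] |: (E :\ [set u; v]).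
  apply/setP => e; rewrite !inE; case: eqP => //= ->; case: eqP => // h.
apply/negP => /connect_addE; have sub := @connect_adj_sub (E :\ [set u; v]) E _ _ (subD1set _ _).
have cuv : connect (adj E) u v by apply: connect1.
case=> [h|[/sub h1 /sub h2]|[/sub h1 /sub h2]]; first by rewrite h in nc.
- case/negP: nab; rewrite connect_adj_sym in h1; rewrite connect_adj_sym in h2.
  exact: connect_trans h1 (connect_trans cuv h2).
- case/negP: nab; rewrite connect_adj_sym; rewrite connect_adj_sym in h1.
  rewrite connect_adj_sym in h2; exact: connect_trans h1 (connect_trans cuv h2).
Qed.

Lemma acyclic0 : acyclic (set0 : {set {set V}}).
Proof. by apply: bridges_acyclic => u v _; rewrite inE. Qed.

Lemma spanning_forest_sub (X : {set V}) E F :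
  F \subset E -> acyclic F ->
  (forall u v, [set u; v] \in E -> connect (adj F) u v) -> spanning_forest X E F.
Proof.
move=> sF acF H; split=> //; apply: eq_imset => x; apply/setP => y.
rewrite !inE; congr (_ && _); apply/idP/idP; first exact: connect_adj_sub.
by apply: connect_sub => u v; apply: H.
Qed.

(** * Double counting *)

Lemma sum_ordered_pairs (M : nmodType) E (phi : {set V} -> M) :
  (forall e, e \in E -> #|e| = 2) ->
  (\sum_v \sum_(u | [set v; u] \in E) phi [set v; u] = (\sum_(e in E) phi e) *+ 2)%R.
Proof.
move=> cE; rewrite pair_big_dep /=.
rewrite (partition_big (fun p : V * V => [set p.1; p.2]) (mem E)) //= -sumrMnl.
apply: eq_bigr => e eE.
have /cards2P[a [b [nab eab]]] : #|e| == 2 by rewrite cE.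
rewrite (eq_bigr (fun=> phi e)); last by move=> p /andP[_ /eqP->].
rewrite (eq_bigl (mem [set (a, b); (b, a)])).
  rewrite sumr_const cards2; suff -> : (a, b) != (b, a) by [].
  by apply: contra nab => /eqP[->].
case=> u v; rewrite !inE /= !xpair_eqE; apply/andP/idP.
  by case=> _ /eqP; rewrite eab => /set2_eq[][-> ->]; rewrite !eqxx ?orbT.
by case/orP=> /andP[/eqP-> /eqP->]; rewrite 1?[[set b; a]]setUC -eab.
Qed.

End Forests.

(** * Rooted trees given by a parent function *)

Section Ancestors.
Variables (n : nat) (pp : nat -> nat).

(** [k] is fuel for climbing to the root; as parents have smaller numbers, [z] steps suffice from
    [z]. *)
Fixpoint ancf k x z :=
  (x == z) || (if k is k'.+1 then (0 < z) && ancf k' x (pp z) else false).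

Definition anc x z := ancf z x z.

Hypothesis pp_lt : forall x, 0 < x < n -> pp x < x.

Lemma ancE x z : z < n -> anc x z = (x == z) || ((0 < z) && anc x (pp z)).
Proof.
move=> zn; have fuel k k' y : y < n -> y <= k -> y <= k' -> ancf k x y = ancf k' x y.
  elim: k k' y => [|k IH] [|k'] y yn yk yk' //=; try by (have -> : y = 0 by lia).
  case: (posnP y) => //= y0; congr (_ || _); have := @pp_lt y; rewrite y0 yn => /(_ isT) ?.
  by apply: IH; lia.
rewrite {1}/anc; case: z zn => // z zn /=; congr (_ || _); have := @pp_lt z.+1.
by rewrite zn => /(_ isT) ?; apply: fuel; lia.
Qed.

Lemma anc_refl x : anc x x.
Proof. by rewrite /anc; case: x => //= x; rewrite eqxx. Qed.

Lemma anc_up x z : 0 < z < n -> x != z -> anc x z = anc x (pp z).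
Proof. by case/andP=> z0 zn /negbTE ne; rewrite ancE // ne z0. Qed.

Lemma anc_le x z : z < n -> anc x z -> x <= z.
Proof.
have [k] := ubnP z; elim: k z => // k IH z zk zn; rewrite ancE //.
case/orP=> [/eqP-> //|/andP[z0]]; have lt : pp z < z by apply: pp_lt; rewrite z0.
by move=> /IH -/(_ _ _); lia.
Qed.

Lemma anc_root z : z < n -> anc 0 z.
Proof.
have [k] := ubnP z; elim: k z => // k IH z zk zn; rewrite ancE //.
case: (posnP z) => [->|z0] //=; have lt : pp z < z by apply: pp_lt; rewrite z0.
by rewrite IH ?orbT; lia.
Qed.

Lemma anc_trans x y z : z < n -> anc x y -> anc y z -> anc x z.
Proof.
have [k] := ubnP z; elim: k z => // k IH z zk zn xy; rewrite ancE //.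
case/orP=> [/eqP<- //|/andP[z0]]; have lt : pp z < z by apply: pp_lt; rewrite z0.
by move=> /IH -/(_ _ _ xy) h; rewrite ancE // z0 h ?orbT; lia.
Qed.

Lemma anc_total x y z : z < n -> anc x z -> anc y z -> x <= y -> anc x y.
Proof.
have [k] := ubnP z; elim: k z => // k IH z zk zn xz; rewrite ancE //.
case/orP=> [/eqP-> //|/andP[z0]]; have lt : pp z < z by apply: pp_lt; rewrite z0.
move=> yz xy; have ypz : y <= pp z by apply: anc_le => //; lia.
by apply: (IH (pp z)) => //; try lia; rewrite -anc_up // ?z0 //; lia.
Qed.

Lemma anc_parent x z : 0 < z < n -> anc x (pp z) -> anc x z.
Proof. by case/andP=> z0 zn; rewrite [anc x z]ancE // z0 => ->; rewrite orbT. Qed.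

Lemma anc_pp x : 0 < x < n -> anc x (pp x) = false.
Proof.
move=> hx; apply/negP => /anc_le; have := pp_lt hx; move=> lt /(_ _); lia.
Qed.

Variable h : nat -> nat.
Hypothesis hP : forall x, x < n ->
  h x = x \/ [/\ 0 < x, pp x = x.-1 & h x = h x.-1].

Lemma head_le x : x < n -> h x <= x.
Proof.
elim: x => [|x IH] xn; have := hP xn; first by case=> [->|[]].
by case=> [->|[_ _ ->]] //; apply: leqW; apply: IH; lia.
Qed.

Lemma head_chain x y : x < n -> h x <= y <= x -> h y = h x.
Proof.
elim: x => [|x IH] xn hy; first by congr h; lia.
case: (ltnP y x.+1) => yx; last by congr h; lia.
case: (hP xn) => [E|[_ _ E]]; first lia.
by rewrite E; apply: IH; rewrite /= in E *; lia.
Qed.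

Lemma head_idem x : x < n -> h (h x) = h x.
Proof. by move=> xn; apply: head_chain => //; rewrite leqnn head_le. Qed.

(** Numbers are consecutive along a heavy path, so the ancestors of [x] on its own path form an
    interval; the others are those of the parent of the head. *)
Lemma anc_chain x y : x < n ->
  anc y x = (h x <= y <= x) || ((0 < h x) && anc y (pp (h x))).
Proof.
elim: x => [|x IH] xn.
  have h0 : h 0 = 0 by have := head_le xn; lia.
  by rewrite h0 /anc /= orbF leqn0 eq_sym; lia.
case: (hP xn) => [E|[_ ppE E]].
  by rewrite E ancE //= andbC; congr (_ || _); lia.
rewrite /= in ppE E; rewrite ancE // ppE /= E IH; last lia.
rewrite orbA; congr (_ || _); have := @head_le x; lia.
Qed.

Lemma head_anc_le x y : x < n -> anc y x -> h y <= h x.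
Proof.
have [k] := ubnP x; elim: k x => // k IH x xk xn; rewrite anc_chain //.
case/orP=> [/head_chain-> //|/andP[h0]]; have hx := head_le xn.
have lt : pp (h x) < h x by apply: pp_lt; lia.
move=> /IH -/(_ _ _) H; apply: leq_trans (_ : h (pp (h x)) <= _); first by apply: H; lia.
by apply: leq_trans (head_le _) _; lia.
Qed.

(** An ancestor of [v] has head at most [h v < h u], so none lies in the interval from [h u] to [u],
    which splits off as a disjoint piece of the symmetric difference. This is why the walk climbs
    from the end with the larger head. *)
Lemma cross_step u v x : u < n -> v < n -> h v < h u ->
  (anc x u (+) anc x v : nat) =
  (h u <= x <= u) + (anc x (pp (h u)) (+) anc x v).
Proof.
move=> un vn lt; rewrite (anc_chain x un) (leq_ltn_trans _ lt) //=.
have hu := head_le un; have pl : pp (h u) < h u by apply: pp_lt; lia.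
case: (boolP (h u <= x <= u)) => //= xu.
have -> : anc x (pp (h u)) = false.
  by apply/negP => /anc_le -/(_ _); lia.
have -> // : anc x v = false.
by apply/negP => /(head_anc_le vn); rewrite (head_chain un xu); lia.
Qed.

(** Everything above the common head cancels. The lower bound is strict because a position stands
    for the edge to its parent, and that of [u] is not on the path. *)
Lemma cross_last u v x : v < n -> u <= v -> h u = h v ->
  anc x u (+) anc x v = (u < x <= v).
Proof.
move=> vn uv E; have un : u < n by lia.
rewrite (anc_chain x un) (anc_chain x vn) E.
have hu := head_le un; have hv := head_le vn; rewrite E in hu.
case: (posnP (h v)) => [h0|h0] /=; first by rewrite !orbF; lia.
have lt : pp (h v) < h v by apply: pp_lt; lia.
case: (boolP (anc x (pp (h v)))) => [/anc_le H|_]; last by rewrite !orbF; lia.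
by have {H} := H _; lia.
Qed.

End Ancestors.

(** * Cuts respecting the tree *)

Section TreeCuts.
Variables (n : nat) (T : {set {set 'I_n}}) (pp : nat -> nat).
Variables (vt : nat -> 'I_n) (ps : 'I_n -> nat).
Hypothesis pp_lt : forall x, 0 < x < n -> pp x < x.
Hypothesis ps_lt : forall v, ps v < n.
Hypothesis psK : cancel ps vt.
Hypothesis vtK : forall x, x < n -> ps (vt x) = x.

(** A tree edge is named by the position of its lower end; 0, the root, names none. *)
Definition te x : {set 'I_n} := [set vt x; vt (pp x)].

Hypothesis te_T : forall x, 0 < x < n -> te x \in T.
Hypothesis acT : acyclic T.
Hypothesis cT : forall e, e \in T -> #|e| = 2.

Definition below x v := anc pp x (ps v).

Let pp_n x : 0 < x < n -> pp x < n.
Proof. by move=> hx; have := pp_lt hx; lia. Qed.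

Lemma connect_up (T' : {set {set 'I_n}}) a z : z < n -> anc pp a z ->
  (forall y, 0 < y < n -> anc pp y z -> anc pp a y -> y != a -> te y \in T') ->
  connect (adj T') (vt a) (vt z).
Proof.
have [k] := ubnP z; elim: k z => // k IH z zk zn az H.
case: (eqVneq a z) => [->|ne] //.
have z0 : 0 < z by case: (posnP z) => // z0; move: az ne; rewrite z0 /anc /= orbF => ->.
have hz : 0 < z < n by rewrite z0.
have lt := pp_lt hz; have az' : anc pp a (pp z) by rewrite -(anc_up pp_lt).
apply: (@connect_trans _ _ (vt (pp z))).
  apply: IH => //; try lia; move=> y hy yz ay ya; apply: H => //.
  exact: (anc_parent pp_lt).
apply: connect1; rewrite /adj /= setUC; apply: H => //; first exact: anc_refl.
by rewrite eq_sym.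
Qed.

Lemma anc_te x z : 0 < x < n -> 0 < z < n ->
  anc pp x z (+) anc pp x (pp z) = (x == z).
Proof.
move=> hx hz; case: eqP => [->|/eqP ne]; first by rewrite anc_refl (anc_pp pp_lt).
by rewrite (anc_up pp_lt) // addbb.
Qed.

(** The edges to parents already connect every vertex to the root, so an edge of [T] outside this
    family would not be a bridge. *)
Lemma T_te e : e \in T -> exists2 x, 0 < x < n & e = te x.
Proof.
move=> eT; case: (boolP [exists x : 'I_n, (0 < x) && (e == te x)]).
  by case/existsP=> x /andP[x0 /eqP->]; exists x => //; rewrite x0 ltn_ord.
move/existsPn=> H; have /cards2P[u [v [nuv eE]]] : #|e| == 2 by rewrite cT.
case/negP: (acyclic_bridge acT (u := u) (v := v) (etrans (congr1 _ (esym eE)) eT) nuv).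
have root z : connect (adj (T :\ [set u; v])) (vt 0) z.
  rewrite -[z]psK; apply: connect_up => //; first exact: (anc_root pp_lt).
  move=> y hy _ _ y0; rewrite !inE te_T // andbT -eE.
  have yn : y < n by lia.
  have := H (Ordinal yn); rewrite /=; case: (0 < y) hy => //= _.
  by rewrite eq_sym.
by apply: connect_trans (root v); rewrite connect_adj_sym.
Qed.

Lemma below_edge x u v : 0 < x < n -> [set u; v] \in T ->
  below x u (+) below x v = ([set u; v] == te x).
Proof.
move=> hx uvT; have [z hz E] := T_te uvT.
have zn : z < n by lia.
have inj : (te z == te x) = (x == z).
  apply/eqP/eqP => [|-> //]; case/set2_eq=> -[/(congr1 ps) E1 /(congr1 ps) E2].
    by move: E1; rewrite !vtK //; lia.
  move: E1 E2; rewrite !vtK ?pp_n //; try lia.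
  by have := pp_lt hx; have := pp_lt hz; lia.
rewrite E inj -(anc_te hx hz) /below; case/set2_eq: E => -[-> ->].
  by rewrite !vtK ?pp_n.
by rewrite !vtK ?pp_n // addbC.
Qed.

Lemma te_inj x y : 0 < x < n -> 0 < y < n -> te x = te y -> x = y.
Proof.
move=> hx hy E; have := below_edge hx (te_T hy); rewrite -/(te y) E eqxx.
rewrite /below !vtK ?pp_n //; last lia.
by rewrite anc_te // => /eqP.
Qed.

Section Middle.
Variables x y : nat.
Hypothesis hx : 0 < x < n.
Hypothesis hy : 0 < y < n.
Hypothesis xy : x < y.

Let T' := T :\: [set te x; te y].
(* The class of a vertex is constant on the components of [T']. *)
Let cls v := (below x v, below y v).
(** The top vertex of the middle component: [x] if [y] lies below it, and the root if the two
    subtrees are disjoint. The assumption [x < y] excludes the remaining case. *)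
Let a := if anc pp x y then x else 0.

Let cls_edge u v : [set u; v] \in T' -> cls u = cls v.
Proof.
rewrite !inE negb_or => /andP[/andP[nx ny] uvT].
have := below_edge hx uvT; have := below_edge hy uvT.
rewrite (negbTE nx) (negbTE ny) /cls => /negbT; rewrite negb_add => /eqP ->.
by move=> /negbT; rewrite negb_add => /eqP ->.
Qed.

Let cls_connect u v : connect (adj T') u v -> cls u = cls v.
Proof.
case/connectP=> p; elim: p u => [|z p IH] u /=; first by move=> _ ->.
by case/andP=> /cls_edge-> /IH H; apply: H.
Qed.

Let an : a < n. Proof. by rewrite /a; case: ifP; lia. Qed.

Let nyx : anc pp y x = false.
Proof. by apply/negP => /(anc_le pp_lt); lia. Qed.

(** The climb from [v] to the top vertex meets neither [te x] nor [te y], since passing one of them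
    would change the class. *)
Let cls_top v : cls v = cls (vt a) -> connect (adj T') (vt a) v.
Proof.
rewrite /cls /below vtK // => -[E1 E2]; rewrite -[v]psK.
move: (ps v) (ps_lt v) E1 E2 => z zn E1 E2.
have hz y' : 0 < y' < n -> y' != x -> y' != y -> te y' \in T'.
  move=> h nx ny; rewrite !inE te_T // andbT negb_or.
  apply/andP; split; apply/eqP => /te_inj E.
    by move: nx; rewrite E ?eqxx.
  by move: ny; rewrite E ?eqxx.
move: E1 E2; rewrite /a; case: ifP => [axy|naxy].
  rewrite anc_refl nyx => xz nyz; apply: connect_up => // t ht tz xt tx.
  by apply: hz => //; apply: contraFneq nyz => <-.
have h0 t : 0 < t -> anc pp t 0 = false by rewrite /anc; case: t.
rewrite !h0; try lia; move=> nxz nyz; apply: connect_up => //; first exact: (anc_root pp_lt).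
move=> t ht tz _ _; apply: hz => //; first by apply: contraFneq nxz => <-.
by apply: contraFneq nyz => <-.
Qed.

Let M := component setT T' (vt a).

Let ME : M = [set v | cls v == cls (vt a)].
Proof.
apply/setP => v; rewrite !inE; apply/idP/eqP => [/cls_connect //|]; exact: cls_top.
Qed.

Lemma middle_meets : (M :&: te x != set0) && (M :&: te y != set0).
Proof.
have xn : x < n by lia. have yn : y < n by lia.
have h0 t : 0 < t -> anc pp t 0 = false by rewrite /anc; case: t.
apply/andP; split; apply/set0Pn.
  case: (boolP (anc pp x y)) => axy; [exists (vt x) | exists (vt (pp x))]; rewrite ME !inE /te.
    by rewrite /a axy !eqxx.
  rewrite eqxx orbT andbT /cls /below !vtK ?pp_n // /a (negbTE axy) !h0; try lia.
  rewrite (anc_pp pp_lt) //; apply/eqP; congr (_, _).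
  by apply/negP => /(anc_le pp_lt); have := pp_lt hx; lia.
exists (vt (pp y)); rewrite ME !inE /te eqxx orbT andbT /cls /below !vtK ?pp_n // (anc_pp pp_lt) //.
have E : anc pp x (pp y) = anc pp x y by rewrite (anc_up pp_lt hy) //; lia.
rewrite E /a; case: ifP => axy; first by rewrite anc_refl nyx.
by rewrite !h0 //; lia.
Qed.

Lemma middle_unique u :
  (component setT T' u :&: te x != set0) && (component setT T' u :&: te y != set0) ->
  component setT T' u = M.
Proof.
case/andP=> /set0Pn[v1 /setIP[]]; rewrite !inE /= => c1 v1x.
move=> /set0Pn[v2 /setIP[]]; rewrite !inE /= => c2 v2y.
have E : cls u = cls (vt a).
  have := cls_connect c1; have := cls_connect c2; move=> -> E; rewrite E.
  have xn : x < n by lia. have yn : y < n by lia.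
  have h0 t : 0 < t -> anc pp t 0 = false by rewrite /anc; case: t.
  have F : anc pp x (pp y) = anc pp x y by rewrite (anc_up pp_lt hy) //; lia.
  have G : anc pp y (pp x) = false by apply/negP => /(anc_le pp_lt); have := pp_lt hx; lia.
  move: E; rewrite /cls /below (vtK an) /a.
  case/orP: v1x => /eqP->; case/orP: v2y => /eqP->; rewrite !vtK ?pp_n //;
  rewrite ?anc_refl ?(anc_pp pp_lt) // ?nyx ?F ?G;
  by case: ifP => axy; rewrite ?axy ?anc_refl ?nyx ?h0 //; lia.
apply/setP => z; rewrite !inE /=; have top := cls_top E.
by apply/idP/idP => [|] h; [apply: connect_trans top h|apply: connect_trans h; rewrite connect_adj_sym].
Qed.

Lemma middle_lt : middle T (te x) (te y) = M.
Proof.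
rewrite /middle; case: pickP => [C /=|].
  by case/andP=> /imsetP[u _ ->] /middle_unique.
move/(_ M); rewrite middle_meets andbT => /negP[].
by apply/imsetP; exists (vt a).
Qed.

(** The component is a difference of nested subtrees if [x] is above [y], and otherwise the
    complement of a disjoint union; both are exclusive ors up to a negation. *)
Lemma in_middle_lt v : v \in M = below x v (+) below y v (+) ~~ anc pp x y.
Proof.
rewrite ME inE /cls /below [ps (vt a)]vtK // /a.
have h0 t : 0 < t -> anc pp t 0 = false by rewrite /anc; case: t.
case: (boolP (anc pp x y)) => axy /=.
  rewrite anc_refl nyx addbF xpair_eqE eqb_id eqbF_neg.
  case: (boolP (anc pp y _)) => [yv|_]; last by rewrite addbF andbT.
  by rewrite (anc_trans pp_lt _ axy yv).
rewrite !h0; try lia; rewrite xpair_eqE !eqbF_neg addbT.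
case: (boolP (anc pp x _)) => xv; case: (boolP (anc pp y _)) => yv //=.
by case/negP: axy; apply: (anc_total pp_lt) xv yv _ => //; lia.
Qed.

(** Each of the two removed edges has an end outside the middle component, and these ends are
    distinct. *)
Lemma middle_compl_gt1 : 1 < #|~: M|.
Proof.
have xn : x < n by lia. have yn : y < n by lia.
have [u [v [nuv uM vM]]] : exists u v, [/\ u != v, u \notin M & v \notin M].
  have nM : vt y \notin M by rewrite in_middle_lt /below vtK // anc_refl; case: (anc _ _ _).
  case: (boolP (anc pp x y)) => axy.
    exists (vt (pp x)), (vt y); split=> //.
      by apply/eqP => /(congr1 ps); rewrite !vtK ?pp_n //; have := pp_lt hx; lia.
    rewrite in_middle_lt axy addbF /below vtK ?pp_n // (anc_pp pp_lt) //=.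
    by apply/negP => /(anc_le pp_lt); have := pp_lt hx; lia.
  exists (vt x), (vt y); split=> //; first by apply/eqP => /(congr1 ps); rewrite !vtK //; lia.
  by rewrite in_middle_lt (negbTE axy) /below vtK // anc_refl nyx.
apply: leq_trans (_ : #|[set u; v]| <= _); first by rewrite cards2 nuv.
by apply/subset_leq_card/subsetP => z; rewrite in_set2 in_setC => /orP[]/eqP->.
Qed.

End Middle.

Lemma middleC (T0 : {set {set 'I_n}}) e f : middle T0 e f = middle T0 f e.
Proof.
rewrite /middle setUC; congr odflt; apply: eq_pick => C.
by rewrite /= [X in _ && X]andbC.
Qed.

(** The term that tells nested from disjoint subtrees occurs twice and cancels, so the matrix needs
    no case distinction on the relative position of the two edges. *)
Lemma middle_cross x y u v : 0 < x < n -> 0 < y < n -> x != y ->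
  (u \in middle T (te x) (te y)) (+) (v \in middle T (te x) (te y)) =
  (below x u (+) below x v) (+) (below y u (+) below y v).
Proof.
move=> hx hy; wlog lt : x y hx hy / x < y => [H|_].
  case: (ltngtP x y) => // [lt|lt] _; first by apply: H => //; lia.
  by rewrite middleC H //; [rewrite addbC | lia].
rewrite middle_lt // !in_middle_lt //.
by case: (below x u); case: (below x v); case: (below y u); case: (below y v); case: (anc _ _ _).
Qed.

(* The complement of the middle component has at least two vertices, so the
   component itself is the single vertex [v]. *)
Lemma trivial_middle x y : 0 < x < n -> 0 < y < n -> x != y ->
  reflect (exists v u1 u2, [/\ u1 != u2, forall u, ([set v; u] \in T) = (u \in [set u1; u2]),
     below x u1 (+) below x u2 & below y u1 (+) below y u2])
    (~~ nontrivial (middle T (te x) (te y))).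
Proof.
move=> hx hy; wlog lt : x y hx hy / x < y => [H|nxy].
  case: (ltngtP x y) => // [lt|lt] ne; first by apply: H => //; lia.
  rewrite middleC; apply: (iffP (H y x hy hx lt _)); first by lia.
    by case=> v [u1 [u2 [? ? ? ?]]]; exists v, u1, u2.
  by case=> v [u1 [u2 [? ? ? ?]]]; exists v, u1, u2.
have := middle_unique hx hy lt; rewrite middle_lt //.
set T' := T :\: _; set a := vt _; set M := component _ _ _ => uniqM.
have cM : 1 < #|~: M| by apply: middle_compl_gt1.
have aM : a \in M by rewrite !inE connect0.
rewrite /nontrivial cM andbT -leqNgt.
have loop u v : [set u; v] \in T -> u != v by move/cT; rewrite cards2; case: eqP.
apply: (iffP idP) => [leM|[v [u1 [u2 [nu nb b1 b2]]]]].
  have {leM}ME : M = [set a].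
    by apply/eqP; rewrite eq_sym eqEcard sub1set aM cards1.
  have inT u : [set a; u] \in T -> ([set a; u] == te x) || ([set a; u] == te y).
    move=> auT; apply: contraT => nt; have : u \in M.
      by rewrite !inE /=; apply: connect1; rewrite /adj /= !inE nt.
    by rewrite ME inE => /eqP E; have := loop _ _ auT; rewrite E eqxx.
  have /andP[] := middle_meets hx hy lt; rewrite -/T' -/a -/M.
  rewrite ME => /set0Pn[a1 /setIP[/set1P-> ax]] /set0Pn[a2 /setIP[/set1P-> ay]].
  have other z : 0 < z < n -> a \in te z -> exists2 u, te z = [set a; u] & [set a; u] \in T.
    move=> hz; rewrite !inE => /orP[]/eqP->.
      by exists (vt (pp z)) => //; apply: te_T.
    by exists (vt z); rewrite setUC //; apply: te_T.
  have [u1 E1 T1] := other x hx ax; have [u2 E2 T2] := other y hy ay.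
  have n12 : u1 != u2.
    by apply: contra nxy => /eqP E; apply/eqP/te_inj => //; rewrite E1 E2 E.
  exists a, u1, u2; split=> //.
  - move=> u; apply/idP/idP; last by rewrite !inE => /orP[]/eqP->.
    move=> auT; rewrite !inE; case/orP: (inT _ auT) => /eqP E.
      rewrite E1 in E; case/set2_eq: E => -[h1 h2]; first by rewrite h2 eqxx.
      by have := loop _ _ T1; rewrite {1}h1 eqxx.
    rewrite E2 in E; case/set2_eq: E => -[h1 h2]; first by rewrite h2 eqxx orbT.
    by have := loop _ _ T2; rewrite {1}h1 eqxx.
  - have := below_edge hx T1; have := below_edge hx T2; rewrite -E1 -E2 eqxx.
    have -> : (te y == te x) = false by apply/eqP => /te_inj E; move: nxy; rewrite E ?eqxx.
    by case: (below x a); case: (below x u1); case: (below x u2).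
  - have := below_edge hy T1; have := below_edge hy T2; rewrite -E1 -E2 eqxx.
    have -> : (te x == te y) = false by apply/eqP => /te_inj E; move: nxy; rewrite E ?eqxx.
    by case: (below y a); case: (below y u1); case: (below y u2).
have T1 : [set v; u1] \in T by rewrite nb set21.
have T2 : [set v; u2] \in T by rewrite nb set22.
(* If the ends of the path [u1, v, u2] are separated by the fundamental cut of [z], then [te z] is
   one of its two edges. As [te x] and [te y] differ, they are all the edges at [v]. *)
have sel z : 0 < z < n -> below z u1 (+) below z u2 ->
    (te z == [set v; u1]) (+) (te z == [set v; u2]).
  move=> hz; have := below_edge hz T1; have := below_edge hz T2.
  rewrite ![_ == te z]eq_sym => <- <-.
  by case: (below z v); case: (below z u1); case: (below z u2).
have s1 := sel _ hx b1; have s2 := sel _ hy b2.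
have ne : te x != te y by apply: contra nxy => /eqP/te_inj E; rewrite E.
have cv : component setT T' v = [set v].
  apply/setP => z; rewrite !inE /=; apply/idP/eqP => [|->]; last exact: connect0.
  case/connectP=> -[|t p] /=; first by [].
  case/andP; rewrite /adj /= !inE => /andP[nt]; rewrite nb !inE => H.
  have G u : [set v; u] = [set v; u1] \/ [set v; u] = [set v; u2] ->
      ~~ (([set v; u] == te x) || ([set v; u] == te y)) -> False.
    move=> uE; rewrite negb_or => /andP[]; rewrite eq_sym => n1; rewrite eq_sym => n2.
    by move: s1 s2 ne; case: uE => <-; rewrite (negbTE n1) (negbTE n2) /= ?addbF => /eqP-> /eqP->;
      rewrite eqxx.
  by case/orP: H nt => /eqP-> nt; case: (G _ _ nt); [left|right].
rewrite -(uniqM v) ?cv ?cards1 //.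
have vin z : (te z == [set v; u1]) (+) (te z == [set v; u2]) -> [set v] :&: te z != set0.
  move=> H; apply/set0Pn; exists v; rewrite !inE eqxx /=.
  have : v \in te z by move: H; case: eqP => [->|_]; [rewrite set21 | move=> /= /eqP->; rewrite set21].
  by rewrite !inE.
by rewrite !vin.
Qed.

End TreeCuts.

(** * Programs writing the masses of tree paths *)

Notation vB := 0 (only parsing).
Notation vThr := 1 (only parsing).
Notation vInf := 2 (only parsing).
Notation vLn := 3 (only parsing).
Notation vPr := 4 (only parsing).
Notation vQq := 5 (only parsing).
Notation vDd := 6 (only parsing).
Notation bDel := 0 (only parsing).

Definition c_layout := c_bfs ;; c_sizes ;; c_chains.

(** Marks come in pairs, the two ends of a half-open interval of positions. The last interval starts
    after the topmost vertex, whose parent edge is not on the path. *)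
Definition c_walk :=
  rC <-~ Cn 0 ;;
  Wh ((aHead @ $rU ==~ aHead @ $rV) ==~ Cn 0)
    (Ife (aHead @ $rU <~ aHead @ $rV)
       (Sto aMk $rC (aHead @ $rV) ;; Sto aMk ($rC +~ Cn 1) ($rV +~ Cn 1) ;;
        rV <-~ aPp @ (aHead @ $rV))
       (Sto aMk $rC (aHead @ $rU) ;; Sto aMk ($rC +~ Cn 1) ($rU +~ Cn 1) ;;
        rU <-~ aPp @ (aHead @ $rU)) ;;
     rC <-~ $rC +~ Cn 2) ;;
  Ife ($rU <=~ $rV)
    (Sto aMk $rC ($rU +~ Cn 1) ;; Sto aMk ($rC +~ Cn 1) ($rV +~ Cn 1))
    (Sto aMk $rC ($rV +~ Cn 1) ;; Sto aMk ($rC +~ Cn 1) ($rU +~ Cn 1)) ;;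
  rC <-~ $rC +~ Cn 2.

(** Each row has its linked list of masses. [$rK] is incremented before use, which leaves index 0 to
    end the lists. *)
Definition c_push :=
  rK <-~ $rK +~ Cn 1 ;; Sto aNx $rK (aHd @ $rP) ;; Sto aHd $rP $rK ;;
  Sto aCol $rK $rX ;; WSto bDel $rK (Wv vDd).

(** Mark number [a] carries the sign [(-1) ^ a]. Masses at [(mk a, 0)] and [(0, mk a)] give the
    terms linear in the path indicator at the row and at the column, masses at [(mk a, mk b)] the
    product term. *)
Definition c_marks :=
  rA <-~ Cn 0 ;;
  Wh ($rA <~ $rC)
    (WSet vDd (Wv vLn) ;; rP <-~ aMk @ $rA ;; rX <-~ Cn 0 ;; c_push ;;
     rX <-~ $rP ;; rP <-~ Cn 0 ;; c_push ;;
     rP <-~ $rX ;; WSet vQq (Wsb Wz (Wv vPr)) ;; rB <-~ Cn 0 ;;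
     Wh ($rB <~ $rC)
       (rX <-~ aMk @ $rB ;; WSet vDd (Wv vQq) ;; c_push ;;
        WSet vQq (Wsb Wz (Wv vQq)) ;; rB <-~ $rB +~ Cn 1) ;;
     WSet vLn (Wsb Wz (Wv vLn)) ;; WSet vPr (Wsb Wz (Wv vPr)) ;;
     rA <-~ $rA +~ Cn 1).

Definition c_path := c_walk ;; c_marks.

(** The linear and product coefficients are [w] and [2 w] for an edge of weight [w]; for a vertex of
    degree two in [T] they are 0 and [- inf], as the product enters with a minus sign. *)
Definition c_edges :=
  rK <-~ Cn 0 ;; rI <-~ Cn 0 ;;
  Wh ($rI <~ $rNn)
    (rJ <-~ Cn 0 ;;
     Wh ($rJ <~ Dg InG $rI)
       (rU <-~ aPos @ $rI ;; rV <-~ aPos @ (Nb InG $rI $rJ) ;;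
        WSet vLn (Wwt $rI $rJ) ;; WSet vPr (Wad (Wv vLn) (Wv vLn)) ;;
        c_path ;; rJ <-~ $rJ +~ Cn 1) ;;
     Ife (Dg InT $rI ==~ Cn 2)
       (rU <-~ aPos @ (Nb InT $rI (Cn 0)) ;; rV <-~ aPos @ (Nb InT $rI (Cn 1)) ;;
        WSet vLn Wz ;; WSet vPr (Wsb Wz (Wv vInf)) ;; c_path)
       Skip ;;
     rI <-~ $rI +~ Cn 1).

(** * Matrices as lists of point masses *)

Section Masses.
Variable R : realType.
Implicit Type ml : seq (nat * nat * R).

(* A list of masses stands for the matrix of its sums over lower left
   quadrants. *)
Definition mv ml e f : R :=
  (\sum_(m <- ml) if (m.1.1 <= e)%N && (m.1.2 <= f)%N then m.2 else 0)%R.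

Lemma mv_cons m ml e f :
  mv (m :: ml) e f = ((if (m.1.1 <= e)%N && (m.1.2 <= f)%N then m.2 else 0) + mv ml e f)%R.
Proof. exact: big_cons. Qed.

(** Masses are numbered from 1, starting at the end of the list, so that a number survives later
    insertions and 0 is free for an empty row. *)
Fixpoint lastm ml r :=
  if ml is m :: l then if m.1.1 == r then (size l).+1 else lastm l r else 0.

Fixpoint cells (nx col : nat -> nat) (del : nat -> R) ml : Prop :=
  if ml is m :: l then
    [/\ col (size l).+1 = m.1.2, del (size l).+1 = m.2, nx (size l).+1 = lastm l m.1.1
      & cells nx col del l]
  else True.

Lemma cells_upd nx col del ml k a b c : size ml < k ->
  cells nx col del ml -> cells (upd nx k a) (upd col k b) (upd del k c) ml.
Proof.
elim: ml => //= m l IH lt [h1 h2 h3 h4]; rewrite !upd_diff; try lia.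
by split=> //; apply: IH => //; apply: ltnW.
Qed.

(** A pair of marks [a <= b] contributes the indicator of its interval, so for disjoint intervals
    the alternating sum is the indicator of their union. *)
Definition msum (mk : nat -> nat) c x : R :=
  (\sum_(0 <= j < c) if (mk j <= x)%N then (-1) ^+ j else 0)%R.

Lemma msumS mk c x :
  msum mk c.+1 x = (msum mk c x + if (mk c <= x)%N then (-1) ^+ c else 0)%R.
Proof. by rewrite /msum big_nat_recr. Qed.

Lemma eq_msum mk mk' c x : (forall j, j < c -> mk j = mk' j) -> msum mk c x = msum mk' c x.
Proof. by move=> H; apply: eq_big_nat => j /H ->. Qed.

Lemma msum_interval mk k x a b : a <= b ->
  msum (upd (upd mk k.*2 a) (k.*2 + 1) b) (k.*2 + 2) x = (msum mk k.*2 x + ((a <= x < b)%N)%:R)%R.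
Proof.
move=> ab; rewrite addn2 !msumS addn1 upd_same [upd _ k.*2.+1 _ _]upd_diff; last lia.
rewrite upd_same (@eq_msum _ mk); last by move=> j jk; rewrite !upd_diff //; lia.
rewrite -addrA; congr (_ + _)%R; rewrite exprS -mul2n exprM sqrrN !expr1n mulr1.
case: (leqP a x) => ax; case: (leqP b x) => bx //=; rewrite ?addr0 ?subrr //; lia.
Qed.

End Masses.

(** [rk] certifies the heavy path property without mentioning sizes: it grows weakly towards the
    root and strictly above a head, so a climb leaves at most [Lg] paths. *)
Record hld n (L : adjlists n) (Lg : nat) (pos vert h pp rk : nat -> nat) : Prop := Hld {
  hl_pp : forall x, 0 < x < n -> pp x < x;
  hl_h : forall x, x < n -> h x = x \/ [/\ 0 < x, pp x = x.-1 & h x = h x.-1];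
  hl_pos : forall v, v < n -> pos v < n /\ vert (pos v) = v;
  hl_vert : forall x, x < n -> vert x < n /\ pos (vert x) = x;
  hl_adj : forall x, 0 < x < n -> vert x \in nb L (vert (pp x));
  hl_rk : forall x, x < n -> rk x <= Lg;
  hl_rk1 : forall x, 0 < x < n -> rk x <= rk (pp x);
  hl_rk2 : forall x, 0 < x < n -> h x = x -> rk x < rk (pp x)
}.

(** * Tree paths as few intervals, and their masses *)

Section Paths.
Variables (R : realType) (W n Ix Lg : nat).
Variables (LG LT : adjlists n) (w : {set 'I_n} -> R).
Hypothesis bigW : 128 * Ix.+1 <= 2 ^ W.
Hypothesis n_gt0 : 0 < n.
Hypothesis nIx : 4 * n.+4 <= Ix.
Hypothesis LgE : Lg = trunc_log 2 n.
Notation wp := (wp W Ix LG LT w).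
Implicit Types s : st R.
Hypothesis deg_le : forall L v, L = LG \/ L = LT -> size (nb L v) <= n.
Hypothesis connT : forall P : nat -> Prop, P 0 ->
  (forall v u, v < n -> P v -> u \in nb LT v -> P u) -> forall v, v < n -> P v.

Lemma sum_reindex (q f : nat -> nat) :
  (forall k, k < n -> q k < n) ->
  (forall k l, k < n -> l < n -> q k = q l -> k = l) ->
  \sum_(0 <= k < n) f (q k) = \sum_(0 <= v < n) f v.
Proof.
move=> lt inj; rewrite /index_iota subn0 -(big_map q xpredT f); apply: perm_big.
have u : uniq (map q (iota 0 n)).
  rewrite map_inj_in_uniq ?iota_uniq // => k l; rewrite !mem_iota /= !add0n; exact: inj.
have sub : {subset map q (iota 0 n) <= iota 0 n}.
  by move=> _ /mapP[k +] ->; rewrite !mem_iota /= !add0n; apply: lt.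
apply: uniq_perm (iota_uniq _ _) _ => //.
by have [|_ ] := uniq_min_size u sub; rewrite ?size_map.
Qed.

Lemma layout_spec s : rg s rNn = n ->
  zero_arr s [:: aQ; aVis; aBp; aSz; aHs; aHv] ->
  wp c_layout (fun s' => (exists rk,
    hld LT Lg (ar s' aPos) (ar s' aVert) (ar s' aHead) (ar s' aPp) rk) /\
    tk s' <= tk s + 4 * n + \sum_(0 <= v < n) size (nb LT v)) s.
Proof.
move=> hn hz; rewrite /c_layout; wps.
apply: (wp_use (@bfs_spec R W n Ix LG LT w bigW n_gt0 nIx deg_le connT s hn _)).
  by move=> a i; rewrite !inE => ha; apply: hz; rewrite !inE; case/or3P: ha => ->; rewrite ?orbT.
move=> s1 F1 [B1 all1 t1].
have bpl k : 0 < k < n -> ar s1 aBp k < k by move=> /(bi_bp B1)[].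
apply: (wp_use (@sizes_spec R W n Ix LG LT w bigW n_gt0 nIx s1 _ _ bpl)).
- by rewrite (fr_rg F1).
- move=> a i; rewrite !inE => ha; rewrite (fr_ar F1); last by case/or3P: ha => /eqP->.
  by apply: hz; rewrite !inE; case/or3P: ha => ->; rewrite ?orbT.
move=> s2 F2 [Z2 t2].
have EQ : ar s2 aQ = ar s1 aQ by rewrite (fr_ar F2).
have EB : ar s2 aBp = ar s1 aBp by rewrite (fr_ar F2).
apply: (wp_use (@chains_spec R W n Ix LG LT w bigW n_gt0 nIx s2 (ar s2 aSz) (ar s2 aHs) _ _ _ _ _ Z2)).
- by rewrite (fr_rg F2) // (fr_rg F1).
- by rewrite EQ; apply: bi_inj B1.
- by rewrite EQ; apply: bi_lt B1.
- by rewrite EB.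
- by rewrite EB; apply: bi_bp0 B1.
move=> s3 F3 [C3 laid3 t3].
have EQ3 : ar s3 aQ = ar s1 aQ by rewrite (fr_ar F3).
have EB3 : ar s3 aBp = ar s1 aBp by rewrite (fr_ar F3).
have EV3 : ar s3 aHv = ar s2 aHv by rewrite (fr_ar F3).
split; last first.
  have := sum_reindex (fun v => size (nb LT v)) (bi_lt B1) (bi_inj B1); lia.
rewrite EQ3 EB3 EV3 in C3; rewrite EB in Z2.
have ord0 : ar s3 aOrd 0 = 0 /\ ar s3 aPp 0 = 0 by exact: ch_root C3 n_gt0.
have ordP x : 0 < x < n -> 0 < ar s3 aOrd x.
  move=> hx; case: (posnP (ar s3 aOrd x)) => // E.
  by have := chain_inv_inj C3 (k := x) (l := 0); rewrite E ord0.1; lia.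
have ordn x : x < n -> ar s3 aOrd x < n by move=> /(ch_ord C3)[].
have ppP x : 0 < x < n -> ar s3 aPp x < x /\ ar s3 aOrd (ar s3 aPp x) = ar s1 aBp (ar s3 aOrd x).
  by move=> hx; apply: (ch_pp C3) (ordP _ hx); lia.
have szn i : i < n -> ar s2 aSz i < n.
  case: (posnP i) => [->|i0] li; last by case: (@zi_c _ _ _ _ _ _ Z2 i); rewrite ?i0.
  by have := zi_sum Z2; rewrite big_nat1; lia.
have szp i : 0 < i < n -> ar s2 aSz i < ar s2 aSz (ar s1 aBp i).
  by move=> hi; have [_ z2 _] := zi_c Z2 hi; have := zi_hs Z2 (ar s1 aBp i); lia.
(* The rank is the logarithm of the subtree size, which is at most [n]. *)
exists (fun x => trunc_log 2 (ar s2 aSz (ar s3 aOrd x)).+1); split.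
- by move=> x /ppP[].
- move=> x xn; case: (ch_h C3 xn) => [[-> _]|[x0 p1 p2 _]]; first by left.
  by right.
- move=> v vn; have [k kn <-] := all1 v vn; have [l1 l2] := laid3 k kn.
  have [_ _ v1 v2] := ch_ord C3 l1; rewrite l2 in v1 v2.
  by rewrite v2 v1.
- move=> x xn; have [o1 o2 o3 o4] := ch_ord C3 xn; rewrite o3; split=> //.
  exact: (bi_lt B1).
- move=> x hx; have [p1 p2] := ppP x hx; have xn : x < n by lia.
  have pn : ar s3 aPp x < n by lia.
  have [o1 _ -> _] := ch_ord C3 xn; have [_ _ -> _] := ch_ord C3 pn; rewrite p2.
  by have [|_] := bi_bp B1 (k := ar s3 aOrd x); rewrite ?ordP ?o1.
- by move=> x xn; rewrite LgE; apply: leq_trunc_log; apply: szn; apply: ordn.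
- move=> x hx; have [p1 p2] := ppP x hx; rewrite p2; apply: leq_trunc_log.
  by apply: ltnW; apply: szp; rewrite ordP // ordn //; lia.
- move=> x hx hE; have [p1 p2] := ppP x hx; rewrite p2.
  have xn : x < n by lia.
  have ho : 0 < ar s3 aOrd x < n by rewrite ordP // ordn.
  (* A position that is its own head is no heavy child: a position continuing a path has the head of
     its predecessor, which is smaller. *)
  have ne : ar s3 aOrd x != ar s2 aHv (ar s1 aBp (ar s3 aOrd x)).
    case: (ch_h C3 xn) => [[_ [E|/eqP]]|[x0 q1 q2 _]].
    + by rewrite E in ho.
    + by rewrite eq_sym.
    + have := head_le (pp := ar s3 aPp) (h := ar s3 aHead) (n := n) _ (x := x.-1).
      rewrite -q2 hE => H; exfalso; have := H _ _; move=> {}H.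
      suff : x <= x.-1 by lia.
      apply: H; last lia.
      move=> y yn; case: (ch_h C3 yn) => [[-> _]|[y0 r1 r2 _]]; [by left | by right].
  (* A light child has at most half the size of its parent, hence a smaller logarithm. *)
  have [_ z2 z3] := zi_c Z2 ho; have := z3 ne => z4.
  set m := (ar s2 aSz (ar s3 aOrd x)).+1.
  have <- : trunc_log 2 m.*2 = (trunc_log 2 m).+1 by rewrite trunc_log2S ?doubleK //; lia.
  by apply: leq_trunc_log; lia.
Qed.

Lemma walk_spec s rk u v : rg s rU = u -> rg s rV = v -> u < n -> v < n ->
  hld LT Lg (ar s aPos) (ar s aVert) (ar s aHead) (ar s aPp) rk -> 4 * Lg + 4 <= Ix ->
  wp c_walk (fun s' => exists k,
    [/\ rg s' rC = k.*2, k <= 2 * Lg + 1, forall j, j < k.*2 -> ar s' aMk j <= n,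
      (forall x, msum R (ar s' aMk) k.*2 x = (anc (ar s aPp) x u (+) anc (ar s aPp) x v)%:R)%R
    & tk s' <= tk s + 2 * Lg]) s.
Proof.
move=> hu hv un vn H LI; have Pl := hl_pp H; have Ph := hl_h H.
have hle := head_le Ph.
pose pp := ar s aPp; pose h := ar s aHead.
rewrite /c_walk; wps; split=> //.
(* Ranks pay for intervals: each climb raises the rank of one end by at least one, and both ranks
   stay at most [Lg]. *)
pose I s' := exists k, [/\ rg s' rC = k.*2, k <= rk (rg s' rU) + rk (rg s' rV),
  [/\ rg s' rU < n, rg s' rV < n & tk s' <= tk s + k], forall j, j < k.*2 -> ar s' aMk j <= n &
  (forall x, msum R (ar s' aMk) k.*2 x + (anc pp x (rg s' rU) (+) anc pp x (rg s' rV))%:R =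
    (anc pp x u (+) anc pp x v)%:R)%R].
have rkh x : x < n -> rk x <= rk (h x).
  rewrite /h; elim: x => [|x IH] xn; case: (Ph _ xn) => [->|[]] //= _ p1 p2.
  rewrite p2; apply: leq_trans (IH _); last lia.
  by have := hl_rk1 H (x := x.+1); rewrite p1; apply; lia.
have up x : x < n -> 0 < h x -> rk x < rk (pp (h x)) /\ pp (h x) < n.
  move=> xn hx0; have := hle _ xn; rewrite -/h => hx; have hxn : 0 < h x < n by lia.
  split; last by have := Pl _ hxn; rewrite -/pp; lia.
  apply: leq_ltn_trans (rkh _ xn) _; apply: (hl_rk2 H) => //.
  exact: (head_idem Ph).
apply: (@wpw_use _ _ _ _ _ _ _ _ _ (fun s' => I s' /\ h (rg s' rU) = h (rg s' rV))).
  apply: (wp_while (I := I) (mu := fun s' => (4 * Lg + 1) - rg s' rC)).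
    by exists 0; wps; rewrite hu hv addn0; split=> // x; rewrite /msum big_geq // add0r.
  move=> s2 F [k [k1 k2 [u2 v2 t2] k3 k4]].
  have EH : ar s2 aHead = h by rewrite (fr_ar F).
  have EP : ar s2 aPp = pp by rewrite (fr_ar F).
  have ru := hl_rk H u2; have rv := hl_rk H v2.
  wps; rewrite EH EP; split; first by spl; lia.
  rewrite lt0b eqb0; case: ifP => [neq|/negbFE/eqP E]; last by split=> //; exists k.
  have := hle _ u2; have := hle _ v2; rewrite -/h => hlv hlu.
  split; first by spl; lia.
  rewrite lt0b addn1; case: ifP => lt.
    have h0 : 0 < h (rg s2 rV) by lia.
    have [r1 r2] := up _ v2 h0.
    rewrite k1; spl; try lia; exists k.+1; wps; rewrite ?EP ?EH ?k1 doubleS; spl => //; try lia.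
    - move=> j jk; rewrite /upd; case: eqP => [_|n1]; first lia.
      by case: eqP => [_|n2]; [lia | apply: k3; lia].
    - move=> x; rewrite -k4 -[k.*2.+2]addn2 msum_interval; last lia.
      have := cross_step Pl Ph x v2 u2 lt; rewrite -/pp -/h addbC => ->.
      by rewrite natrD addrA addn1 ltnS; congr (_ + _)%R; rewrite addbC.
  have lt' : h (rg s2 rV) < h (rg s2 rU) by lia.
  have h0 : 0 < h (rg s2 rU) by lia.
  have [r1 r2] := up _ u2 h0.
  rewrite k1; spl; try lia; exists k.+1; wps; rewrite ?EP ?EH ?k1 doubleS; spl => //; try lia.
  - move=> j jk; rewrite /upd; case: eqP => [_|n1]; first lia.
    by case: eqP => [_|n2]; [lia | apply: k3; lia].
  - move=> x; rewrite -k4 -[k.*2.+2]addn2 msum_interval; last lia.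
    have := cross_step Pl Ph x u2 v2 lt'; rewrite -/pp -/h => ->.
    by rewrite natrD addrA addn1 ltnS.
move=> s2 F [[k [k1 k2 [u2 v2 t2] k3 k4]] E].
have ru := hl_rk H u2; have rv := hl_rk H v2.
split=> //; rewrite lt0b; case: ifP => uv; rewrite k1; spl; try lia; exists k.+1; wps;
  rewrite ?k1 doubleS; spl; try lia.
- move=> j jk; rewrite /upd; case: eqP => [_|n1]; first lia.
  by case: eqP => [_|n2]; [lia | apply: k3; lia].
- move=> x; rewrite -k4 -[k.*2.+2]addn2 msum_interval; last lia.
  by rewrite (cross_last Pl Ph x v2 uv E) !addn1 ltnS.
- move=> j jk; rewrite /upd; case: eqP => [_|n1]; first lia.
  by case: eqP => [_|n2]; [lia | apply: k3; lia].
- move=> x; rewrite -k4 -[k.*2.+2]addn2 msum_interval; last lia.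
  have vu : rg s2 rV <= rg s2 rU by lia.
  by rewrite addbC (cross_last Pl Ph x u2 vu (esym E)) !addn1 ltnS.
Qed.

(** The bounds on rows and columns are not strict: the right end of an interval can be [n], one past
    the last position. *)
Definition bk s (ml : seq (nat * nat * R)) :=
  [/\ rg s rK = size ml, cells (ar s aNx) (ar s aCol) (wa s bDel) ml,
      (forall r, ar s aHd r = lastm ml r) & all (fun m => (m.1.1 <= n) && (m.1.2 <= n)) ml].

Lemma push_spec s ml : bk s ml -> rg s rP <= n -> rg s rX <= n -> (size ml).+1 < Ix ->
  wp c_push (fun s' => bk s' ((rg s rP, rg s rX, wr s vDd) :: ml) /\ tk s' = tk s) s.
Proof.
case=> b1 b2 b3 b4 hp hx hI; rewrite /c_push; wps; rewrite b1 addn1; rewrite /bk; wps; spl; try lia; rewrite //= ?upd_same //.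
- by split=> //; apply: cells_upd.
- by move=> r; rewrite /upd eq_sym; case: eqP.
- by rewrite hp hx.
Qed.

Lemma marks_spec s ml c : bk s ml -> rg s rC = c -> ~~ odd c ->
  (forall j, j < c -> ar s aMk j <= n) -> size ml + c * (c + 2) < Ix -> c < Ix ->
  wp c_marks (fun s' => exists ml',
    [/\ bk s' ml', size ml' = size ml + c * (c + 2), tk s' <= tk s + c + c * c
      & forall e f, (mv ml' e f = mv ml e f +
          wr s vLn * (msum R (ar s aMk) c e + msum R (ar s aMk) c f) -
          wr s vPr * msum R (ar s aMk) c e * msum R (ar s aMk) c f)%R]) s.
Proof.
move=> bk0 hc ec hm hI hcI; rewrite /c_marks; wps; split=> //.
set mk := ar s aMk; set lin := wr s vLn; set prd := wr s vPr.
(* After [a] rounds the row factor of the product is the sum over the first [a] marks, while the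
   column factor is already complete. *)
pose I s' := exists ml', let a := rg s' rA in
  [/\ bk s' ml', size ml' = size ml + a * (c + 2), tk s' <= tk s + a + a * c, a <= c &
   [/\ wr s' vLn = ((-1) ^+ a * lin)%R, wr s' vPr = ((-1) ^+ a * prd)%R
   & forall e f, (mv ml' e f = mv ml e f + lin * (msum R mk a e + msum R mk a f) -
          prd * msum R mk a e * msum R mk c f)%R]].
apply: (wp_while (I := I) (mu := fun s' => c - rg s' rA)).
  exists ml; wps; rewrite !expr0 !mul1r addn0; split=> //; try lia.
  by split=> // e f; rewrite /msum !(big_geq (leqnn 0)) !(addr0, mulr0, mul0r, subr0).
move=> s2 F [ml2 [b2 z2 t2 a2 [L2 P2 V2]]].
have EC : rg s2 rC = c by rewrite (fr_rg F).
have EM : ar s2 aMk = mk by rewrite (fr_ar F).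
set a := rg s2 rA in z2 t2 a2 L2 P2 V2 *.
wps; rewrite EC; split; first by spl; lia.
rewrite lt0b; case: ifP => ac; last first.
  have E : a = c by lia.
  by rewrite E in z2 t2 V2; exists ml2; split.
have mka : mk a <= n by apply: hm; lia.
rewrite EM; spl; try lia.
set s3 := sr _ rX 0.
have ac' : a.+1 * (c + 2) <= c * (c + 2) by rewrite leq_mul2r; lia.
have b3 : bk s3 ml2 by [].
apply: (wp_use (push_spec b3 _ _ _)); [done|done|nia|].
move=> s4 F4 [b4 t4].
have Ep4 : rg s4 rP = mk a by rewrite (fr_rg F4).
have Ed4 : wr s4 vDd = wr s2 vLn by rewrite (fr_wr F4).
have Ex4 : rg s3 rX = 0 by [].
wps; spl=> //; set s5 := sr _ rP 0.
have b5 : bk s5 ((rg s3 rP, rg s3 rX, wr s3 vDd) :: ml2) by [].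
apply: (wp_use (push_spec b5 _ _ _)); [done|by rewrite /s5; wps; rewrite Ep4|rewrite /=; nia|].
move=> s6 F6 [b6 t6].
have Ep6 : rg s6 rX = mk a by rewrite (fr_rg F6) //; rewrite /s5; wps; rewrite Ep4.
have Ea6 : rg s6 rA = a by rewrite (fr_rg F6) //; rewrite /s5; wps; rewrite (fr_rg F4).
have Ec6 : rg s6 rC = c by rewrite (fr_rg F6) //; rewrite /s5; wps; rewrite (fr_rg F4).
have Em6 : ar s6 aMk = mk by rewrite (fr_ar F6) //; rewrite /s5; wps; rewrite (fr_ar F4).
have El6 : wr s6 vLn = wr s2 vLn by rewrite (fr_wr F6) //; rewrite /s5; wps; rewrite (fr_wr F4).
have Er6 : wr s6 vPr = wr s2 vPr by rewrite (fr_wr F6) //; rewrite /s5; wps; rewrite (fr_wr F4).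
have ml6 : forall e f, (mv [:: (rg s5 rP, rg s5 rX, wr s5 vDd), (rg s3 rP, rg s3 rX, wr s3 vDd) & ml2] e f =
   mv ml2 e f + lin * ((if (mk a <= e)%N then (-1) ^+ a else 0) + if (mk a <= f)%N then (-1) ^+ a else 0))%R.
  move=> e f; rewrite !mv_cons /s3 /s5; wps; rewrite /= Ep4 Ed4 L2 !leq0n andbT.
  by case: (mk a <= e); case: (mk a <= f); rewrite /=; ring.
move: b6 ml6; set m6 := [:: _, _ & ml2] => b6 ml6.
have z6 : size m6 = size ml2 + 2 by rewrite /m6 /= addn2.
wps; spl=> //; rewrite Ep6 Er6 P2.
pose J s' := exists ml', let b := rg s' rB in
  [/\ bk s' ml', size ml' = size ml2 + 2 + b, tk s' <= tk s2 + b, b <= c &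
   [/\ rg s' rP = mk a, wr s' vQq = (- ((-1) ^+ a * (-1) ^+ b * prd))%R
   & forall e f, (mv ml' e f = mv m6 e f -
       prd * (if (mk a <= e)%N then (-1) ^+ a else 0) * msum R mk b f)%R]].
apply: (@wpw_use _ _ _ _ _ _ _ _ _ (fun s' => J s' /\ rg s' rB = c)).
  apply: (wp_while (I := J) (mu := fun s' => c - rg s' rB)).
    exists m6; wps; rewrite !expr0 mulr1 sub0r addn0; split=> //.
    - by rewrite t6 /= t4 /s3 /= addn0.
    - split=> // e f; by rewrite /msum !(big_geq (leqnn 0)) mulr0 subr0.
  move=> s7 F7 [m7 [b7 z7 t7 l7 [P7 Q7 V7]]].
  have Ec7 : rg s7 rC = c by rewrite (fr_rg F7).
  have Em7 : ar s7 aMk = mk by rewrite (fr_ar F7).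
  wps; rewrite Ec7; split; first by spl; lia.
  rewrite lt0b; case: ifP => bc; last by split; [exists m7 | lia].
  set b := rg s7 rB in z7 t7 l7 Q7 V7 bc *.
  have mkb : mk b <= n by apply: hm; lia.
  rewrite Em7; spl; try lia; set s8 := swr _ vDd _.
  have b8 : bk s8 m7 by [].
  apply: (wp_use (push_spec b8 _ _ _)); [by rewrite /s8; wps; rewrite P7|by []|rewrite z7; nia|].
  move=> s9 F9 [b9 t9].
  have Eb9 : rg s9 rB = b by rewrite (fr_rg F9).
  have Ep9 : rg s9 rP = mk a by rewrite (fr_rg F9) //; rewrite /s8; wps; rewrite P7.
  have Eq9 : wr s9 vQq = wr s7 vQq by rewrite (fr_wr F9).
  wps; rewrite Eb9; spl => //; try lia; exists ((rg s8 rP, rg s8 rX, wr s8 vDd) :: m7); wps.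
  rewrite ?Eb9; split=> //=; [lia | rewrite t9 /s8; wps; lia |].
  split=> //; first by rewrite Eq9 Q7 addn1 exprS; ring.
  move=> e f; rewrite mv_cons V7 /s8; wps; rewrite /= P7 Q7 addn1 msumS.
  by case: (mk a <= e); case: (mk b <= f); rewrite /=; ring.
move=> s7 F7 [[m7 [b7 z7 t7 l7 [P7 Q7 V7]]] E7].
have Ea7 : rg s7 rA = a by rewrite (fr_rg F7).
have El7 : wr s7 vLn = wr s2 vLn by rewrite (fr_wr F7).
have Er7 : wr s7 vPr = wr s2 vPr by rewrite (fr_wr F7).
rewrite Ea7 E7 in z7 t7 V7 *; spl=> //; try lia.
exists m7; wps; rewrite ?Ea7 ?El7 ?Er7 ?L2 ?P2 addn1; split=> //; try nia.
split; [by rewrite exprS; ring | by rewrite exprS; ring |].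
move=> e f; rewrite V7 ml6 V2 !msumS.
by case: (mk a <= e); case: (mk a <= f); rewrite /=; ring.
Qed.

End Paths.

(** * Masses of all edges and penalties *)

Section Edges.
Variables (R : realType) (W n Ix Lg : nat).
Variables (LG LT : adjlists n) (w : {set 'I_n} -> R).
Hypothesis bigW : 128 * Ix.+1 <= 2 ^ W.
Hypothesis n_gt0 : 0 < n.
Hypothesis nIx : 4 * n.+4 <= Ix.
Hypothesis LgE : Lg = trunc_log 2 n.
Notation wp := (wp W Ix LG LT w).
Implicit Types s : st R.
Hypothesis deg_le : forall L v, L = LG \/ L = LT -> size (nb L v) <= n.

(** Two marks for each of at most [2 * Lg + 1] intervals. [MM] bounds the masses of a path, two plus
    [Cm] for each mark, and [PT] the ticks of the walk and of the two nested loops over marks. *)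
Let Cm := 4 * Lg + 2.
Let MM := Cm * (Cm + 2).
Let PT := 2 * Lg + Cm + Cm * Cm.

Definition pval (lin prd : R) (A : nat -> bool) e f : R :=
  (lin * ((A e)%:R + (A f)%:R) - prd * (A e)%:R * (A f)%:R)%R.

Lemma path_spec s rk u v ml : bk n s ml -> rg s rU = u -> rg s rV = v -> u < n -> v < n ->
  hld LT Lg (ar s aPos) (ar s aVert) (ar s aHead) (ar s aPp) rk ->
  size ml + MM < Ix ->
  wp c_path (fun s' => exists ml',
    [/\ bk n s' ml', size ml' <= size ml + MM, tk s' <= tk s + PT
      & forall e f, (mv ml' e f = mv ml e f + pval (wr s vLn) (wr s vPr)
          (fun x => anc (ar s aPp) x u (+) anc (ar s aPp) x v) e f)%R]) s.
Proof.
move=> bk0 hu hv un vn H hI; rewrite /c_path; wps.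
have CI : 4 * Lg + 4 <= Ix by move: hI; rewrite /MM /Cm; nia.
apply: (wp_use (walk_spec LG w bigW n_gt0 nIx LgE hu hv un vn H CI)).
move=> s1 F1 [k [k1 k2 k3 k4 t1]].
have kC : k.*2 <= Cm by rewrite /Cm; lia.
have kM : k.*2 * (k.*2 + 2) <= MM by rewrite /MM; apply: leq_mul => //; lia.
have bk1 : bk n s1 ml.
  case: bk0 => b1 b2 b3 b4; split=> //; first by rewrite (fr_rg F1).
    by rewrite !(fr_ar F1) // (fr_wa F1).
  by move=> r; rewrite (fr_ar F1).
apply: (wp_use (marks_spec LG LT w bigW n_gt0 nIx LgE bk1 k1 _ k3 _ _)).
- by rewrite odd_double.
- lia.
- lia.
move=> s2 F2 [ml2 [b2 z2 t2 v2]]; exists ml2; split=> //; first lia.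
  by have : k.*2 * k.*2 <= Cm * Cm := leq_mul kC kC; rewrite /PT; lia.
by move=> e f; rewrite v2 !k4 !(fr_wr F1) // /pval addrA.
Qed.

Definition cr (pos pp : nat -> nat) a b x := anc pp x (pos a) (+) anc pp x (pos b).

Definition edge_val pos pp i j e f : R :=
  pval (query_wt LG w i j) (query_wt LG w i j + query_wt LG w i j)%R
    (cr pos pp i (nth 0 (nb LG i) j)) e f.

Definition fake_val pos pp (inf : R) i e f : R :=
  if size (nb LT i) == 2 then
    pval 0 (0 - inf)%R (cr pos pp (nth 0 (nb LT i) 0) (nth 0 (nb LT i) 1)) e f
  else 0%R.

(** One path for each adjacency entry and at most one penalty path for each vertex. *)
Definition npaths i := \sum_(0 <= i' < i) (size (nb LG i')).+1.

Lemma npathsS i : npaths i.+1 = npaths i + (size (nb LG i)).+1.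
Proof. by rewrite /npaths big_nat_recr. Qed.

Lemma npaths_le i j : i <= j -> npaths i <= npaths j.
Proof. by move=> /subnK <-; elim: (j - i) => // d IH; rewrite addSn npathsS; lia. Qed.

Lemma edges_spec s rk : rg s rNn = n ->
  hld LT Lg (ar s aPos) (ar s aVert) (ar s aHead) (ar s aPp) rk ->
  zero_arr s [:: aHd] -> npaths n * MM < Ix ->
  wp c_edges (fun s' => exists ml,
    [/\ bk n s' ml, size ml <= npaths n * MM, tk s' <= tk s + n + npaths n * PT.+1
      & forall e f, (mv ml e f = \sum_(0 <= i < n)
          (\sum_(0 <= j < size (nb LG i)) edge_val (ar s aPos) (ar s aPp) i j e f
           + fake_val (ar s aPos) (ar s aPp) (wr s vInf) i e f))%R]) s.
Proof.
move=> hn H hz hI; rewrite /c_edges; wps; split=> //; split=> //.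
set pos := ar s aPos; set pp := ar s aPp; set inf := wr s vInf.
have step X a b x : x <= a * X -> a < b -> x + X <= b * X.
  move=> h1 h2; apply: leq_trans (_ : a.+1 * X <= _); first by rewrite mulSn; lia.
  by rewrite leq_mul2r h2 orbT.
pose I s' := exists ml, let i := rg s' rI in
  [/\ bk n s' ml, size ml <= npaths i * MM, tk s' <= tk s + i + npaths i * PT.+1, i <= n
    & forall e f, (mv ml e f = \sum_(0 <= i < i)
          (\sum_(0 <= j < size (nb LG i)) edge_val pos pp i j e f
           + fake_val pos pp inf i e f))%R].
apply: (wp_while (I := I) (mu := fun s' => n - rg s' rI)).
  exists [::]; wps; split=> //; try lia.
    by split=> //= r; rewrite hz.
  by move=> e f; rewrite /mv big_nil big_geq.
move=> s2 F [ml2 [b2 z2 t2 i2 v2]].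
have EN : rg s2 rNn = n by rewrite (fr_rg F).
have EP : ar s2 aPos = pos by rewrite (fr_ar F).
have EV : ar s2 aVert = ar s aVert by rewrite (fr_ar F).
have EH : ar s2 aHead = ar s aHead by rewrite (fr_ar F).
have EPp : ar s2 aPp = pp by rewrite (fr_ar F).
have EI : wr s2 vInf = inf by rewrite (fr_wr F).
wps; rewrite EN; split; first by spl; lia.
set i := rg s2 rI in z2 t2 i2 v2 *.
rewrite lt0b; case: ifP => it; last first.
  have E : i = n by lia.
  by rewrite E in z2 t2 v2; exists ml2; split.
have nS := npathsS i; have nle : npaths i.+1 <= npaths n by apply: npaths_le; lia.
have nI : npaths i.+1 * MM < Ix by apply: leq_ltn_trans hI; rewrite leq_mul2r nle orbT.
split=> //.
pose J s' := exists ml, let j := rg s' rJ in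
  [/\ bk n s' ml, size ml <= (npaths i + j) * MM, tk s' <= tk s + i + (npaths i + j) * PT.+1,
      j <= size (nb LG i)
    & forall e f, (mv ml e f = mv ml2 e f + \sum_(0 <= j < j) edge_val pos pp i j e f)%R].
apply: (@wpw_use _ _ _ _ _ _ _ _ _ (fun s' => J s' /\ rg s' rJ = size (nb LG i))).
  apply: (wp_while (I := J) (mu := fun s' => size (nb LG i) - rg s' rJ)).
    exists ml2; wps; rewrite addn0; split=> //.
    by move=> e f; rewrite big_geq // addr0.
  move=> s4 F4 [ml4 [b4 z4 t4 j4 v4]].
  have EI4 : rg s4 rI = i by rewrite (fr_rg F4).
  have EP4 : ar s4 aPos = pos by rewrite (fr_ar F4).
  have EV4 : ar s4 aVert = ar s aVert by rewrite (fr_ar F4).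
  have EH4 : ar s4 aHead = ar s aHead by rewrite (fr_ar F4).
  have EPp4 : ar s4 aPp = pp by rewrite (fr_ar F4).
  have dn : size (nb LG i) <= n by apply: deg_le; left.
  wps; rewrite EI4 query_degE; split; first by spl; lia.
  set j := rg s4 rJ in z4 t4 j4 v4 *.
  rewrite lt0b; case: ifP => jt; last by split; [exists ml4; split | lia].
  have un : nth 0 (nb LG i) j < n.
    by apply: (@nb_lt _ LG i); apply: mem_nth; rewrite -addn1.
  rewrite query_nbrE EP4; spl => //; try lia.
  set s5 := swr _ vPr _.
  have b5 : bk n s5 ml4 by [].
  have H5 : hld LT Lg (ar s5 aPos) (ar s5 aVert) (ar s5 aHead) (ar s5 aPp) rk.
    by rewrite /s5; wps; rewrite EP4 EV4 EH4 EPp4.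
  have iin : i < n by lia.
  have p1 : pos i < n by case: (hl_pos H iin).
  have p2 : pos (nth 0 (nb LG i) j) < n by case: (hl_pos H un).
  apply: (wp_use (path_spec b5 (u := pos i) (v := pos (nth 0 (nb LG i) j)) _ _ p1 p2 H5 _)) => //.
    by apply: leq_ltn_trans nI; rewrite nS; apply: step; eauto; lia.
  move=> s6 F6 [ml6 [b6 z6 t6 v6]].
  have Ej : rg s6 rJ = j by rewrite (fr_rg F6).
  rewrite Ej; spl => //; try lia; exists ml6; wps; rewrite ?Ej; split=> //.
  - by apply: leq_trans z6 _; apply: step; eauto; lia.
  - by move: t6; rewrite /s5; wps; rewrite addn1 addnS mulSn; lia.
  - move=> e f; rewrite addn1 big_nat_recr //= v6 v4 -addrA; congr (_ + (_ + _))%R.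
    by rewrite /edge_val /s5; wps; rewrite EPp4.
move=> s4 F4 [[ml4 [b4 z4 t4 j4 v4]] Ej].
rewrite Ej in z4 t4 v4.
have EI4 : rg s4 rI = i by rewrite (fr_rg F4).
have EP4 : ar s4 aPos = pos by rewrite (fr_ar F4).
have EV4 : ar s4 aVert = ar s aVert by rewrite (fr_ar F4).
have EH4 : ar s4 aHead = ar s aHead by rewrite (fr_ar F4).
have EPp4 : ar s4 aPp = pp by rewrite (fr_ar F4).
have Einf : wr s4 vInf = inf by rewrite (fr_wr F4).
rewrite EI4 EP4 query_degE !query_nbrE; split=> //; rewrite lt0b.
case: ifP => d2.
  have lt k : k < 2 -> nth 0 (nb LT i) k < n.
    by move=> k2; apply: (@nb_lt _ LT i); apply: mem_nth; rewrite (eqP d2).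
  have l0 := lt 0 isT; have l1 := lt 1 isT.
  spl => //; try lia; set s5 := swr _ vPr _.
  have b5 : bk n s5 ml4 by [].
  have H5 : hld LT Lg (ar s5 aPos) (ar s5 aVert) (ar s5 aHead) (ar s5 aPp) rk.
    by rewrite /s5; wps; rewrite EP4 EV4 EH4 EPp4.
  have p1 : pos (nth 0 (nb LT i) 0) < n by case: (hl_pos H l0).
  have p2 : pos (nth 0 (nb LT i) 1) < n by case: (hl_pos H l1).
  apply: (wp_use (path_spec b5 (u := pos (nth 0 (nb LT i) 0)) (v := pos (nth 0 (nb LT i) 1)) _ _ p1 p2 H5 _)) => //.
    by apply: leq_ltn_trans nI; rewrite nS; apply: step; eauto; lia.
  move=> s6 F6 [ml6 [b6 z6 t6 v6]].
  have Ei : rg s6 rI = i by rewrite (fr_rg F6) //; rewrite /s5; wps; rewrite EI4.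
  rewrite Ei; spl => //; try lia; exists ml6; wps; rewrite ?Ei addn1; split=> //.
  - by apply: leq_trans z6 _; apply: step; eauto; lia.
  - by move: t6; rewrite /s5; wps; rewrite nS [npaths i + _]addnS mulSn; lia.
  - lia.
  - move=> e f; rewrite big_nat_recr //= v6 v4 v2 -!addrA; congr (_ + (_ + _))%R.
    by rewrite /fake_val d2 /s5; wps; rewrite EPp4 Einf.
rewrite ?EI4; spl => //; try lia; exists ml4; wps; rewrite ?EI4 addn1; split=> //.
- by apply: leq_trans z4 _; rewrite leq_mul2r; apply/orP; right; lia.
- by rewrite nS [npaths i + _]addnS mulSn; lia.
- lia.
- by move=> e f; rewrite big_nat_recr //= v4 v2 /fake_val d2 addr0.
Qed.

End Edges.

(** * Programs on the segment tree *)

Notation vSl := 7 (only parsing).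
Notation vV1 := 8 (only parsing).
Notation vV2 := 9 (only parsing).
Notation vCv := 10 (only parsing).
Notation bS := 1 (only parsing).
Notation bV1 := 2 (only parsing).
Notation bV2 := 3 (only parsing).

(** Doubling continues until [$rN] exceeds [n], because column [n] can receive masses and must be a
    leaf too. *)
Definition c_setup :=
  rN <-~ Cn 1 ;; Wh ($rN <=~ $rNn) (rN <-~ $rN +~ $rN) ;;
  WSet vThr (Wad (Wv vB) (Wv vB)) ;; WSet vInf (Wad (Wv vThr) (Wwt (Cn 0) (Cn 0))).

(** If both kept leaves share a class, no other class has been met, and a candidate of another class
    takes second place whatever its value. In the last branch the old leader becomes second unless
    it shares the class of the newcomer. *)
Definition c_ins :=
  Ifw (Wv vV1) (Wv vCv)
    (Ife (aComp @ $rCi ==~ aComp @ $rI1) Skip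
       (Ife (aComp @ $rI2 ==~ aComp @ $rI1) (rI2 <-~ $rCi ;; WSet vV2 (Wv vCv))
          (Ifw (Wv vV2) (Wv vCv) Skip (rI2 <-~ $rCi ;; WSet vV2 (Wv vCv)))))
    (Ife (aComp @ $rCi ==~ aComp @ $rI1) Skip (rI2 <-~ $rI1 ;; WSet vV2 (Wv vV1)) ;;
     rI1 <-~ $rCi ;; WSet vV1 (Wv vCv)).

Definition c_pull1 :=
  rL <-~ $rX +~ $rX ;; rI1 <-~ aI1 @ $rL ;; rI2 <-~ aI2 @ $rL ;;
  WSet vV1 (Wld bV1 $rL) ;; WSet vV2 (Wld bV2 $rL) ;; WSet vSl (Wld bS $rL) ;;
  rL <-~ $rL +~ Cn 1 ;;
  rCi <-~ aI1 @ $rL ;; WSet vCv (Wad (Wv vSl) (Wld bV1 $rL)).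

Definition c_pull2 :=
  rCi <-~ aI2 @ $rL ;; WSet vCv (Wad (Wv vSl) (Wld bV2 $rL)).

Definition c_pull3 :=
  WSto bS $rX (Wad (Wv vSl) (Wld bS $rL)) ;;
  Sto aI1 $rX $rI1 ;; Sto aI2 $rX $rI2 ;; WSto bV1 $rX (Wv vV1) ;; WSto bV2 $rX (Wv vV2).

Definition c_pull := c_pull1 ;; c_ins ;; c_pull2 ;; c_ins ;; c_pull3.

Definition c_upd :=
  rX <-~ $rN +~ $rP ;; WSto bS $rX (Wad (Wld bS $rX) (Wv vDd)) ;;
  WSto bV1 $rX (Wad (Wld bV1 $rX) (Wv vDd)) ;; WSto bV2 $rX (Wad (Wld bV2 $rX) (Wv vDd)) ;;
  rX <-~ $rX /~ Cn 2 ;;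
  Wh (Cn 1 <=~ $rX) (c_pull ;; rX <-~ $rX /~ Cn 2).

Definition c_leaves :=
  rP <-~ Cn 0 ;;
  Wh ($rP <~ $rN)
    (Sto aComp $rP $rP ;; Sto aNxt $rP $rP ;; Sto aCsz $rP (Cn 1) ;;
     Sto aI1 ($rN +~ $rP) $rP ;; Sto aI2 ($rN +~ $rP) $rP ;; rP <-~ $rP +~ Cn 1).

Definition c_build :=
  rX <-~ $rN -~ Cn 1 ;; Wh (Cn 1 <=~ $rX) (c_pull ;; rX <-~ $rX -~ Cn 1).

(** The prefix sums of these three changes are [inf] at column 0 and from column [n] on, that is, at
    the columns which are no tree edges. *)
Definition c_dummies :=
  rP <-~ Cn 0 ;; WSet vDd (Wv vInf) ;; c_upd ;;
  rP <-~ Cn 1 ;; WSet vDd (Wsb Wz (Wv vInf)) ;; c_upd ;;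
  rP <-~ $rNn ;; WSet vDd (Wv vInf) ;; c_upd.

(** * Two smallest values in different classes *)

Section TwoBest.
Variables (R : realType) (val : nat -> R) (cl : nat -> nat).

(** The last clause is vacuous when only one class occurs, so no null value is needed for a missing
    second leaf. *)
Definition tb (S : nat -> Prop) i1 i2 :=
  [/\ S i1, S i2, forall p, S p -> (val i1 <= val p)%R
    & forall p, S p -> cl p <> cl i1 -> cl i2 <> cl i1 /\ (val i2 <= val p)%R].

(** Two leaves represent a whole block: among its leaves outside the class of [i1], a smallest one
    is [r1] or, if [r1] lies in that class, [r2]. *)
Lemma tb_union (S S' : nat -> Prop) r1 r2 i1 i2 :
  tb S' r1 r2 -> tb (fun p => (S p \/ p = r1) \/ p = r2) i1 i2 ->
  tb (fun p => S p \/ S' p) i1 i2.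
Proof.
case=> S1 S2 m1 m2 [T1 T2 n1 n2]; split.
- by case: T1 => [[|->]|->]; auto.
- by case: T2 => [[|->]|->]; auto.
- move=> p [Sp|Sp]; first by apply: n1; auto.
  by apply: le_trans (m1 _ Sp); apply: n1; auto.
- move=> p [Sp|Sp] np; first by apply: n2; auto.
  case: (eqVneq (cl r1) (cl i1)) => [e1|/eqP ne].
    have [|c2 le2] := m2 p Sp; first by rewrite e1.
    have [||c3 le3] := n2 r2; [by auto | by rewrite -e1|].
    by split=> //; apply: le_trans le3 le2.
  have [||c3 le3] := n2 r1; [by auto | by []|].
  by split=> //; apply: le_trans le3 (m1 _ Sp).
Qed.

Lemma eq_tb val' S S' i1 i2 : (forall p, S p <-> S' p) -> (forall p, S p -> val p = val' p) ->
  tb S i1 i2 ->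
  [/\ S' i1, S' i2, forall p, S' p -> (val' i1 <= val' p)%R
    & forall p, S' p -> cl p <> cl i1 -> cl i2 <> cl i1 /\ (val' i2 <= val' p)%R].
Proof.
move=> hS hv [T1 T2 n1 n2]; split; try exact/hS.
- by move=> p /hS Sp; rewrite -!hv //; apply: n1.
- by move=> p /hS Sp; rewrite -!hv //; apply: n2.
Qed.

End TwoBest.

(** * Correctness of the segment tree *)

Section Tree.
Variables (R : realType) (W n Ix : nat).
Variables (LG LT : adjlists n) (w : {set 'I_n} -> R).
Hypothesis bigW : 128 * Ix.+1 <= 2 ^ W.
Hypothesis nIx : 4 * n.+4 <= Ix.
Notation wp := (wp W Ix LG LT w).
Implicit Types s : st R.

Lemma ins_spec s val S : tb val (ar s aComp) S (rg s rI1) (rg s rI2) ->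
  wr s vV1 = val (rg s rI1) -> wr s vV2 = val (rg s rI2) -> wr s vCv = val (rg s rCi) ->
  rg s rI1 < Ix -> rg s rI2 < Ix -> rg s rCi < Ix ->
  wp c_ins (fun s' =>
    [/\ tb val (ar s aComp) (fun p => S p \/ p = rg s rCi) (rg s' rI1) (rg s' rI2),
     wr s' vV1 = val (rg s' rI1), wr s' vV2 = val (rg s' rI2),
     rg s' rI1 < Ix /\ rg s' rI2 < Ix & tk s' = tk s]) s.
Proof.
move=> [S1 S2 m1 m2] v1 v2 vc l1 l2 lc; rewrite /c_ins; wps; split=> //.
set i1 := rg s rI1 in S1 m1 m2 v1 l1 *; set i2 := rg s rI2 in S2 m1 m2 v2 l2 *.
set ci := rg s rCi in vc lc *; set cl := ar s aComp in m1 m2 *.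
have leS a b : (val a <= val b)%R -> forall p, p = b -> (val a <= val p)%R.
  by move=> h p ->.
rewrite v1 v2 vc; case: ifP => [le1|/negbT]; last rewrite -ltNge => lt1.
  split=> //; rewrite lt0b; case: eqP => [e1|n1].
    split=> //; split; auto.
    + by move=> p [/m1|->].
    + by move=> p [Sp|->] np; [apply: m2 | case: np].
  split=> //; rewrite lt0b; case: eqP => [e2|n2]; wps; spl => //.
  + split; auto.
    * by move=> p [/m1|->].
    * by move=> p [Sp|->] np //; have [] := m2 p Sp np; rewrite e2.
  + case: ifP => [le2|/negbT]; last rewrite -ltNge => lt2; wps; spl => //; split; auto.
    * by move=> p [/m1|->].
    * by move=> p [Sp|->] np //; apply: m2.
    * by move=> p [/m1|->].
    * move=> p [Sp|->] np //; have [_ h] := m2 p Sp np; split=> //.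
      exact: le_trans (ltW lt2) h.
split=> //; rewrite lt0b; have le1 := ltW lt1; case: eqP => [e1|n1]; wps; spl => //; split; auto.
- by move=> p [/m1 h|-> //]; apply: le_trans le1 h.
- by rewrite e1; move=> p [Sp|->] np; [apply: m2 | case: np; rewrite e1].
- by move=> p [/m1 h|-> //]; apply: le_trans le1 h.
- move=> p [Sp|->] np; last by case: np.
  by split; [move=> e; apply: n1 | apply: m1].
Qed.

Definition psum (D : nat -> R) lo p : R := (\sum_(lo <= q < p.+1) D q)%R.

(** Prefix sums start at the left end [lo] of the node, so a change at one leaf affects only the
    nodes above it. *)
Record tnode s (D : nat -> R) (cl : nat -> nat) x lo len : Prop := Tnode {
  tn_s : wa s bS x = (\sum_(lo <= q < lo + len) D q)%R;
  tn_tb : tb (psum D lo) cl (fun p => lo <= p < lo + len) (ar s aI1 x) (ar s aI2 x);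
  tn_1 : wa s bV1 x = psum D lo (ar s aI1 x);
  tn_2 : wa s bV2 x = psum D lo (ar s aI2 x)
}.

Lemma eq_tnode s s' D D' cl cl' x lo len :
  wa s' bS x = wa s bS x -> wa s' bV1 x = wa s bV1 x -> wa s' bV2 x = wa s bV2 x ->
  ar s' aI1 x = ar s aI1 x -> ar s' aI2 x = ar s aI2 x ->
  (forall p, lo <= p < lo + len -> D p = D' p /\ cl p = cl' p) ->
  tnode s D cl x lo len -> tnode s' D' cl' x lo len.
Proof.
clear bigW nIx; move=> e1 e2 e3 e4 e5 H [h1 [h2 h2' h2a h2b] h3 h4].
have pE p : lo <= p < lo + len -> psum D' lo p = psum D lo p.
  by move=> hp; apply: eq_big_nat => q hq; have [|-> _] := H q; first lia.
have cE p : lo <= p < lo + len -> cl' p = cl p by move=> /H[].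
split; rewrite ?e1 ?e2 ?e3 ?e4 ?e5 ?pE //.
- by rewrite h1; apply: eq_big_nat => q /H[].
- split=> //.
  + by move=> p hp; rewrite !pE //; apply: h2a.
  + by move=> p hp; rewrite !pE // !cE //; apply: h2b.
Qed.

Lemma pull1_spec s x : rg s rX = x -> x + x + 1 < Ix ->
  wp c_pull1 (fun s' => [/\ rg s' rI1 = ar s aI1 (x + x), rg s' rI2 = ar s aI2 (x + x),
    rg s' rL = x + x + 1, rg s' rCi = ar s aI1 (x + x + 1) &
    [/\ wr s' vV1 = wa s bV1 (x + x), wr s' vV2 = wa s bV2 (x + x), wr s' vSl = wa s bS (x + x),
      wr s' vCv = (wa s bS (x + x) + wa s bV1 (x + x + 1))%R & tk s' = tk s]]) s.
Proof. by move=> hx hI; rewrite /c_pull1; wps; rewrite hx; spl => //; lia. Qed.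

Lemma pull2_spec s x : rg s rL = x -> x < Ix ->
  wp c_pull2 (fun s' => [/\ rg s' rCi = ar s aI2 x,
    wr s' vCv = (wr s vSl + wa s bV2 x)%R & tk s' = tk s]) s.
Proof. by move=> hx hI; rewrite /c_pull2; wps; rewrite hx; spl => //; lia. Qed.

Lemma pull3_spec s x y : rg s rX = x -> rg s rL = y -> x < Ix -> y < Ix ->
  wp c_pull3 (fun s' => [/\ wa s' bS = upd (wa s bS) x (wr s vSl + wa s bS y)%R,
    ar s' aI1 = upd (ar s aI1) x (rg s rI1), ar s' aI2 = upd (ar s aI2) x (rg s rI2),
    wa s' bV1 = upd (wa s bV1) x (wr s vV1) &
    wa s' bV2 = upd (wa s bV2) x (wr s vV2) /\ tk s' = tk s]) s.
Proof. by move=> hx hy xI yI; rewrite /c_pull3; wps; rewrite hx hy; spl => //; lia. Qed.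

Lemma pull_spec s D cl x lo len : cl = ar s aComp -> rg s rX = x -> 0 < len ->
  x + x + 1 < Ix -> lo + len + len <= Ix ->
  tnode s D cl (x + x) lo len -> tnode s D cl (x + x + 1) (lo + len) len ->
  wp c_pull (fun s' => [/\ tnode s' D cl x lo (len + len),
    (forall y, y != x -> [/\ wa s' bS y = wa s bS y, wa s' bV1 y = wa s bV1 y,
       wa s' bV2 y = wa s bV2 y, ar s' aI1 y = ar s aI1 y & ar s' aI2 y = ar s aI2 y])
    & tk s' = tk s]) s.
Proof.
move=> hcl hx l0 hI hI2 A B; rewrite /c_pull.
have [As [A1 A2 A3 A4] Av1 Av2] := A; have [Bs [B1 B2 B3 B4] Bv1 Bv2] := B.
pose val := psum D lo; pose S p := lo <= p < lo + len.
(* Seen from the parent, all prefix sums of the right half grow by the total of the left half, which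
   keeps their order. *)
have shift p : lo + len <= p -> val p = (wa s bS (x + x) + psum D (lo + len) p)%R.
  by move=> hp; rewrite /val /psum (@big_cat_nat _ _ _ (lo + len)) ?As //; lia.
apply: wp_seq; apply: (wp_use (pull1_spec hx hI)) => s1 F1 [i1 i2 iL ic [v1 v2 vs vc k1]].
have aE1 a : ar s1 a = ar s a by rewrite (fr_ar F1).
have bE1 a : wa s1 a = wa s a by rewrite (fr_wa F1).
have x1 : rg s1 rX = x by rewrite (fr_rg F1).
have t1 : tb val (ar s1 aComp) S (rg s1 rI1) (rg s1 rI2) by rewrite aE1 -hcl i1 i2.
apply: wp_seq; apply: (wp_use (ins_spec t1 _ _ _ _ _ _)); rewrite ?i1 ?i2 ?ic ?v1 ?v2 ?vc; try lia.
- by rewrite Av1.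
- by rewrite Av2.
- by rewrite Bv1 shift //; lia.
move=> s2 F2 [t2 v21 v22 [l21 l22] k2].
have aE2 a : ar s2 a = ar s a by rewrite (fr_ar F2).
have bE2 a : wa s2 a = wa s a by rewrite (fr_wa F2).
have x2 : rg s2 rX = x by rewrite (fr_rg F2).
have iL2 : rg s2 rL = x + x + 1 by rewrite (fr_rg F2).
have vs2 : wr s2 vSl = wa s bS (x + x) by rewrite (fr_wr F2).
apply: wp_seq; apply: (wp_use (pull2_spec iL2 hI)) => s3 F3 [ic3 vc3 k3].
have aE3 a : ar s3 a = ar s a by rewrite (fr_ar F3).
have bE3 a : wa s3 a = wa s a by rewrite (fr_wa F3).
have x3 : rg s3 rX = x by rewrite (fr_rg F3).
have iL3 : rg s3 rL = x + x + 1 by rewrite (fr_rg F3).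
have vs3 : wr s3 vSl = wa s bS (x + x) by rewrite (fr_wr F3).
have i13 : rg s3 rI1 = rg s2 rI1 by rewrite (fr_rg F3).
have i23 : rg s3 rI2 = rg s2 rI2 by rewrite (fr_rg F3).
have v13 : wr s3 vV1 = wr s2 vV1 by rewrite (fr_wr F3).
have v23 : wr s3 vV2 = wr s2 vV2 by rewrite (fr_wr F3).
have t3 : tb val (ar s3 aComp) (fun p => S p \/ p = ar s aI1 (x + x + 1)) (rg s3 rI1) (rg s3 rI2).
  by rewrite aE3 i13 i23 -(aE1 aComp).
apply: wp_seq; apply: (wp_use (ins_spec t3 _ _ _ _ _ _)); rewrite ?i13 ?i23 ?v13 ?v23 ?ic3 ?vc3 ?aE2 ?bE2 ?vs2 //; try lia.
  by rewrite Bv2 shift //; lia.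
move=> s4 F4 [t4 v41 v42 [l41 l42] k4].
have aE4 a : ar s4 a = ar s a by rewrite (fr_ar F4).
have bE4 a : wa s4 a = wa s a by rewrite (fr_wa F4).
have x4 : rg s4 rX = x by rewrite (fr_rg F4).
have iL4 : rg s4 rL = x + x + 1 by rewrite (fr_rg F4).
have vs4 : wr s4 vSl = wa s bS (x + x) by rewrite (fr_wr F4).
apply: (wp_use (pull3_spec x4 iL4 _ hI)); first lia.
move=> s5 F5 [e1 e2 e3 e4 [e5 k5]].
rewrite aE3 -hcl in t4.
have tR : tb val cl (fun p => lo + len <= p < lo + len + len) (ar s aI1 (x + x + 1)) (ar s aI2 (x + x + 1)).
  split=> // p hp; first by rewrite !shift ?lerD2l; try lia; apply: B3.
  by rewrite !shift ?lerD2l; try lia; apply: B4.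
have t5 := tb_union tR t4.
split; [split| |by rewrite k5 k4 k3 k2 k1]; rewrite ?e1 ?e2 ?e3 ?e4 ?e5 ?upd_same //.
- by rewrite vs4 bE4 As Bs addnA -big_cat_nat //; lia.
- apply: (eq_tb _ _ t5) => // p; rewrite /S; split; first by case; lia.
  by move=> hp; case: (ltnP p (lo + len)) => h; [left|right]; lia.
- by move=> y /eqP ny; rewrite !upd_diff // !bE4 !aE4.
Qed.

Section Levels.
Variables (H : nat).
Let N := 2 ^ H.
Hypothesis NIx : 4 * N <= Ix.

(** Heap numbering: the root is 1, the children of [x] are [2 x] and [2 x + 1], the leaves are [N]
    to [2 N - 1]. At height [h] the leftmost leaf below [x] is [x * 2 ^ h]. *)
Definition inode h x := N <= x * 2 ^ h < 2 * N.

Definition tn s D cl h x := tnode s D cl x (x * 2 ^ h - N) (2 ^ h).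

Definition tree s D cl := forall h x, inode h x -> tn s D cl h x.

Lemma inode_level h h' x : inode h x -> inode h' x -> h = h'.
Proof.
clear bigW nIx NIx; wlog lt : h h' / h < h' => [G|] i1 i2.
  by case: (ltngtP h h') => // l; [apply: G | apply/esym; apply: G].
move: i1 i2; rewrite /inode => /andP[a _] /andP[_ b]; exfalso.
have : x * 2 ^ h.+1 <= x * 2 ^ h' by rewrite leq_mul2l leq_exp2l ?lt ?orbT.
by rewrite expnS; lia.
Qed.

Lemma inode_le h x : inode h x -> h <= H.
Proof.
case/andP=> a b; rewrite -ltnS -(@ltn_exp2l 2) // expnS -/N; apply: leq_ltn_trans b.
by apply: leq_pmull; have := expn_gt0 2 H; rewrite -/N; case: x a => //; lia.
Qed.

Lemma inode_child h x : inode h.+1 x -> inode h (x + x) /\ inode h (x + x + 1).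
Proof.
move=> i; have hH := inode_le i; move: i; rewrite /inode /N.
have -> : 2 * 2 ^ H = 2 ^ (H - h) * 2 ^ h.+1 by rewrite -expnD -expnS; congr (2 ^ _); lia.
rewrite ltn_mul2r !expnS => /andP[a /andP[_ b]].
have : x.+1 * (2 * 2 ^ h) <= 2 ^ (H - h) * (2 * 2 ^ h) by rewrite leq_mul2r b orbT.
have := expn_gt0 2 h; nia.
Qed.

Lemma inode_anc h p : p < N -> h <= H -> inode h ((N + p) %/ 2 ^ h).
Proof.
move=> pN hH; have e0 : 0 < 2 ^ h by rewrite expn_gt0.
have e : N = 2 ^ (H - h) * 2 ^ h by rewrite -expnD subnK.
apply/andP; split; last by apply: leq_ltn_trans (leq_trunc_div _ _) _; lia.
by rewrite {1}e leq_mul2r; apply/orP; right; rewrite leq_divRL // -e leq_addr.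
Qed.

Lemma node_range h x p : inode h x -> p < N ->
  (x * 2 ^ h - N <= p < x * 2 ^ h - N + 2 ^ h) = (x == (N + p) %/ 2 ^ h).
Proof.
move=> /andP[a b] pN; have e0 : 0 < 2 ^ h by rewrite expn_gt0.
apply/idP/eqP => [hp|->].
  have -> : N + p = x * 2 ^ h + (N + p - x * 2 ^ h) by lia.
  by rewrite divnMDl // divn_small ?addn0 //; lia.
by have := leq_trunc_div (N + p) (2 ^ h); have := ltn_ceil (N + p) e0; rewrite mulSn; lia.
Qed.

Lemma tn_leaf s D cl p : p < N -> ar s aI1 (N + p) = p -> ar s aI2 (N + p) = p ->
  wa s bS (N + p) = D p -> wa s bV1 (N + p) = D p -> wa s bV2 (N + p) = D p ->
  tn s D cl 0 (N + p).
Proof.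
move=> pN e1 e2 e3 e4 e5; rewrite /tn expn0 muln1 addKn.
have pE : psum D p p = D p by rewrite /psum big_nat1.
split; rewrite ?e1 ?e2 ?e3 ?e4 ?e5 ?pE ?addn1 ?big_nat1 //.
have only q : p <= q < p.+1 -> q = p by lia.
by split=> [||q /only->|q /only-> []] //; lia.
Qed.

Lemma pull_level s D h x : rg s rX = x -> inode h.+1 x ->
  tn s D (ar s aComp) h (x + x) -> tn s D (ar s aComp) h (x + x + 1) ->
  wp c_pull (fun s' => [/\ tn s' D (ar s aComp) h.+1 x,
    (forall D' cl' h' y, y != x -> tn s D' cl' h' y -> tn s' D' cl' h' y)
    & tk s' = tk s]) s.
Proof.
move=> hx ix A B; have := inode_child ix; case=> i1 i2.
have e0 : 0 < 2 ^ h by rewrite expn_gt0.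
case/andP: (ix); rewrite expnS => a b; case/andP: (i1) => a1 b1; case/andP: (i2) => a2 b2.
have lo1 : (x + x) * 2 ^ h - N = x * 2 ^ h.+1 - N by rewrite expnS; congr (_ - _); lia.
have lo2 : (x + x + 1) * 2 ^ h - N = x * 2 ^ h.+1 - N + 2 ^ h by rewrite expnS; lia.
rewrite /tn lo1 in A; rewrite /tn lo2 in B.
apply: (wp_use (pull_spec erefl hx e0 _ _ A B)).
- by have : x + x + 1 <= (x + x + 1) * 2 ^ h := leq_pmulr _ e0; lia.
- by rewrite expnS; lia.
move=> s' F [t o k]; split=> //; first by rewrite /tn [in X in tnode _ _ _ _ _ X]expnS mul2n -addnn.
by move=> D' cl' h' y /o[? ? ? ? ?]; apply: eq_tnode.
Qed.

(** Inner nodes are assumed correct only off the path from the leaf to the root, as those on it are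
    rebuilt. One program thus serves changes of a mass and changes of a class. *)
Lemma upd_spec s D p : rg s rN = N -> rg s rP = p -> p < N ->
  (forall h x, inode h x -> x != (N + p) %/ 2 ^ h -> tn s D (ar s aComp) h x) ->
  ar s aI1 (N + p) = p -> ar s aI2 (N + p) = p ->
  wa s bS (N + p) = D p -> wa s bV1 (N + p) = D p -> wa s bV2 (N + p) = D p ->
  wp c_upd (fun s' => tree s' (upd D p (D p + wr s vDd)%R) (ar s aComp) /\
    tk s' <= tk s + H) s.
Proof.
move=> hN hp pN T e1 e2 e3 e4 e5; rewrite /c_upd; wps; rewrite hN hp e3 e4 e5; spl; try lia.
set D' := upd D p _; set cl := ar s aComp; set s1 := sr _ rX _.
pose I s' := exists h, [/\ h <= H, rg s' rX = (N + p) %/ 2 ^ h.+1,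
  (forall h' x, inode h' x -> h' <= h \/ x != (N + p) %/ 2 ^ h' -> tn s' D' cl h' x)
  & tk s' <= tk s + h].
apply: (wp_while (I := I) (mu := fun s' => rg s' rX)).
  exists 0; rewrite /s1; wps; split=> //; last by rewrite addn0.
  move=> h' x ix [h0|ne].
    have {h0}h0 : h' = 0 by lia.
    subst h'; have xE : x = N + (x - N) by move: ix; rewrite /inode expn0; lia.
    have xN : x - N < N by move: ix; rewrite /inode expn0; lia.
    case: (eqVneq x (N + p)) => [->|ne].
      by apply: tn_leaf => //; wps; rewrite ?upd_same //; rewrite /D' upd_same.
    have := T 0 x ix; rewrite expn0 divn1 ne => /(_ isT); apply: eq_tnode; wps; rewrite ?upd_diff //;
      try exact/eqP.
    by move=> q; rewrite expn0 muln1 => hq; rewrite /D' upd_diff //; lia.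
  have := T _ _ ix ne; apply: eq_tnode; wps => //; try (rewrite upd_diff //; apply/eqP).
  - by apply: contra ne => /eqP E; rewrite E in ix *; rewrite (_ : h' = 0) ?expn0 ?divn1 //;
      apply: (inode_level ix); rewrite /inode expn0; lia.
  - by apply: contra ne => /eqP E; rewrite E in ix *; rewrite (_ : h' = 0) ?expn0 ?divn1 //;
      apply: (inode_level ix); rewrite /inode expn0; lia.
  - by apply: contra ne => /eqP E; rewrite E in ix *; rewrite (_ : h' = 0) ?expn0 ?divn1 //;
      apply: (inode_level ix); rewrite /inode expn0; lia.
  - move=> q hq; split=> //; rewrite /D' upd_diff // => qp; subst q.
    by move: ne; rewrite -(node_range ix pN) hq.
move=> s2 F2 [h [hH hx T2 t2]].
have EC : ar s2 aComp = cl by rewrite (fr_ar F2).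
wps; split=> //; rewrite lt0b; case: ifP => x1; last first.
  (* Every ancestor of height at most [H] has a positive number, so 0 is reached only beyond the
     root. *)
  have hE : h = H.
    apply/eqP; rewrite eqn_leq hH /= leqNgt; apply/negP => lt.
    have /andP[+ _] := inode_anc pN lt; rewrite -hx; have := expn_gt0 2 H; rewrite -/N.
    by rewrite (_ : rg s2 rX = 0) ?mul0n; lia.
  by split; [move=> h' x ix; apply: T2 => //; left; rewrite hE; apply: inode_le ix | lia].
have hlt : h < H.
  rewrite ltn_neqAle hH andbT; apply/eqP => E; move: x1; rewrite hx E divn_small //.
  by rewrite expnS -/N; lia.
have ix := inode_anc pN hlt; rewrite -hx in ix.
have [i1 i2] := inode_child ix.
have A : tn s2 D' (ar s2 aComp) h (rg s2 rX + rg s2 rX) by rewrite EC; apply: T2 => //; left.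
have B : tn s2 D' (ar s2 aComp) h (rg s2 rX + rg s2 rX + 1) by rewrite EC; apply: T2 => //; left.
apply: (wp_use (pull_level erefl ix A B)) => s3 F3 [t3 o3 k3].
have rX3 : rg s3 rX = rg s2 rX by rewrite (fr_rg F3).
spl=> //; wps; last by rewrite rX3 divn2 -[in X in _ < X](odd_double_half (rg s2 rX)); lia.
exists h.+1; wps; split=> //; last by lia.
  by rewrite rX3 hx -divnMA -expnSr.
move=> h' x ix' hc; have G : tn s3 D' cl h' x; last by apply: eq_tnode G.
case: (eqVneq x (rg s2 rX)) => [xE|ne].
  by rewrite xE in ix' *; rewrite (inode_level ix' ix) -EC.
apply: o3 => //; apply: T2 => //; case: hc => [h1|]; last by right.
case: (leqP h' h) => h2; [by left | right].
have hE' : h' = h.+1 by lia.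
by rewrite hE' -hx.
Qed.

Lemma leaf_tn s D cl p : p < N -> tn s D cl 0 (N + p) ->
  [/\ ar s aI1 (N + p) = p, ar s aI2 (N + p) = p, wa s bS (N + p) = D p,
      wa s bV1 (N + p) = D p & wa s bV2 (N + p) = D p].
Proof.
clear bigW nIx NIx; move=> pN; rewrite /tn expn0 muln1 addKn => -[h1 [i1 i2 _ _] h3 h4].
have e1 : ar s aI1 (N + p) = p by lia.
have e2 : ar s aI2 (N + p) = p by lia.
by rewrite h1 h3 h4 e1 e2 addn1 /psum !big_nat1.
Qed.

(* With [wr s vDd = 0] this refreshes the tree after a change of the class of
   [p]. *)
Lemma upd_tree s D cl p : rg s rN = N -> rg s rP = p -> p < N -> tree s D cl ->
  (forall q, q < N -> q != p -> cl q = ar s aComp q) ->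
  wp c_upd (fun s' => tree s' (upd D p (D p + wr s vDd)%R) (ar s aComp) /\
    tk s' <= tk s + H) s.
Proof.
move=> hN hp pN T hcl.
have [] := leaf_tn pN (T 0 (N + p) _); first by rewrite /inode expn0; lia.
move=> e1 e2 e3 e4 e5; apply: upd_spec => // h x ix ne.
have := T h x ix; apply: eq_tnode => // q hq; split=> //; apply: hcl.
  move: (ix) => /andP[i1 i2]; have hH := inode_le ix.
  have : x.+1 * 2 ^ h <= 2 * N.
    have -> : 2 * N = 2 ^ (H.+1 - h) * 2 ^ h by rewrite -expnD -expnS; congr (2 ^ _); lia.
    rewrite leq_mul2r; apply/orP; right; rewrite -(@ltn_pmul2r (2 ^ h)) ?expn_gt0 //.
    by rewrite -expnD subnK ?expnS //; lia.
  by rewrite mulSn; lia.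
by apply: contra ne => /eqP qp; rewrite qp in hq; rewrite -(node_range ix pN).
Qed.

Lemma root_tree s D cl : tree s D cl -> let val := psum D 0 in
  [/\ tb val cl (fun p => p < N) (ar s aI1 1) (ar s aI2 1), wa s bV1 1 = val (ar s aI1 1)
    & wa s bV2 1 = val (ar s aI2 1)].
Proof.
clear bigW nIx NIx; move=> T; have e0 : 0 < N by rewrite /N expn_gt0.
have := T H 1; rewrite /inode /tn mul1n -/N subnn => /(_ _)[|_ t h1 h2]; first lia.
by split=> //; apply: (eq_tb _ _ t).
Qed.

Lemma leaves_spec s : rg s rN = N ->
  wp c_leaves (fun s' => [/\ forall p, p < N ->
      [/\ ar s' aComp p = p, ar s' aNxt p = p, ar s' aCsz p = 1, ar s' aI1 (N + p) = p
        & ar s' aI2 (N + p) = p] & tk s' <= tk s + N]) s.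
Proof.
move=> hN; rewrite /c_leaves; wps; split=> //.
pose I s' := [/\ rg s' rP <= N, forall p, p < rg s' rP ->
      [/\ ar s' aComp p = p, ar s' aNxt p = p, ar s' aCsz p = 1, ar s' aI1 (N + p) = p
        & ar s' aI2 (N + p) = p] & tk s' <= tk s + rg s' rP].
apply: (wp_while (I := I) (mu := fun s' => N - rg s' rP)).
  by rewrite /I; wps; split=> //; rewrite addn0.
move=> s2 F [I1 I2 I3]; have EN : rg s2 rN = N by rewrite (fr_rg F).
wps; rewrite EN; split; first by spl; lia.
rewrite lt0b; case: ifP => pt; last first.
  have E : rg s2 rP = N by lia.
  by rewrite E in I2 I3; split.
rewrite /I; wps; rewrite ?EN; spl; try lia.
move=> p; rewrite addn1 ltnS leq_eqVlt => /orP[/eqP->|pl]; first by rewrite !upd_same.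
by have [? ? ? ? ?] := I2 p pl; rewrite !upd_diff //; lia.
Qed.

Lemma build_spec s : rg s rN = N ->
  (forall p, p < N -> ar s aI1 (N + p) = p /\ ar s aI2 (N + p) = p) ->
  (forall b x, b \in [:: bS; bV1; bV2] -> wa s b x = 0%R) ->
  wp c_build (fun s' => tree s' (fun=> 0%R) (ar s aComp) /\ tk s' <= tk s + N) s.
Proof.
move=> hN hl hz; rewrite /c_build; wps; split=> //; rewrite hN.
set cl := ar s aComp; set D := fun=> 0%R : R.
pose I s' := [/\ rg s' rX < N, tk s' + rg s' rX < tk s + N &
  forall h x, inode h x -> rg s' rX < x -> tn s' D cl h x].
have N0 : 0 < N by rewrite /N expn_gt0.
apply: (wp_while (I := I) (mu := fun s' => rg s' rX)).
  rewrite /I; wps; split; try lia; move=> h x ix xN.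
  have h0 : h = 0.
    case: h ix => // h /andP[_]; rewrite expnS => b.
    by have := expn_gt0 2 h; nia.
  subst h; have xE : x = N + (x - N) by lia.
  have xl : x - N < N by move: ix; rewrite /inode expn0; lia.
  rewrite xE; have [a1 a2] := hl _ xl; apply: tn_leaf => //; by rewrite hz.
move=> s2 F [I1 I2 I3]; have EC : ar s2 aComp = cl by rewrite (fr_ar F).
wps; split=> //; rewrite lt0b; case: ifP => x0; last first.
  split; last lia; move=> h x ix; apply: I3 => //.
  by case: x ix => [|x _]; [rewrite /inode mul0n; lia | lia].
(* The depth [d] of a node is the logarithm of its number, and its height is [H - d]. *)
have [h ix] : exists h, inode h.+1 (rg s2 rX).
  have /andP[e1 e2] : 2 ^ trunc_log 2 (rg s2 rX) <= rg s2 rX < 2 ^ (trunc_log 2 (rg s2 rX)).+1.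
    by rewrite trunc_logP // trunc_log_ltn.
  set d := trunc_log 2 (rg s2 rX) in e1 e2 *.
  have dH : d < H by rewrite -(@ltn_exp2l 2) // -/N; lia.
  exists (H - d).-1; rewrite prednK; last lia.
  rewrite /inode; have -> : N = 2 ^ d * 2 ^ (H - d) by rewrite -expnD subnKC // ltnW.
  rewrite mulnA -expnS leq_mul2r ltn_mul2r expn_gt0 /=; lia.
have [i1 i2] := inode_child ix.
have A : tn s2 D (ar s2 aComp) h (rg s2 rX + rg s2 rX) by rewrite EC; apply: I3 => //; lia.
have B : tn s2 D (ar s2 aComp) h (rg s2 rX + rg s2 rX + 1) by rewrite EC; apply: I3 => //; lia.
apply: (wp_use (pull_level erefl ix A B)) => s3 F3 [t3 o3 k3].
have rX3 : rg s3 rX = rg s2 rX by rewrite (fr_rg F3).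
rewrite /I; wps; rewrite rX3; spl => //; try lia.
move=> h' x ix' lt; have G : tn s3 D cl h' x; last by apply: eq_tnode G.
case: (eqVneq x (rg s2 rX)) => [xE|ne].
  by rewrite xE in ix' *; rewrite (inode_level ix' ix) -EC.
by apply: o3 => //; apply: I3 => //; lia.
Qed.

Definition dummy (inf : R) p : R := if (p == 0) || (n <= p) then inf else 0%R.

Lemma dummies_spec s : 1 < n -> n < N -> rg s rN = N -> rg s rNn = n ->
  tree s (fun=> 0%R) (ar s aComp) ->
  wp c_dummies (fun s' => (exists2 D, tree s' D (ar s aComp) &
     forall p, psum D 0 p = dummy (wr s vInf) p) /\ tk s' <= tk s + 3 * H) s.
Proof.
move=> n1 nN hN hn T; rewrite /c_dummies; wps; spl => //; set s1 := swr _ vDd _.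
set inf := wr s vInf.
have T1 : tree s1 (fun=> 0%R) (ar s aComp) by move=> h x /T; apply: eq_tnode.
apply: (wp_use (@upd_tree s1 _ (ar s aComp) 0 hN erefl _ T1 _)) => //; first lia.
move=> s2 F2 [T2 t2].
have EC2 : ar s2 aComp = ar s aComp by rewrite (fr_ar F2).
have EN2 : rg s2 rN = N by rewrite (fr_rg F2).
have En2 : rg s2 rNn = n by rewrite (fr_rg F2).
have EI2 : wr s2 vInf = inf by rewrite (fr_wr F2).
spl => //; set s3 := swr _ vDd _.
have T3 : tree s3 (upd (fun=> 0%R) 0 (0 + wr s1 vDd)%R) (ar s aComp).
  by move=> h x /T2; apply: eq_tnode.
apply: (wp_use (@upd_tree s3 _ (ar s aComp) 1 _ erefl _ T3 _)); rewrite /s3; wps => //; first lia.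
  by rewrite EC2.
move=> s4 F4 [T4 t4].
have EC4 : ar s4 aComp = ar s aComp by rewrite (fr_ar F4).
have EN4 : rg s4 rN = N by rewrite (fr_rg F4).
have En4 : rg s4 rNn = n by rewrite (fr_rg F4).
have EI4 : wr s4 vInf = inf by rewrite (fr_wr F4).
spl => //; set s5 := swr _ vDd _.
rewrite EC2 in T4.
have T5 := T4; have {}T5 : tree s5 (upd (upd (fun=> 0%R) 0 (0 + wr s1 vDd)%R) 1 (upd (fun=> 0%R) 0 (0 + wr s1 vDd) 1 + wr s3 vDd)%R) (ar s aComp).
  by move=> h x /T4; apply: eq_tnode.
apply: (wp_use (@upd_tree s5 _ (ar s aComp) n _ En4 nN T5 _)); rewrite /s5; wps => //.
  by rewrite EC4.
move=> s6 F6 [T6 t6]; split; last by move: t2 t4 t6; rewrite /s1; wps; lia.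
rewrite EC4 EI4 in T6; eexists; first exact: T6.
have E1 : wr s1 vDd = inf by [].
have E3 : wr s3 vDd = (- inf)%R by rewrite /s3; wps; rewrite EI2 sub0r.
move=> p; rewrite E1 E3 add0r /psum /dummy.
have E k (d : R) : (\sum_(0 <= q < p.+1) (if q == k then d else 0) = if (k <= p)%N then d else 0)%R.
  by rewrite -big_mkcond /= big_nat1_eq ltnS.
rewrite (eq_bigr (fun q => (if q == 0 then inf else 0) + (if q == 1 then - inf else 0) +
   (if q == n then inf else 0))%R); last first.
  have e0 : (n == 0) = false by lia.
  have e1 : (n == 1) = false by lia.
  move=> q _; rewrite /upd; case: (eqVneq q n) => [->|qn]; rewrite ?e0 ?e1 /= ?addr0 ?add0r //.
  by case: q qn => [|[|q]] _ /=; rewrite ?addr0 ?add0r.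
rewrite !big_split /= !E; case: p {E} => [|p] /=.
  by rewrite leqNgt (ltnW n1) /= !addr0.
by rewrite subrr add0r.
Qed.

End Levels.

Lemma setup_spec s : 0 < n -> rg s rNn = n ->
  wp c_setup (fun s' => [/\ exists H, [/\ rg s' rN = 2 ^ H, n < 2 ^ H <= 2 * n &
      tk s' <= tk s + H],
    wr s' vThr = (wr s vB + wr s vB)%R &
    wr s' vInf = (wr s vB + wr s vB + query_wt LG w 0 0)%R]) s.
Proof.
move=> n0 hn; rewrite /c_setup; wps; split=> //.
pose I s' := exists H, [/\ rg s' rN = 2 ^ H, 2 ^ H <= 2 * n & tk s' <= tk s + H].
apply: (wp_while (I := I) (mu := fun s' => 2 * n + 1 - rg s' rN)).
  by exists 0; wps; split=> //; [rewrite expn0; lia | rewrite addn0].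
move=> s2 F [H [h1 h2 h3]]; have En : rg s2 rNn = n by rewrite (fr_rg F).
wps; rewrite En; split=> //; rewrite lt0b; case: ifP => le; last first.
  spl => //; first by exists H; split=> //; lia.
  + by rewrite (fr_wr F).
  + by rewrite (fr_wr F).
have e0 : 0 < 2 ^ H by rewrite expn_gt0.
spl; try lia; exists H.+1; wps; rewrite expnS; split; lia.
Qed.

End Tree.

(** * Programs merging two classes *)

Definition c_relabel :=
  Wh $rH
    (Sto aComp $rP $rB ;; c_upd ;; rP <-~ aNxt @ $rP ;;
     rH <-~ ($rP ==~ $rA) ==~ Cn 0).

(* The smaller class is the one of [$rA]; its label is replaced by [$rB]. *)
Definition c_select :=
  Ife (aCsz @ (aComp @ $rE) <=~ aCsz @ (aComp @ $rF))
    (rA <-~ $rE ;; rV <-~ $rF) (rA <-~ $rF ;; rV <-~ $rE).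

Definition c_merge :=
  c_select ;;
  rB <-~ aComp @ $rV ;;
  Sto aCsz $rB (aCsz @ $rB +~ aCsz @ (aComp @ $rA)) ;;
  WSet vDd Wz ;; rP <-~ $rA ;; rH <-~ Cn 1 ;; c_relabel ;;
  rU <-~ aNxt @ $rA ;; Sto aNxt $rA (aNxt @ $rV) ;; Sto aNxt $rV $rU.

(** * Classes as circular lists *)

(** Meant for splicing: a cycle is entered at a new start [z] that takes over the successor of
    [y]. *)
Lemma path_redirect (f f' : nat -> nat) y z t x :
  path (frel f) y (rcons t x) -> f' z = f y -> {in t, f' =1 f} ->
  path (frel f') z (rcons t x).
Proof.
elim: t y z => [|u t IH] y z /=; first by rewrite !andbT => /eqP <- ->.
case/andP=> /eqP <- p e H; rewrite e eqxx /=; apply: IH p _ _.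
  by apply: H; rewrite inE eqxx.
by move=> v vt; apply: H; rewrite inE vt orbT.
Qed.

Section Classes.
Variable N : nat.

Record classes (cl nxt csz : nat -> nat) (L : nat -> seq nat) : Prop := Classes {
  cs_in : forall x, x < N -> cl x < N /\ x \in L (cl x);
  cs_cl : forall c x, x \in L c -> x < N /\ cl x = c;
  cs_uniq : forall c, uniq (L c);
  cs_cycle : forall c, fcycle nxt (L c);
  cs_size : forall x, x < N -> csz (cl x) = size (L (cl x))
}.

(** A relabelled element raises its own term by at least one and no term exceeds [H], so there are
    at most [N * H] relabellings. *)
Definition potential (cl csz : nat -> nat) :=
  \sum_(0 <= x < N) trunc_log 2 (csz (cl x)).

Lemma classes_size cl nxt csz L c : classes cl nxt csz L -> size (L c) <= N.
Proof.
move=> C; rewrite -(size_iota 0 N); apply: uniq_leq_size (cs_uniq C c) _ => x.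
by move=> /(cs_cl C)[]; rewrite mem_iota.
Qed.

Lemma potential_le cl nxt csz L H : N = 2 ^ H -> classes cl nxt csz L ->
  potential cl csz <= N * H.
Proof.
move=> NE C; rewrite /potential -[N in N * H]subn0 -sum_nat_const_nat.
rewrite big_nat [in X in _ <= X]big_nat; apply: leq_sum => x xN.
rewrite (cs_size C) //; apply: leq_trans (leq_trunc_log 2 (classes_size _ C)) _.
by rewrite NE trunc_expnK.
Qed.

Lemma rot_head cl nxt csz L x : classes cl nxt csz L -> x < N ->
  exists t, [/\ perm_eq (x :: t) (L (cl x)), uniq (x :: t) & path (frel nxt) x (rcons t x)].
Proof.
move=> C xN; have [_ /rot_to[i t E]] := cs_in C xN; exists t.
split; first by rewrite -E perm_rot.
  by rewrite -E rot_uniq (cs_uniq C).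
by have := cs_cycle C (cl x); rewrite -(rot_cycle i) E.
Qed.

(* Every element of the smaller class at least doubles the size of its class. *)
Lemma classes_merge cl nxt csz L a b ta : classes cl nxt csz L -> a < N -> b < N ->
  cl a <> cl b -> csz (cl a) <= csz (cl b) ->
  perm_eq (a :: ta) (L (cl a)) -> path (frel nxt) a (rcons ta a) ->
  let cl' x := if x \in a :: ta then cl b else cl x in
  let csz' := upd csz (cl b) (csz (cl b) + csz (cl a)) in
  let nxt' := upd (upd nxt a (nxt b)) b (nxt a) in
  (exists L', classes cl' nxt' csz' L') /\
  potential cl csz + (size ta).+1 <= potential cl' csz'.
Proof.
move=> C aN bN nab le pa ca cl' csz' nxt'.
have [tb [pb ub cb]] := rot_head C bN.
have ina x : (x \in a :: ta) = (x \in L (cl a)) by rewrite (perm_mem pa).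
have inb x : (x \in b :: tb) = (x \in L (cl b)) by rewrite (perm_mem pb).
have inL c x : x \in L c = (x < N) && (cl x == c).
  by apply/idP/andP => [/(cs_cl C)[-> ->]//|[xN /eqP <-]]; case: (cs_in C xN).
have ua : uniq (a :: ta) by rewrite (perm_uniq pa) (cs_uniq C).
have clE x : x < N -> cl' x = if cl x == cl a then cl b else cl x.
  by move=> xN; rewrite /cl' ina inL xN.
have szE : csz' (cl b) = size (L (cl b)) + size (L (cl a)).
  by rewrite /csz' upd_same !(cs_size C).
have szo c : c != cl b -> csz' c = csz c by move=> /eqP ne; rewrite /csz' upd_diff.
split; last first.
  have -> : (size ta).+1 = \sum_(0 <= x < N) (cl x == cl a).
    rewrite -[LHS]/(size (a :: ta)) -sum1_size /index_iota subn0.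
    rewrite -[RHS]big_mkcond /= -[RHS]big_filter; apply: perm_big; apply: uniq_perm => //.
      by rewrite filter_uniq ?iota_uniq.
    by move=> x; rewrite mem_filter mem_iota ina inL /= add0n andbC.
  rewrite /potential -big_split /= big_nat [in X in _ <= X]big_nat; apply: leq_sum => x xN.
  rewrite clE //; case: eqP => [->|ne]; last first.
    rewrite addn0; case: (eqVneq (cl x) (cl b)) => [->|nb]; last by rewrite szo.
    by rewrite szE leq_trunc_log // (cs_size C bN) leq_addr.
  rewrite szE; move: le; rewrite !(cs_size C) // => le.
  have s0 : 0 < size (L (cl a)) by rewrite -(perm_size pa).
  have -> : trunc_log 2 (size (L (cl a))) + 1 = trunc_log 2 (size (L (cl a))).*2.
    by rewrite addn1 [in RHS]trunc_log2S ?doubleK //; lia.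
  by apply: leq_trunc_log; lia.
(* Exchanging the successors of [a] and [b] sends [a] into the rest of the cycle of [b], and [b]
   into the rest of the cycle of [a]. *)
pose m := a :: tb ++ b :: ta.
have disj x : x \in a :: ta -> x \in b :: tb -> False.
  by rewrite ina inb !inL => /andP[_ /eqP->] /andP[_ /eqP].
have um : uniq m.
  have -> : uniq m = uniq ((a :: ta) ++ (b :: tb)).
    by apply: perm_uniq; apply/permP => z; rewrite /m /= !count_cat /=; lia.
  rewrite cat_uniq ua ub andbT; apply/hasPn => x xb; apply/negP => xa; exact: disj xa xb.
have memm x : (x \in m) = (x \in a :: ta) || (x \in b :: tb).
  by rewrite /m !(inE, mem_cat); case: (x == a); case: (x == b); case: (x \in ta); case: (x \in tb).
exists (fun c => if c == cl b then m else if c == cl a then [::] else L c).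
have nba : (cl b == cl a) = false by apply/eqP => e; apply: nab.
have nab' : (cl a == cl b) = false by apply/eqP.
split.
- move=> x xN; have [c1 c2] := cs_in C xN; rewrite clE //; case: (eqVneq (cl x) (cl a)) => [e|ne].
    by rewrite eqxx memm ina inL xN e eqxx; split=> //; case: (cs_in C bN).
  rewrite (negbTE ne); split=> //; case: (eqVneq (cl x) (cl b)) => [e|nb]; last by [].
  by rewrite memm inb inL xN e eqxx orbT.
- move=> c x; case: (eqVneq c (cl b)) => [->|nc].
    rewrite memm ina inb !inL => /orP[]/andP[xN /eqP e]; split=> //; rewrite clE // e ?eqxx //.
    by rewrite nba.
  case: (eqVneq c (cl a)) => [//|na]; rewrite inL => /andP[xN /eqP e]; split=> //.
  by rewrite clE // e (negbTE na).
- by move=> c; case: eqP => // _; case: eqP => // _; apply: (cs_uniq C).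
- move=> c; case: (eqVneq c (cl b)) => [_|nc].
    have nba' : b <> a by move=> e; apply: nab; rewrite e.
    have -> : fcycle nxt' m = path (frel nxt') a (rcons tb b ++ rcons ta a).
      by rewrite /m /cycle rcons_cat /= cat_rcons.
    rewrite cat_path last_rcons; apply/andP; split.
      apply: path_redirect cb _ _; first by rewrite /nxt' upd_diff ?upd_same //; auto.
      move=> x xb; rewrite /nxt' !upd_diff // => e; subst x; last by move: ub; rewrite /= xb.
      by apply: (disj a); rewrite inE ?eqxx // xb orbT.
    apply: path_redirect ca _ _; first by rewrite /nxt' upd_same.
    move=> x xa; rewrite /nxt' !upd_diff // => e; subst x; first by move: ua; rewrite /= xa.
    by apply: (disj b); rewrite inE ?eqxx // xa orbT.
  case: (eqVneq c (cl a)) => [//|na].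
  have old x : x \in L c -> nxt' x = nxt x.
    rewrite inL => /andP[_ /eqP e]; rewrite /nxt' !upd_diff // => ex; subst x.
      by rewrite e eqxx in na.
    by rewrite e eqxx in nc.
  have := cs_cycle C c; case E : (L c) => [//|y l] p.
  apply: (path_redirect p); first by apply: old; rewrite E inE eqxx.
  by move=> z zl; apply: old; rewrite E inE zl orbT.
- move=> x xN; rewrite clE //; case: (eqVneq (cl x) (cl a)) => [_|ne].
    by rewrite eqxx szE /m -(perm_size pa) -(perm_size pb) /= size_cat /=; lia.
  case: (eqVneq (cl x) (cl b)) => [->|nb].
    by rewrite szE /m -(perm_size pa) -(perm_size pb) /= size_cat /=; lia.
  by rewrite (negbTE ne) szo // (cs_size C).
Qed.

End Classes.

(** * Correctness and amortised cost of a merge *)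

Section Merge.
Variables (R : realType) (W n Ix : nat).
Variables (LG LT : adjlists n) (w : {set 'I_n} -> R).
Hypothesis bigW : 128 * Ix.+1 <= 2 ^ W.
Hypothesis nIx : 4 * n.+4 <= Ix.
Notation wp := (wp W Ix LG LT w).
Implicit Types s : st R.
Variable H : nat.
Let N := 2 ^ H.
Hypothesis NIx : 4 * N <= Ix.

(** After each relabelling an update with zero mass makes the tree agree with the partly changed
    labels. The flag in [rH] is needed because the loop stops at the element where it starts. *)
Lemma relabel_loop t p a s D : rg s rN = N -> rg s rP = p -> rg s rA = a -> rg s rH = 1 ->
  wr s vDd = 0%R -> rg s rB < N ->
  all (fun x => x < N) (p :: t) -> a < N -> a \notin t -> uniq (p :: t) ->
  path (frel (ar s aNxt)) p (rcons t a) -> tree H s D (ar s aComp) ->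
  wp c_relabel (fun s' => [/\ (forall x, ar s' aComp x =
       if x \in p :: t then rg s rB else ar s aComp x),
     tree H s' D (ar s' aComp) & tk s' <= tk s + (size t).+1 * H.+1]) s.
Proof.
elim: t p s D => [|q t IH] p s D hN hp ha hg hd hB al aN at_ un pt T;
  rewrite /c_relabel; wps; apply: wp_while_step => //; wps; rewrite hg ltn0Sn hp; wps;
  have pN : p < N by case/andP: al.
- spl; try lia; set s1 := sa _ aComp _ _.
  apply: (wp_use (upd_tree LG LT w bigW nIx NIx (s := s1) (D := D) (cl := ar s aComp) (p := p) _ _ pN _ _));
    rewrite /s1; wps => //.
  + by move=> h x /T; apply: eq_tnode.
  + by move=> z _ /eqP nz; rewrite upd_diff.
  rewrite hd addr0 => s2 F2 [T2 t2].
  have EP : rg s2 rP = p by rewrite (fr_rg F2).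
  have EX : ar s2 aNxt = ar s aNxt by rewrite (fr_ar F2).
  have EA : rg s2 rA = a by rewrite (fr_rg F2).
  have EC : ar s2 aComp = upd (ar s aComp) p (rg s rB) by rewrite (fr_ar F2).
  rewrite EP EX EA; spl; try lia.
  have -> : ar s aNxt p = a by move: pt; rewrite /= andbT => /eqP.
  apply: wp_while_step => //; wps; rewrite lt0b eqb0 eqxx; cbn [negb]; rewrite EC; split.
  + by move=> x; rewrite /upd inE.
  + have DE : upd D p (D p) =1 D by move=> z; rewrite /upd; case: eqP => [->|].
    move=> h x /T2; rewrite -EC; apply: eq_tnode => // z _; split=> //; exact: DE.
  + lia.
- spl; try lia; set s1 := sa _ aComp _ _.
  apply: (wp_use (upd_tree LG LT w bigW nIx NIx (s := s1) (D := D) (cl := ar s aComp) (p := p) _ _ pN _ _));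
    rewrite /s1; wps => //.
  + by move=> h x /T; apply: eq_tnode.
  + by move=> z _ /eqP nz; rewrite upd_diff.
  rewrite hd addr0 => s2 F2 [T2 t2].
  have EP : rg s2 rP = p by rewrite (fr_rg F2).
  have EX : ar s2 aNxt = ar s aNxt by rewrite (fr_ar F2).
  have EA : rg s2 rA = a by rewrite (fr_rg F2).
  have EN : rg s2 rN = N by rewrite (fr_rg F2).
  have EB : rg s2 rB = rg s rB by rewrite (fr_rg F2).
  have ED : wr s2 vDd = 0%R by rewrite (fr_wr F2).
  have EC : ar s2 aComp = upd (ar s aComp) p (rg s rB) by rewrite (fr_ar F2).
  rewrite EP EX EA; spl; try lia.
  case/andP: pt => /eqP pq pt; rewrite pq.
  have aq : a != q by move: at_; rewrite inE negb_or => /andP[].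
  set s3 := tick _.
  have T3 : tree H s3 D (ar s3 aComp).
    have DE : upd D p (D p) =1 D by move=> z; rewrite /upd; case: eqP => [->|].
    move=> h x /T2; rewrite -EC /s3; wps; apply: eq_tnode => // z _; split=> //; exact: DE.
  have := IH q s3 D; rewrite /s3 {1}/c_relabel; wps; rewrite EN EA EB ED EX => G.
  apply: (wpw_use (G _ _ _ _ _ _ _ _ _ _ _ _)) => //.
  + by rewrite [q == a]eq_sym (negbTE aq).
  + by case/andP: al.
  + by move: at_; rewrite inE negb_or => /andP[].
  + by case/andP: un.
  move=> s4 F4 [c4 T4 t4]; split=> //.
  + by move=> x; rewrite c4 EC /upd [x \in p :: _]inE; case: (x \in q :: t); rewrite ?orbT ?orbF.
  + by move: t4; rewrite /= !mulSn; lia.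
Qed.

(** Time is measured against the potential: a relabelled leaf costs [H.+1] ticks and raises the
    potential by at least one. Which class keeps its label depends on the sizes, hence the two
    possibilities for [a] and [b]. *)
Lemma merge_spec s D L e f : rg s rN = N -> rg s rE = e -> rg s rF = f -> e < N -> f < N ->
  classes N (ar s aComp) (ar s aNxt) (ar s aCsz) L -> ar s aComp e <> ar s aComp f ->
  tree H s D (ar s aComp) ->
  wp c_merge (fun s' =>
   [/\ exists L', classes N (ar s' aComp) (ar s' aNxt) (ar s' aCsz) L',
       tree H s' D (ar s' aComp),
       exists a b, [/\ (a = e /\ b = f) \/ (a = f /\ b = e), ar s aComp a <> ar s aComp b &
         forall x, x < N -> ar s' aComp x =
           if ar s aComp x == ar s aComp a then ar s aComp b else ar s aComp x],
       tk s' + H.+1 * potential N (ar s aComp) (ar s aCsz) <=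
       tk s + H.+1 * potential N (ar s' aComp) (ar s' aCsz)
     & potential N (ar s aComp) (ar s aCsz) < potential N (ar s' aComp) (ar s' aCsz)]) s.
Proof.
move=> hN hE hF eN fN C nef T; rewrite /c_merge.
set cl := ar s aComp in C nef T *; set nxt := ar s aNxt in C *; set csz := ar s aCsz in C *.
have clN x : x < N -> cl x < N by move=> /(cs_in C)[].
have ce := clN _ eN; have cf := clN _ fN.
have Wx x : x < N -> csz (cl x) <= N by move=> xN; rewrite (cs_size C xN) (classes_size _ C).
pose Q s' := [/\ exists L', classes N (ar s' aComp) (ar s' aNxt) (ar s' aCsz) L',
       tree H s' D (ar s' aComp),
       exists a b, [/\ (a = e /\ b = f) \/ (a = f /\ b = e), cl a <> cl b &
         forall x, x < N -> ar s' aComp x = if cl x == cl a then cl b else cl x],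
       tk s' + H.+1 * potential N cl csz <= tk s + H.+1 * potential N (ar s' aComp) (ar s' aCsz)
     & potential N cl csz < potential N (ar s' aComp) (ar s' aCsz)].
have main s1 a b : rg s1 rA = a -> rg s1 rV = b -> a < N -> b < N -> rg s1 rN = N ->
  (a = e /\ b = f) \/ (a = f /\ b = e) ->
  (forall z, ar s1 z = ar s z) -> (forall z, wa s1 z = wa s z) -> tk s1 = tk s -> cl a <> cl b -> csz (cl a) <= csz (cl b) ->
  wp (rB <-~ aComp @ $rV ;;
  Sto aCsz $rB (aCsz @ $rB +~ aCsz @ (aComp @ $rA)) ;;
  WSet vDd Wz ;; rP <-~ $rA ;; rH <-~ Cn 1 ;; c_relabel ;;
  rU <-~ aNxt @ $rA ;; Sto aNxt $rA (aNxt @ $rV) ;; Sto aNxt $rV $rU) Q s1.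
  move=> hA hV aN bN hN1 hab ea ew ek nab le; wps; rewrite !ea hA hV -/cl -/csz -/nxt.
  have ca := clN _ aN; have cb := clN _ bN; have := Wx _ aN; have := Wx _ bN => wb wa_.
  spl; try lia; set s2 := sr _ rH 1.
  have [t [pt ut ct]] := rot_head C aN.
  apply: (wp_use (@relabel_loop t a a s2 D _ _ _ _ _ _ _ aN _ ut _ _)); rewrite /s2; wps => //.
  - apply/allP => x; rewrite (perm_mem pt) => /(cs_cl C)[] //.
  - by case/andP: ut.
  - by rewrite ea.
  - by rewrite ea -/cl => h x /T; apply: eq_tnode; wps; rewrite ?ea ?ew.
  rewrite ea -/cl => s3 F3 [c3 T3 t3].
  have EA : rg s3 rA = a by rewrite (fr_rg F3).
  have EV : rg s3 rV = b by rewrite (fr_rg F3).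
  have EX : ar s3 aNxt = nxt by rewrite (fr_ar F3) //; wps; rewrite ea.
  have EZ : ar s3 aCsz = upd csz (cl b) (csz (cl b) + csz (cl a)).
    by rewrite (fr_ar F3) //; wps; rewrite ea.
  rewrite EA EV EX; spl; try lia.
  have [[L' C'] pot] := classes_merge C aN bN nab le pt ct.
  have cE : ar s3 aComp =1 (fun x => if x \in a :: t then cl b else cl x) := c3.
  have potE z : potential N (ar s3 aComp) z = potential N (fun x => if x \in a :: t then cl b else cl x) z.
    by apply: eq_bigr => x _; rewrite cE.
  rewrite /Q; wps; rewrite EX EZ potE; split.
  - exists L'; case: C' => k1 k2 k3 k4 k5; split.
    + by move=> x xN; rewrite cE; apply: k1.
    + by move=> c x; rewrite cE; apply: k2.
    + exact: k3.
    + exact: k4.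
    + by move=> x xN; rewrite cE; apply: k5.
  - by move=> h x /T3; apply: eq_tnode.
  - exists a, b; split=> // x xN; rewrite cE (perm_mem pt).
    suff -> : (x \in L (cl a)) = (cl x == cl a) by [].
    apply/idP/eqP => [/(cs_cl C)[] //|<-]; by case: (cs_in C xN).
  - move: t3; rewrite ek => t3.
    have : H.+1 * (potential N cl csz + (size t).+1) <= H.+1 * potential N (fun x => if x \in a :: t then cl b else cl x)
       (upd csz (cl b) (csz (cl b) + csz (cl a))) by rewrite leq_mul2l pot orbT.
    by rewrite mulnDr [H.+1 * (size t).+1]mulnC; lia.
  - by apply: leq_trans pot; rewrite addnS ltnS leq_addr.
apply: wp_seq.
apply: (@wp_use _ _ _ _ _ _ _ _ (fun s1 => exists a b, [/\ rg s1 rA = a, rg s1 rV = b,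
  (a = e /\ b = f) \/ (a = f /\ b = e), csz (cl a) <= csz (cl b) & tk s1 = tk s])).
  rewrite /c_select; wps; rewrite hE hF -/cl -/csz; split; first by spl; lia.
  rewrite lt0b; case: ifP => le; wps; spl => //.
    by exists e, f; split=> //; left.
  by exists f, e; split=> //; [right | lia].
move=> s1 F1 [a [b [hA hV hab le k1]]].
apply: (main s1 a b) => //.
- by case: hab => -[-> _].
- by case: hab => -[_ ->].
- by rewrite (fr_rg F1).
- by move=> z; rewrite (fr_ar F1).
- by move=> z; rewrite (fr_wa F1).
- by case: hab => -[-> ->] // q; apply: nef.
Qed.

End Merge.

(** * Sweeping the rows *)

Definition c_pick :=
  rF <-~ aI1 @ (Cn 1) ;; WSet vCv (Wld bV1 (Cn 1)) ;;
  Ife (aComp @ $rF ==~ aComp @ $rE) (rF <-~ aI2 @ (Cn 1) ;; WSet vCv (Wld bV2 (Cn 1))) Skip.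

Definition c_print :=
  Pr (aVert @ $rE) ;; Pr (aVert @ (aPp @ $rE)) ;; Pr (aVert @ $rF) ;; Pr (aVert @ (aPp @ $rF)).

Definition c_try :=
  c_pick ;;
  Ife (aComp @ $rF ==~ aComp @ $rE) (rG <-~ Cn 0)
    (Ifw (Wv vCv) (Wv vThr) (c_print ;; c_merge) (rG <-~ Cn 0)).

Definition c_query := rG <-~ Cn 1 ;; Wh $rG c_try.

Definition c_bucket :=
  Wh (Cn 1 <=~ $rM)
    (rP <-~ aCol @ $rM ;; WSet vDd (Wld bDel $rM) ;; c_upd ;; rM <-~ aNx @ $rM).

(** Row 0 is no tree edge but holds the masses at [(0, mk a)], which count in every row; it is
    loaded without being queried. *)
Definition c_rows :=
  rE <-~ Cn 0 ;;
  Wh ($rE <~ $rNn)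
    (rM <-~ aHd @ $rE ;; c_bucket ;; Ife (Cn 1 <=~ $rE) c_query Skip ;;
     rE <-~ $rE +~ Cn 1).

(** A history of the printed pairs, free of trees and graphs. The equivalence records which columns
    share a class and not their labels, so it is indifferent to the direction of relabelling. *)
Inductive built (n N : nat) (Hr : nat -> nat -> Prop) :
    seq (nat * nat) -> (nat -> nat) -> Prop :=
  | built0 cl : (forall x y, x < N -> y < N -> cl x = cl y -> x = y) -> built n N Hr [::] cl
  | builtS fl cl cl' e f : built n N Hr fl cl -> cl e <> cl f -> Hr e f ->
      0 < e < n -> 0 < f < n ->
      (forall x y, x < N -> y < N -> (cl' x = cl' y <->
         [\/ cl x = cl y, cl x = cl e /\ cl y = cl f | cl x = cl f /\ cl y = cl e])) ->
      built n N Hr (rcons fl (e, f)) cl'.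

Lemma sum_masses_upto (R : realType) (ml : seq (nat * nat * R)) (P : pred nat) f :
  (\sum_(0 <= c < f.+1) \sum_(m <- ml | P m.1.1 && (m.1.2 == c)) m.2 =
   \sum_(m <- ml | P m.1.1 && (m.1.2 <= f)%N) m.2)%R.
Proof.
elim: ml => [|m ml IH]; first by rewrite big1 ?big_nil // => c _; rewrite big_nil.
rewrite [RHS]big_cons -IH.
rewrite (eq_bigr (fun c => (if P m.1.1 && (m.1.2 == c) then m.2 else 0) +
   \sum_(m <- ml | P m.1.1 && (m.1.2 == c)) m.2)%R); last first.
  by move=> c _; rewrite big_cons; case: ifP => _; rewrite ?add0r.
rewrite big_split /=; case: (P m.1.1) => /=; last by rewrite big1 // add0r.
rewrite (eq_bigr (fun c => if c == m.1.2 then m.2 else 0)%R); last first.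
  by move=> c _; rewrite eq_sym.
rewrite -big_mkcond /= big_nat1_eq ltnS leq0n /=.
by case: ifP => _; rewrite ?add0r.
Qed.

Section Rows.
Variables (R : realType) (W n Ix : nat).
Variables (LG LT : adjlists n) (w : {set 'I_n} -> R).
Hypothesis bigW : 128 * Ix.+1 <= 2 ^ W.
Hypothesis nIx : 4 * n.+4 <= Ix.
Notation wp := (wp W Ix LG LT w).
Implicit Types s : st R.
Variable H : nat.
Let N := 2 ^ H.
Hypothesis NIx : 4 * N <= Ix.
Hypothesis nN : n < N.

(** The induction runs over the masses of all rows: [lastm] plays the pointer, and masses of other
    rows are passed without any step of the program. *)
Lemma bucket_spec l r D s : rg s rN = N -> rg s rM = lastm l r ->
  size l < Ix -> all (fun m => (m.1.1 <= n) && (m.1.2 <= n)) l ->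
  cells (ar s aNx) (ar s aCol) (wa s bDel) l -> tree H s D (ar s aComp) ->
  wp c_bucket (fun s' =>
    (exists2 D', tree H s' D' (ar s aComp) &
      forall c, (D' c = D c + \sum_(m <- l | (m.1.1 == r) && (m.1.2 == c)) m.2)%R)
    /\ tk s' <= tk s + H.+1 * count (fun m => m.1.1 == r) l) s.
Proof.
rewrite /c_bucket; wp1.
elim: l D s => [|m l IH] D s hN hM hI al ce T.
  apply: wp_while_step => //; wps; rewrite hM /=.
  by split; [exists D => // c; rewrite big_nil addr0 | rewrite muln0 addn0].
case/andP: al => /andP[_ mc] al; case: ce => c1 c2 c3 c4.
have sI : size l < Ix by move: hI => /=; lia.
have [er|nr] := eqVneq m.1.1 r; last first.
  apply: (wpw_use (IH D s hN _ sI al c4 T)); first by rewrite hM /= (negbTE nr).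
  move=> s' F [[D' T' hD'] t']; split; last by rewrite /= (negbTE nr).
  by exists D' => // c; rewrite big_cons (negbTE nr).
have {}hM : rg s rM = (size l).+1 by rewrite hM /= er eqxx.
apply: wp_while_step => //; wps; rewrite hM ltn0Sn ltn0Sn; wps.
rewrite c1 c2; spl; try by move: hI => /=; lia.
set s1 := swr _ vDd _.
have cN : m.1.2 < N by lia.
apply: (wp_use (upd_tree LG LT w bigW nIx NIx (s := s1) (D := D) (cl := ar s aComp) (p := m.1.2) _ _ cN _ _));
  rewrite /s1; wps => //.
  by move=> h x /T; apply: eq_tnode.
move=> s2 F2 [T2 t2].
have EM : rg s2 rM = (size l).+1 by rewrite (fr_rg F2).
have EX : ar s2 aNx = ar s aNx by rewrite (fr_ar F2).
have EO : ar s2 aCol = ar s aCol by rewrite (fr_ar F2).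
have EC : ar s2 aComp = ar s aComp by rewrite (fr_ar F2).
have EN : rg s2 rN = N by rewrite (fr_rg F2).
have ED : wa s2 bDel = wa s bDel by rewrite (fr_wa F2).
rewrite EM EX c3; spl; first by move: hI => /=; lia.
set s3 := tick _; set D2 := upd D _ _ in T2.
have T3 : tree H s3 D2 (ar s3 aComp) by rewrite /s3; wps; rewrite EC => h x /T2; apply: eq_tnode.
apply: (wpw_use (IH D2 s3 _ _ sI al _ T3)); rewrite /s3; wps => //; first by rewrite er.
  by rewrite EX EO ED.
rewrite EC => s4 F4 [[D' T' hD'] t']; split; last first.
  by apply: leq_trans t' _; rewrite /= er eqxx add1n mulnS addnA leq_add2r; lia.
exists D' => // c; rewrite hD' big_cons er eqxx /= /D2 /upd.
by case: (eqVneq c m.1.2) => [->|nc]; rewrite ?addrA.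
Qed.

Lemma pick_spec s D e : rg s rE = e -> e < N -> tree H s D (ar s aComp) ->
  wp c_pick (fun s' => let f := rg s' rF in let cl := ar s aComp in
    [/\ f < N, wr s' vCv = psum D 0 f, tk s' = tk s,
       (cl f = cl e -> forall p, p < N -> cl p = cl e) &
       (cl f <> cl e -> forall p, p < N -> cl p <> cl e -> (psum D 0 f <= psum D 0 p)%R)]) s.
Proof.
move=> hE eN T; have [[r1 r2 r3 r4] v1 v2] := root_tree T.
rewrite /c_pick; wps; rewrite hE; spl; try lia.
rewrite lt0b; case: eqP => [e1|n1]; wps; spl; try lia; rewrite -/N //.
- move=> e2 p pN; case: (eqVneq (ar s aComp p) (ar s aComp e)) => // /eqP ne.
  by have [|] := r4 p pN; rewrite e1 // e2.
- by move=> _ p pN np; have [|//] := r4 p pN; rewrite e1.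
- by move=> _ p pN _; apply: r3.
Qed.

Section Query.
Variables (Hr : nat -> nat -> Prop) (vert pp : nat -> nat) (D : nat -> R) (thr : R) (e : nat).

Definition quad (q : nat * nat) := [:: vert q.1; vert (pp q.1); vert q.2; vert (pp q.2)].

Definition forest_state s fl :=
  [/\ built n N Hr fl (ar s aComp), out s = flatten [seq quad q | q <- fl]
    & exists L, classes N (ar s aComp) (ar s aNxt) (ar s aCsz) L].

Let Phi s := potential N (ar s aComp) (ar s aCsz).

Lemma print_spec s f : rg s rE = e -> rg s rF = f -> e < n -> f < n ->
  ar s aPp e < n -> ar s aPp f < n ->
  wp c_print (fun s' => out s' = out s ++ [:: ar s aVert e; ar s aVert (ar s aPp e);
     ar s aVert f; ar s aVert (ar s aPp f)] /\ tk s' = tk s) s.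
Proof.
move=> hE hF en fn pe pf; rewrite /c_print; wps; rewrite hE hF; spl; try lia.
by rewrite -!cats1 -!catA.
Qed.

(** A merge raises the potential by at least one, which pays for the tick of its attempt; hence
    [H.+2] where a merge alone needs [H.+1]. The final [+ 1] is the failing attempt. *)
Lemma query_spec s fl : rg s rN = N -> rg s rE = e -> 0 < e < n -> wr s vThr = thr ->
  ar s aVert = vert -> ar s aPp = pp -> (forall x, 0 < x < n -> pp x < n) ->
  tree H s D (ar s aComp) -> forest_state s fl ->
  (forall f, f < N -> (psum D 0 f <= thr)%R -> 0 < f < n) ->
  (forall f, 0 < f < n -> (psum D 0 f <= thr)%R -> Hr e f) ->
  wp c_query (fun s' =>
    [/\ exists fl', forest_state s' fl', tree H s' D (ar s' aComp),
      (forall p, p < N -> ar s' aComp p <> ar s' aComp e -> (thr < psum D 0 p)%R),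
      (forall x y, x < N -> y < N -> ar s aComp x = ar s aComp y -> ar s' aComp x = ar s' aComp y)
    & tk s' + H.+2 * Phi s <= tk s + H.+2 * Phi s' + 1]) s.
Proof.
move=> hN hE he hT hV hP ppn T FS hd hH; rewrite /c_query; wps; split=> //.
have en : e < n by lia.
have eN : e < N by lia.
pose I s' := [/\ (exists fl', forest_state s' fl') /\ rg s' rG <= 1, tree H s' D (ar s' aComp),
   (rg s' rG = 0 -> forall p, p < N -> ar s' aComp p <> ar s' aComp e -> (thr < psum D 0 p)%R),
   (forall x y, x < N -> y < N -> ar s aComp x = ar s aComp y -> ar s' aComp x = ar s' aComp y)
  & tk s' + H.+2 * Phi s <= tk s + H.+2 * Phi s' + (1 - rg s' rG)].
have PhiM s' : forall fl', forest_state s' fl' -> Phi s' <= N * H.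
  by move=> fl' [_ _ [L C]]; apply: potential_le C.
(* An attempt either raises the potential, which is at most [N * H], or clears the flag. *)
apply: (wp_while (I := I) (mu := fun s' => (N * H - Phi s').*2 + rg s' rG)).
  rewrite /I; wps; split=> //; first by split=> //; exists fl.
    by move=> h x /T; apply: eq_tnode.
  by rewrite /Phi; wps; rewrite subnn addn0.
move=> s2 F [[[fl2 FS2] g2] T2 I2 m2 t2].
have EN : rg s2 rN = N by rewrite (fr_rg F).
have EE : rg s2 rE = e by rewrite (fr_rg F).
have ET : wr s2 vThr = thr by rewrite (fr_wr F).
have EV : ar s2 aVert = vert by rewrite (fr_ar F).
have EP : ar s2 aPp = pp by rewrite (fr_ar F).
split=> //; cbn [ev]; case: ifP => g0; last first.
  have G0 : rg s2 rG = 0 by lia.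
  split=> //; [by exists fl2 | exact: I2 | by move: t2; rewrite G0 subn0].
have G1 : rg s2 rG = 1 by lia.
rewrite /c_try; apply: wp_seq; apply: (wp_use (pick_spec EE eN T2)) => s3 F3 [fN vf k3 a3 b3].
have aE a : ar s3 a = ar s2 a by rewrite (fr_ar F3).
have bE a : wa s3 a = wa s2 a by rewrite (fr_wa F3).
have oE : out s3 = out s2 by rewrite (fr_out F3).
have G3 : rg s3 rG = 1 by rewrite (fr_rg F3).
have E3 : rg s3 rE = e by rewrite (fr_rg F3).
have N3 : rg s3 rN = N by rewrite (fr_rg F3).
have T3 : wr s3 vThr = thr by rewrite (fr_wr F3).
set f := rg s3 rF in fN vf a3 b3 *.
set cl := ar s2 aComp in a3 b3 *.
have stop : (forall p, p < N -> cl p <> cl e -> (thr < psum D 0 p)%R) ->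
  I (tick (sr s3 rG 0)) /\ (N * H - Phi (tick (sr s3 rG 0))).*2 + 0 < (N * H - Phi s2).*2 + rg s2 rG.
  move=> st.
  have PE : Phi (tick (sr s3 rG 0)) = Phi s2 by rewrite /Phi; wps; rewrite !aE.
  split; last by rewrite PE G1; lia.
  split; [split=> // | | | |]; wps; rewrite ?aE //.
  - by exists fl2; case: FS2 => b1 b2 b4; split; wps; rewrite ?aE // oE.
  - by move=> h x /T2; apply: eq_tnode; wps; rewrite ?aE ?bE.
  - by rewrite PE k3; move: t2; rewrite G1; move: (H.+2 * Phi s) (H.+2 * Phi s2) => X Y; lia.
wp1; cbn [ok ev]; rewrite E3 aE -/cl -/f; split; first by spl; lia.
rewrite lt0b; case: eqP => [ef|nef]; first by wps; split=> //; apply: stop => p pN np; case: np; apply: a3.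
split=> //; cbn [wev]; rewrite vf T3; case: ifP => [le|/negbT]; last first.
  rewrite -ltNge => lt; wps; split=> //; apply: stop => p pN np.
  by apply: lt_le_trans lt _; apply: b3.
have hf := hd f fN le; have fn : f < n by lia.
apply: wp_seq; apply: (wp_use (print_spec E3 erefl en fn _ _)); rewrite ?aE ?EP; try exact: ppn.
move=> s4 F4 [o4 k4].
have aE4 a : ar s4 a = ar s2 a by rewrite (fr_ar F4).
have bE4 a : wa s4 a = wa s2 a by rewrite (fr_wa F4).
have E4 : rg s4 rE = e by rewrite (fr_rg F4).
have F4' : rg s4 rF = f by rewrite (fr_rg F4).
have N4 : rg s4 rN = N by rewrite (fr_rg F4).
have G4 : rg s4 rG = 1 by rewrite (fr_rg F4).
have [b1 b2 [L C]] := FS2.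
have C4 : classes N (ar s4 aComp) (ar s4 aNxt) (ar s4 aCsz) L by rewrite !aE4.
have T4 : tree H s4 D (ar s4 aComp).
  by rewrite aE4 => h x /T2; apply: eq_tnode; rewrite ?aE4 ?bE4.
have nef4 : ar s4 aComp e <> ar s4 aComp f by rewrite aE4 => q; apply: nef.
apply: (wp_use (merge_spec LG LT w bigW nIx NIx N4 E4 F4' eN fN C4 nef4 T4)).
rewrite !aE4 -/cl => s5 F5 [C5 T5 [a [b [ab nab c5]]] t5 p5].
have G5 : rg s5 rG = 1 by rewrite (fr_rg F5).
have O5 : out s5 = out s4 by rewrite (fr_out F5).
have FS5 : forest_state (tick s5) (rcons fl2 (e, f)).
  split; wps; last exact: C5.
    apply: (builtS b1 (e := e) (f := f)) => //; [by move=> q; apply: nef | exact: hH|].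
    move=> x y xN yN; rewrite !c5 // -/cl.
    case: ab nab => -[-> ->] nab; case: eqP => e1; case: eqP => e2; split=> //;
      try (by move=> ?; constructor 1; congruence);
      try (by move=> ?; constructor 2; split; congruence);
      try (by move=> ?; constructor 3; split; congruence);
      by case=> [?|[? ?]|[? ?]]; congruence.
  rewrite O5 o4 oE b2 map_rcons flatten_rcons /quad /= ?aE EV ?EP.
  by [].
have P5 : Phi (tick s5) = potential N (ar s5 aComp) (ar s5 aCsz) by rewrite /Phi; wps.
have P2 : Phi s2 = potential N cl (ar s2 aCsz) by rewrite /Phi.
rewrite -/N -P2 -P5 in t5 p5.
split; last by have := PhiM _ _ FS5; rewrite [rg s2 rG]G1 [rg (tick s5) rG]G5;
  move: p5; move: (Phi _) (Phi _) (N * H) => A B K; lia.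
split; [split; [by exists (rcons fl2 (e, f)) | by wps; rewrite G5] | | | |]; wps.
- by move=> h x /T5; apply: eq_tnode.
- by rewrite G5.
- by move=> x y xN yN /(m2 x y xN yN); rewrite !c5 // -/cl => ->.
- rewrite P5; move: t2 t5 p5; rewrite k4 k3 G5 G1 -?P2 -?P5.
  move: (Phi s) (Phi s2) (Phi _) => A0 A B; rewrite (mulSn H.+1 A) (mulSn H.+1 B).
  by move: (H.+2 * A0) (H.+1 * A) (H.+1 * B) => X Y Z; lia.
Qed.

End Query.

(** Non-negative entries in the dummy columns keep these above the threshold once [inf] is added.
    The diagonal needs no such guard: column [e] lies in the class of [e]. *)
Lemma rows_spec s (ml : seq (nat * nat * R)) D1 inf thr :
  rg s rN = N -> rg s rNn = n -> bk n s ml -> size ml < Ix -> wr s vThr = thr ->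
  tree H s D1 (ar s aComp) -> (forall p, psum D1 0 p = dummy n inf p) ->
  (forall p, p < N -> [/\ ar s aComp p = p, ar s aNxt p = p & ar s aCsz p = 1]) ->
  out s = [::] -> (forall x, 0 < x < n -> ar s aPp x < n) -> (thr < inf)%R ->
  (forall e p, 0 < e < n -> (p == 0) || (n <= p) -> (0 <= mv ml e p)%R) ->
  wp c_rows (fun s' => exists fl cl,
    [/\ built n N (fun e f => (mv ml e f <= thr)%R) fl cl,
        out s' = flatten [seq quad (ar s aVert) (ar s aPp) q | q <- fl],
        (forall e f, 0 < e < n -> 0 < f < n -> (mv ml e f <= thr)%R -> cl e = cl f)
      & tk s' <= tk s + 2 * n + H.+1 * size ml + H.+2 * (N * H)]) s.
Proof.
move=> hN hn B hI hT T hD hc ho ppn ti pos; rewrite /c_rows; wps; split=> //.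
pose Hr e f := (mv ml e f <= thr)%R; pose vert := ar s aVert; pose pp := ar s aPp.
pose Phi (s' : st R) := potential N (ar s' aComp) (ar s' aCsz).
pose I s' := exists fl D, let e := rg s' rE in
  [/\ forest_state Hr vert pp s' fl, tree H s' D (ar s' aComp),
    (forall c, D c = D1 c + \sum_(m <- ml | (m.1.1 < e)%N && (m.1.2 == c)) m.2)%R,
    (forall e' f, 0 < e' < n -> e' < e -> 0 < f < n -> Hr e' f -> ar s' aComp e' = ar s' aComp f)
  & e <= n /\ tk s' + H.+2 * Phi s <=
      tk s + 2 * e + H.+1 * count (fun m => m.1.1 < e) ml + H.+2 * Phi s'].
apply: (wp_while (I := I) (mu := fun s' => n - rg s' rE)).
  exists [::], D1; wps; split=> //.
  - split; wps => //.
      by apply: built0 => x y xN yN; have [-> _ _] := hc x xN; have [-> _ _] := hc y yN.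
    exists (fun c => if c < N then [:: c] else [::]); split.
    + by move=> x xN; have [-> _ _] := hc x xN; rewrite xN inE eqxx.
    + move=> c x; case: ifP => // cN; rewrite inE => /eqP ->; split=> //.
      by have [-> _ _] := hc c cN.
    + by move=> c; case: ifP.
    + by move=> c; case: ifP => // cN; have [_ e _] := hc c cN; rewrite /= e eqxx.
    + by move=> x xN; have [-> _ ->] := hc x xN; rewrite xN.
  - by move=> h x /T; apply: eq_tnode.
  - by move=> c; rewrite big_pred0 ?addr0.
  - by rewrite /Phi; wps; split=> //; lia.
move=> s2 F [fl [D [FS T2 hD2 dn [en t2]]]].
have EN : rg s2 rN = N by rewrite (fr_rg F).
have En : rg s2 rNn = n by rewrite (fr_rg F).
have ET : wr s2 vThr = thr by rewrite (fr_wr F).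
have EV : ar s2 aVert = vert by rewrite (fr_ar F).
have EP : ar s2 aPp = pp by rewrite (fr_ar F).
have EH : ar s2 aHd = ar s aHd by rewrite (fr_ar F).
have EX : ar s2 aNx = ar s aNx by rewrite (fr_ar F).
have EO : ar s2 aCol = ar s aCol by rewrite (fr_ar F).
have ED : wa s2 bDel = wa s bDel by rewrite (fr_wa F).
set e := rg s2 rE in hD2 dn en t2 *.
wps; rewrite En; split; first by spl; lia.
rewrite lt0b; case: ifP => lt; last first.
  have eE : e = n by lia.
  rewrite eE in dn t2; exists fl, (ar s2 aComp); have [b1 b2 [L C]] := FS; split=> //.
    by move=> e' f h1 h2 h3; apply: dn => //; lia.
  have := potential_le (erefl N) C; rewrite -/(Phi s2) => le.
  have h1 : H.+2 * Phi s2 <= H.+2 * (N * H) by rewrite leq_mul2l le orbT.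
  have h2 : H.+1 * count (fun m => m.1.1 < n) ml <= H.+1 * size ml by rewrite leq_mul2l count_size orbT.
  by move: t2 h1 h2; move: (H.+2 * Phi s) (H.+2 * Phi s2) (H.+1 * _) => X Y Z; lia.
have [B1 B2 B3 B4] := B.
split; first by spl; lia.
rewrite EH B3; set s3 := sr _ rM _.
have T3 : tree H s3 D (ar s3 aComp) by move=> h x /T2; apply: eq_tnode.
apply: (wp_use (bucket_spec (l := ml) (r := e) (D := D) (s := s3) _ _ hI B4 _ T3)); rewrite /s3; wps => //.
  by rewrite EX EO ED.
rewrite -/s3 => s4 F4 [[D4 T4 hD4] t4].
have aE a : a \notin [:: aI1; aI2] -> ar s4 a = ar s2 a by move=> h; rewrite (fr_ar F4).
have E4 : rg s4 rE = e by rewrite (fr_rg F4).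
have N4 : rg s4 rN = N by rewrite (fr_rg F4).
have T4' : wr s4 vThr = thr by rewrite (fr_wr F4).
have O4 : out s4 = out s2 by rewrite (fr_out F4).
have FS4 : forest_state Hr vert pp s4 fl.
  by case: FS => b1 b2 b3; split; rewrite ?aE // O4.
have hD5 c : (D4 c = D1 c + \sum_(m <- ml | (m.1.1 < e.+1)%N && (m.1.2 == c)) m.2)%R.
  rewrite hD4 hD2 -addrA; congr (_ + _)%R.
  rewrite [in RHS](bigID (fun m => m.1.1 < e)%N) /=; congr (_ + _)%R; apply: eq_bigl => m; lia.
(* Once the rows up to [e] are loaded, a prefix sum over columns is a sum over a lower left
   quadrant. *)
have val f : psum D4 0 f = (dummy n inf f + mv ml e f)%R.
  rewrite /psum (eq_bigr _ (fun c _ => hD5 c)) big_split /= -/(psum D1 0 f) hD.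
  rewrite (sum_masses_upto ml (fun r => r < e.+1)); congr (_ + _)%R.
  by rewrite big_mkcond.
have cnt : count (fun m : nat * nat * R => m.1.1 < e.+1) ml =
   count (fun m => m.1.1 < e) ml + count (fun m => m.1.1 == e) ml.
  rewrite -count_predUI (_ : count (predI _ _) ml = 0) ?addn0.
    by apply: eq_count => m /=; lia.
  by rewrite (eq_count (a2 := pred0)) ?count_pred0 // => m /=; lia.
rewrite E4; split=> //; rewrite lt0b; case: ifP => e0.
  have he : 0 < e < n by lia.
  have lo f : 0 < f < n -> dummy n inf f = 0%R.
    by move=> hf; rewrite /dummy; case: ifP => //; lia.
  apply: (wp_use (query_spec (D := D4) (thr := thr) (e := e) N4 E4 he T4' _ _ _ _ FS4 _ _)); rewrite ?aE //.
  - move=> f fN; rewrite val /dummy; case: ifP => [dd le|]; last by lia.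
    by exfalso; have := pos e f he dd; lra.
  - by move=> f hf; rewrite val lo // add0r.
  move=> s5 F5 [[fl5 FS5] T5 st5 m5 t5].
  have E5 : rg s5 rE = e by rewrite (fr_rg F5).
  rewrite E5 addn1; spl => //; try lia.
  exists fl5, D4; wps; rewrite ?E5 ?addn1; split.
  - by case: FS5 => b1 b2 b3; split.
  - by move=> h x /T5; apply: eq_tnode.
  - exact: hD5.
  - move=> e' f h1; rewrite ltnS leq_eqVlt => /orP[/eqP e'E|h2] h3 hr.
      subst e'; case: (eqVneq (ar s5 aComp f) (ar s5 aComp e)) => [-> //|/eqP ne].
      have := st5 f _ ne; rewrite val lo // add0r => /(_ _) lt'.
      by exfalso; move: hr; rewrite /Hr leNgt lt' //; lia.
    (* Merges only coarsen the classes, so the pairs of earlier rows stay joined. *)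
    by apply: m5; [lia|lia|rewrite ?aE //; apply: dn].
  - split; first lia.
    move: t2 t4 t5; rewrite cnt mulnDr /Phi; wps; rewrite ?aE //.
    move: (H.+2 * _) (H.+2 * _) (H.+2 * _) (H.+1 * _) (H.+1 * _) => X Y Z U V; lia.
spl => //; try lia; exists fl, D4; wps; rewrite ?E4 ?addn1; split.
- by case: FS4 => b1 b2 b3; split.
- by move=> h x /T4; apply: eq_tnode => //; wps; rewrite ?aE.
- exact: hD5.
- by move=> e' f h1 h2; lia.
- split; first lia.
  move: t2 t4; rewrite cnt mulnDr /Phi; wps; rewrite ?aE //.
  move: (H.+2 * _) (H.+2 * _) (H.+1 * _) (H.+1 * _) => X Y U V; lia.
Qed.

End Rows.

(** * Correctness of the matrix *)

Lemma card_set2I (V : finType) (S : {set V}) u v : u != v ->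
  (#|[set u; v] :&: S| == 1) = (u \in S) (+) (v \in S).
Proof.
move=> uv; rewrite (cardsD1 u) (cardsD1 v) !inE !eqxx [v == u]eq_sym (negbTE uv) /=.
have -> : ([set u; v] :&: S) :\ u :\ v = set0.
  by apply/setP=> z; rewrite !inE; case: (z == v); case: (z == u).
by rewrite cards0; case: (u \in S); case: (v \in S).
Qed.

Lemma nb_ord n (L : adjlists n) (v : 'I_n) : nb L (val v) = [seq val u | u <- L v].
Proof. by rewrite /nb /nbrs valK. Qed.

Lemma pval_xor (R : realType) (a : R) A x y :
  (pval a (a + a) A x y = a * (A x (+) A y)%:R)%R.
Proof. by rewrite /pval; case: (A x); case: (A y) => /=; ring. Qed.

Lemma pval_and (R : realType) (a : R) A x y :
  (pval 0 (0 - a) A x y = a * (A x && A y)%:R)%R.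
Proof. by rewrite /pval; case: (A x); case: (A y) => /=; ring. Qed.

Section Graph.
Variables (R : realType) (n : nat) (E T : {set {set 'I_n}}) (w : {set 'I_n} -> R).
Variables (LG LT : adjlists n).
Hypothesis gE : is_graph [set: 'I_n] E.
Hypothesis w_gt0 : forall e, e \in E -> (0 < w e)%R.
Hypothesis stT : spanning_tree [set: 'I_n] E T.
Hypothesis aG : adjlists_of E LG.
Hypothesis aT : adjlists_of T LT.

Lemma card_edge e : e \in E -> #|e| = 2.
Proof. by case/gE. Qed.

Lemma card_tree_edge e : e \in T -> #|e| = 2.
Proof. by case: stT => /subsetP TE _ _ /TE/card_edge. Qed.

Lemma cost_ge0 e f : (0 <= cost E T w e f)%R.
Proof. by apply: sumr_ge0 => g; rewrite inE => /andP[/w_gt0/ltW]. Qed.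

Lemma size_nb_le L v : L = LG \/ L = LT -> size (nb L v) <= n.
Proof.
have H (M : adjlists n) X : adjlists_of X M -> size (nb M v) <= n.
  move=> aX; rewrite /nb size_map /nbrs; case: insubP => //= u _ _.
  have [U _] := aX u; rewrite -(card_uniqP U) -[n in _ <= n](card_ord n); exact: max_card.
by case=> ->; [apply: H aG | apply: H aT].
Qed.

Lemma nb_tree_ind (P : nat -> Prop) : P 0 ->
  (forall v u, v < n -> P v -> u \in nb LT v -> P u) -> forall v, v < n -> P v.
Proof.
move=> P0 PS v vn; have n0 : 0 < n by lia.
have [_ [_ cT] _] := stT; have /connectP[p] := cT (Ordinal n0) (Ordinal vn) (in_setT _) (in_setT _).
rewrite -[v]/(val (Ordinal vn)) => pth ->.
have : P (val (Ordinal n0)) by [].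
elim: p (Ordinal n0) pth => //= u p IH x /andP[xu pth] Px; apply: IH => //.
by apply: (PS x) => //; rewrite nb_ord map_f // (aT x).2.
Qed.

Lemma nbr_exists v : 1 < n -> exists u, u \in LG v.
Proof.
move=> n1; have [TE [_ cT] _] := stT.
have [u vu] : exists u : 'I_n, u != v.
  case: (posnP v) => v0; first by exists (Ordinal n1); rewrite -val_eqE /= v0.
  have n0 : 0 < n by lia.
  by exists (Ordinal n0); rewrite -val_eqE /= eq_sym -lt0n.
have /connectP[[|x p] /=] := cT v u (in_setT _) (in_setT _).
  by move=> _ e; rewrite e eqxx in vu.
case/andP=> vx _ _; exists x; rewrite (aG v).2; exact: (subsetP TE).
Qed.

Lemma sum_degrees : \sum_(0 <= v < n) size (nb LG v) = #|E| * 2.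
Proof.
rewrite big_mkord.
have := sum_ordered_pairs (M := nat) (fun=> 1) card_edge.
rewrite -[(\sum_(e in E) 1%N)%R]/(\sum_(e in E) 1) sum1_card.
rewrite -[(_ *+ 2)%R]/(#|E| + #|E|)%N muln2 -addnn => <-.
apply: eq_bigr => v _; rewrite nb_ord size_map.
rewrite -[RHS]/(\sum_(u | [set v; u] \in E) 1) sum1_card -(card_uniqP (aG v).1).
by apply: eq_card => u; rewrite (aG v).2.
Qed.

(** Every vertex has a neighbour when [1 < n], so [n] is at most the degree sum. *)
Lemma npaths_le_edges : 1 < n -> npaths LG n <= 4 * #|E|.
Proof.
move=> n1; have le : n <= \sum_(0 <= v < n) size (nb LG v).
  rewrite big_mkord -[X in X <= _](card_ord n) -sum1_card; apply: leq_sum => v _.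
  by rewrite nb_ord size_map; have [u] := nbr_exists v n1; case: (LG v).
have -> : npaths LG n = n + #|E| * 2.
  rewrite -sum_degrees /npaths; under eq_bigr do rewrite -add1n.
  by rewrite big_split /= sum_nat_const_nat subn0 muln1.
by rewrite sum_degrees in le; lia.
Qed.

Lemma order_le : 1 < n -> n <= 2 * #|E|.
Proof.
move=> n1; rewrite mulnC -sum_degrees big_mkord -[X in X <= _](card_ord n) -sum1_card.
apply: leq_sum => v _.
by rewrite nb_ord size_map; have [u] := nbr_exists v n1; case: (LG v).
Qed.

Lemma sum_tree_degrees_le : \sum_(0 <= v < n) size (nb LT v) <= #|E| * 2.
Proof.
rewrite -sum_degrees !big_mkord; apply: leq_sum => v _; rewrite !nb_ord !size_map.
rewrite -(card_uniqP (aG v).1) -(card_uniqP (aT v).1); apply: subset_leq_card.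
apply/subsetP=> u; rewrite (aG v).2 (aT v).2; case: stT => TE _ _; exact: (subsetP TE).
Qed.

(** A bound in [n] alone, because the word size, and with it the room for arrays, depends only on
    [n]. *)
Lemma npaths_le_sqr : npaths LG n <= n * n.+1.
Proof.
rewrite /npaths big_mkord -[X in X * _](card_ord n) -sum_nat_const.
by apply: leq_sum => v _; rewrite ltnS; apply: size_nb_le; left.
Qed.

Section Matrix.
Variables (Lg : nat) (pos vert h pp rk : nat -> nat).
Hypothesis hl : hld LT Lg pos vert h pp rk.
Hypothesis n_gt0 : 0 < n.

Definition vtx x : 'I_n := insubd (Ordinal n_gt0) (vert x).
Definition psn (v : 'I_n) := pos (val v).
Notation te := (te pp vtx).
Notation below := (below pp psn).

Lemma val_vtx x : x < n -> val (vtx x) = vert x.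
Proof. by move=> xn; rewrite val_insubd (hl_vert hl xn).1. Qed.

Lemma psn_lt v : psn v < n.
Proof. exact: (hl_pos hl (ltn_ord v)).1. Qed.

Lemma psnK : cancel psn vtx.
Proof. by move=> v; apply: val_inj; rewrite val_vtx ?psn_lt //; apply: (hl_pos hl (ltn_ord v)).2. Qed.

Lemma vtxK x : x < n -> psn (vtx x) = x.
Proof. by move=> xn; rewrite /psn val_vtx //; apply: (hl_vert hl xn).2. Qed.

Lemma pp_ltn x : 0 < x < n -> pp x < n.
Proof. by move=> hx; have := hl_pp hl hx; lia. Qed.

Lemma te_tree x : 0 < x < n -> te x \in T.
Proof.
move=> hx; have := hl_adj hl hx; have pn := pp_ltn hx; have xn : x < n by lia.
rewrite -!val_vtx // nb_ord mem_map; last exact: val_inj.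
by rewrite (aT _).2 /te setUC.
Qed.

Lemma acyclic_tree : acyclic T. Proof. by case: stT. Qed.

Definition matrix_sum (inf : R) x y :=
  (\sum_(0 <= i < n) (\sum_(0 <= j < size (nb LG i)) edge_val LG w pos pp i j x y
     + fake_val LT pos pp inf i x y))%R.

Lemma edge_val_sum (v : 'I_n) x y :
  (\sum_(0 <= j < size (nb LG (val v))) edge_val LG w pos pp (val v) j x y =
   \sum_(u | [set v; u] \in E)
      w [set v; u] * ((below x v (+) below x u) (+) (below y v (+) below y u))%:R)%R.
Proof.
rewrite -(eq_bigl _ _ (aG v).2) -big_uniq ?(aG v).1 //= nb_ord size_map.
rewrite [RHS](big_nth v) !big_mkord; apply: eq_bigr => j _.
rewrite /edge_val /query_wt valK nb_ord (nth_map v) // onthE (nth_map v) //.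
by rewrite pval_xor.
Qed.

Lemma fake_valE (inf : R) (v : 'I_n) x y :
  fake_val LT pos pp inf (val v) x y =
  (if LT v is [:: a; b] then
     inf * ((below x a (+) below x b) && (below y a (+) below y b))%:R else 0)%R.
Proof.
rewrite /fake_val nb_ord size_map; case: (LT v) => [|a [|b [|c l]]] //=.
exact: pval_and.
Qed.

(** By [middle_cross] an edge lies in the cut iff it crosses exactly one of the two fundamental
    cuts, and the adjacency lists show it from both ends. *)
Lemma cost_sum x y : 0 < x < n -> 0 < y < n -> x != y ->
  (\sum_(0 <= i < n) \sum_(0 <= j < size (nb LG i)) edge_val LG w pos pp i j x y =
   cost E T w (te x) (te y) *+ 2)%R.
Proof.
move=> hx hy xy; rewrite big_mkord /cost /cut /Delta.
set M := middle T (te x) (te y).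
rewrite [in RHS](eq_bigl _ _ (fun g => in_set _ g)) big_mkcondr /=.
rewrite -(sum_ordered_pairs (fun g => if #|g :&: M| == 1 then w g else 0%R)); last exact: card_edge.
apply: eq_bigr => v _; rewrite edge_val_sum; apply: eq_bigr => u vu.
have nvu : v != u by apply/eqP=> e; have := card_edge vu; rewrite e setUid cards1.
rewrite card_set2I // (middle_cross (hl_pp hl) psn_lt psnK vtxK te_tree acyclic_tree card_tree_edge) //.
by case: addb; rewrite ?mulr1 ?mulr0.
Qed.

Lemma fake_ge0 (inf : R) v x y : (0 <= inf)%R -> (0 <= fake_val LT pos pp inf (val (v : 'I_n)) x y)%R.
Proof.
by move=> i0; rewrite fake_valE; case: (LT v) => [|a [|b [|c l]]] //; rewrite mulr_ge0.
Qed.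

Lemma matrix_sum_ge0 (inf : R) x y : (0 <= inf)%R ->
  (0 <= matrix_sum inf x y)%R.
Proof.
move=> i0; rewrite /matrix_sum big_mkord; apply: sumr_ge0 => v _.
rewrite addr_ge0 ?fake_ge0 // edge_val_sum; apply: sumr_ge0 => u vu.
by rewrite mulr_ge0 ?ler0n //; apply/ltW/w_gt0.
Qed.

(** For a non-trivial cut all penalties vanish, since one at [(x, y)] would exhibit a single-vertex
    middle component, and the entry is twice the cost. For a trivial cut that vertex contributes
    [2 beta + w0] and all other terms are non-negative. *)
Lemma matrix_le (beta w0 : R) x y : (0 <= beta)%R -> (0 < w0)%R ->
  0 < x < n -> 0 < y < n -> x != y ->
  (matrix_sum (beta + beta + w0) x y <= beta + beta)%R =
  (cost E T w (te x) (te y) <= beta)%R && nontrivial (middle T (te x) (te y)).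
Proof.
move=> b0 w00 hx hy xy; set inf := (beta + beta + w0)%R.
have i0 : (0 <= inf)%R by rewrite /inf; lra.
have tm := trivial_middle (hl_pp hl) psn_lt psnK vtxK te_tree acyclic_tree card_tree_edge hx hy xy.
have c0 := cost_ge0 (te x) (te y).
rewrite /matrix_sum big_split /= cost_sum //.
case nt : (nontrivial _).
  rewrite andbT big_mkord big1 => [|v _]; first by rewrite addr0 mulr2n; apply/idP/idP => ?; lra.
  rewrite fake_valE; have [U mU] := aT v; move: U mU; case: (LT v) => [|a [|b [|c l]]] //= U mU.
  case: andP => [[ax ay]|]; last by rewrite mulr0.
  suff : ~~ nontrivial (middle T (te x) (te y)) by rewrite nt.
  apply/tm; exists v, a, b; split=> //; first by move: U; rewrite inE andbT.
  by move=> u; rewrite -[LHS]mU !inE.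
rewrite andbF; apply/negbTE; rewrite -ltNge.
have [|v [u1 [u2 [u12 mU ax ay]]]] := tm _; first by rewrite nt.
rewrite big_mkord (bigD1 v) //=.
have -> : fake_val LT pos pp inf v x y = inf.
  rewrite (fake_valE inf v); have [U mL] := aT v.
  have mL' u : (u \in LT v) = (u \in [set u1; u2]) by rewrite mL -mU.
  have sz : size (LT v) = 2.
    rewrite -(card_uniqP U); have <- : #|[set u1; u2]| = 2 by rewrite cards2 u12.
    exact: eq_card.
  move: U sz mL' ; case: (LT v) => [|a [|b [|c l]]] //= U _ mL'.
  have := mL' a; have := mL' b; rewrite !inE !eqxx orbT /=.
  move: U; rewrite inE andbT => nab /esym hb /esym ha.
  have S z : below z a (+) below z b = below z u1 (+) below z u2.
    move/idP: ha => /orP[] /eqP qa; move/idP: hb => /orP[] /eqP qb;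
    by move: nab; rewrite qa qb ?eqxx // addbC.
  by rewrite !S ax ay mulr1.
have : (0 <= \sum_(i < n | i != v) fake_val LT pos pp inf i x y)%R.
  by apply: sumr_ge0 => i _; apply: fake_ge0.
by move: (\sum_(i < n | _) _)%R => S S0; rewrite /inf mulr2n; lra.
Qed.

(** * Correctness of the forest *)

Definition fedge (q : nat * nat) := [set te q.1; te q.2].

(** Classes of tree edges coincide with connectivity in the printed graph, so joining distinct
    classes neither closes a cycle nor repeats an edge. *)
Lemma built_forest N Hr fl cl : n <= N -> built n N Hr fl cl ->
  let F := [set z in [seq fedge q | q <- fl]] in
  [/\ acyclic F, uniq [seq fedge q | q <- fl],
      forall x y, 0 < x < n -> 0 < y < n -> (cl x = cl y <-> connect (adj F) (te x) (te y))
    & forall q, q \in fl -> [/\ 0 < q.1 < n, 0 < q.2 < n, q.1 != q.2 & Hr q.1 q.2]].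
Proof.
move=> nN; elim=> {fl cl} [cl inj|fl cl cl' e f _ IH nef hr he hf hc] /=.
  have E0 : [set z in ([::] : seq {set {set 'I_n}})] = set0 by apply/setP=> z; rewrite !inE.
  rewrite E0; split=> //; first exact: acyclic0.
  move=> x y hx hy; split=> [/inj->|]; [exact: connect0 | lia | lia |].
  case/connectP=> -[|u p] /=; last by rewrite /adj /= inE.
  move=> _ /(te_inj (hl_pp hl) psn_lt psnK vtxK te_tree acyclic_tree card_tree_edge) -> //.
move: IH => [ac U co hq].
set F := [set z in [seq fedge q | q <- fl]] in ac co.
have -> : [set z in [seq fedge q | q <- rcons fl (e, f)]] = fedge (e, f) |: F.
  by apply/setP=> z; rewrite map_rcons !inE mem_rcons inE.
have nc : ~~ connect (adj F) (te e) (te f) by apply/negP => /(co e f he hf).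
split.
- exact: acyclic_add.
- rewrite map_rcons rcons_uniq U andbT; apply/negP => m; case/negP: nc; apply: connect1.
  by rewrite /adj /= inE.
- move=> x y hx hy; rewrite (hc x y); [|lia|lia].
  have S (u v : {set 'I_n}) : connect (adj F) u v -> connect (adj (fedge (e, f) |: F)) u v.
    by apply: connect_adj_sub; apply/subsetP=> z; rewrite !inE => ->; rewrite orbT.
  have ef : connect (adj (fedge (e, f) |: F)) (te e) (te f).
    by apply: connect1; rewrite /adj /= !inE eqxx.
  have fe : connect (adj (fedge (e, f) |: F)) (te f) (te e) by rewrite connect_adj_sym.
  split=> [[]|/connect_addE[]].
  + by move/(co x y hx hy)/S.
  + case=> /(co x e hx he)/S a /esym/(co f y hf hy)/S b.
    exact: connect_trans a (connect_trans ef b).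
  + case=> /(co x f hx hf)/S a /esym/(co e y he hy)/S b.
    exact: connect_trans a (connect_trans fe b).
  + by move/(co x y hx hy) => ?; constructor 1.
  + by case=> /(co x e hx he) ? /(co f y hf hy) ?; constructor 2.
  + by case=> /(co x f hx hf) ? /(co e y he hy) ?; constructor 3.
- move=> q; rewrite mem_rcons inE => /orP[/eqP->|/hq] //; split=> //=.
  by apply/eqP=> q'; apply: nef; rewrite q'.
Qed.

Lemma built_outputs N fl cl (beta : R) (M : nat -> nat -> R) :
  n <= N -> (forall x y, 0 < x < n -> 0 < y < n -> x != y -> (M x y <= beta + beta)%R =
    (cost E T w (te x) (te y) <= beta)%R && nontrivial (middle T (te x) (te y))) ->
  built n N (fun x y => (M x y <= beta + beta)%R) fl cl ->
  (forall x y, 0 < x < n -> 0 < y < n -> (M x y <= beta + beta)%R -> cl x = cl y) ->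
  exists2 F, outputs (flatten [seq quad vert pp q | q <- fl]) F
    & spanning_forest T (Hedges E T w beta) F.
Proof.
move=> nN hM bt mx; have [ac U co hq] := built_forest nN bt.
exists [set z in [seq fedge q | q <- fl]].
  exists [seq ((vtx q.1, vtx (pp q.1)), (vtx q.2, vtx (pp q.2))) | q <- fl].
  rewrite -!map_comp; split=> //; congr flatten; apply/eq_in_map => q /hq[h1 h2 _ _] /=.
  have [p1 p2] := (pp_ltn h1, pp_ltn h2).
  by case/andP: h1 => _ q1; case/andP: h2 => _ q2; rewrite /quad -!val_vtx.
apply: spanning_forest_sub => //.
  apply/subsetP=> z; rewrite inE => /mapP[q /hq[h1 h2 nq le] ->].
  rewrite hM // in le; apply/imset2P; exists (te q.1) (te q.2); rewrite ?te_tree // inE te_tree //= le andbT.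
  by apply: contra nq => /eqP/(te_inj (hl_pp hl) psn_lt psnK vtxK te_tree acyclic_tree card_tree_edge)->.
have TE := T_te (hl_pp hl) psn_lt psnK te_tree acyclic_tree card_tree_edge.
move=> u v /imset2P[e f eT]; rewrite inE => /andP[fT /andP[ef le]] uv.
have [x hx ex] := TE _ eT; have [y hy ey] := TE _ fT; subst e f.
have xy : x != y by apply: contra ef => /eqP->.
have c : connect (adj [set z in [seq fedge q | q <- fl]]) (te x) (te y).
  by apply/co => //; apply: mx => //; rewrite hM.
by case: (set2_eq uv) => -[-> ->] //; rewrite connect_adj_sym.
Qed.

End Matrix.
End Graph.

(** * The program *)

Definition c_body :=
  c_layout ;; c_setup ;; c_edges ;; c_leaves ;; c_build ;; c_dummies ;; c_rows.

(** If [n < 2] there are no tree edges, and if [beta < 0] no cost is small enough; the empty output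
    is then right. *)
Definition c_main := Ife (Cn 2 <=~ $rNn) (Ifw Wz (Wv vB) c_body Skip) Skip.

Definition start_state (R : realType) n (beta : R) : st R :=
  St (fun r => if r == 0 then n else 0) (fun _ _ => 0)
     (fun r => if r == 0 then beta else 0%R) (fun _ _ => 0%R) [::] 0.

(** * Output and ticks of the whole run *)

Section Body.
Variables (R : realType) (W n Ix Lg : nat) (E T : {set {set 'I_n}}) (w : {set 'I_n} -> R).
Variables (LG LT : adjlists n) (beta : R).
Hypothesis gE : is_graph [set: 'I_n] E.
Hypothesis w_gt0 : forall e, e \in E -> (0 < w e)%R.
Hypothesis stT : spanning_tree [set: 'I_n] E T.
Hypothesis aG : adjlists_of E LG.
Hypothesis aT : adjlists_of T LT.
Hypothesis n_gt1 : 1 < n.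
Hypothesis beta_ge0 : (0 <= beta)%R.
Hypothesis bigW : 128 * Ix.+1 <= 2 ^ W.
Hypothesis nIx : 4 * n.+4 <= Ix.
Hypothesis treeIx : 8 * n <= Ix.
Hypothesis LgE : Lg = trunc_log 2 n.
Notation Cm := (4 * Lg + 2).
Hypothesis massIx : npaths LG n * (Cm * (Cm + 2)) < Ix.

Lemma first_weight_gt0 : (0 < query_wt LG w 0 0)%R.
Proof.
have n0 : 0 < n by lia.
rewrite /query_wt (_ : insub 0 = Some (Ordinal n0)); last by rewrite insubT.
have [u] := nbr_exists stT aG (Ordinal n0) n_gt1.
have := (aG (Ordinal n0)).2; case: (LG _) => //= v l H _; apply: w_gt0.
by have := H v; rewrite inE eqxx => /esym.
Qed.

Lemma body_spec : wp W Ix LG LT w c_body (fun s' =>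
  (exists2 F, outputs (out s') F & spanning_forest T (Hedges E T w beta) F) /\
  exists2 H, 2 ^ H <= 2 * n & tk s' <= 4 * n + \sum_(0 <= v < n) size (nb LT v) + H
     + (n + npaths LG n * (2 * Lg + Cm + Cm * Cm).+1) + 2 ^ H + 2 ^ H + 3 * H
     + 2 * n + H.+1 * (npaths LG n * (Cm * (Cm + 2))) + H.+2 * (2 ^ H * H))
  (start_state n beta).
Proof.
have n0 : 0 < n by lia.
have dle := size_nb_le aG aT; have cnT := nb_tree_ind stT aT.
have w0 := first_weight_gt0.
set s0 := start_state n beta; rewrite /c_body.
have z0 l : zero_arr s0 l by [].
apply: wp_seq; apply: (wp_use (layout_spec w bigW n0 nIx LgE dle cnT (erefl : rg s0 0 = n) (z0 _))).
move=> s1 F1 [[rk hl] t1].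
have n1 : rg s1 rNn = n by rewrite (fr_rg F1).
have b1 : wr s1 vB = beta by rewrite (fr_wr F1).
apply: wp_seq; apply: (wp_use (setup_spec LG LT w bigW nIx n0 n1)).
move=> s2 F2 [[H [N2 NH t2]] T2 I2].
have NIx : 4 * 2 ^ H <= Ix by case/andP: NH => _; move: (2 ^ H) treeIx => N hI; lia.
have nN : n < 2 ^ H by case/andP: NH.
rewrite b1 in T2 I2; set w00 := query_wt LG w 0 0 in w0 I2.
have n2 : rg s2 rNn = n by rewrite (fr_rg F2).
have A2 a : ar s2 a = ar s1 a by rewrite (fr_ar F2).
rewrite -!A2 in hl.
have z2 : zero_arr s2 [:: aHd].
  by move=> a i; rewrite inE => /eqP->; rewrite A2 (fr_ar F1).
apply: wp_seq; apply: (wp_use (edges_spec w bigW n0 nIx LgE dle n2 hl z2 massIx)).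
move=> s3 F3 [ml [bk3 sz t3 mvE]].
have N3 : rg s3 rN = 2 ^ H by rewrite (fr_rg F3).
apply: wp_seq; apply: (wp_use (leaves_spec LG LT w bigW nIx NIx N3)).
move=> s4 F4 [L4 t4].
have N4 : rg s4 rN = 2 ^ H by rewrite (fr_rg F4).
have L4' p : p < 2 ^ H -> ar s4 aI1 (2 ^ H + p) = p /\ ar s4 aI2 (2 ^ H + p) = p by case/L4.
have W4 b x : b \in [:: bS; bV1; bV2] -> wa s4 b x = 0%R.
  rewrite !inE => /or3P[] /eqP->;
  by rewrite (fr_wa F4) // (fr_wa F3) // (fr_wa F2) // (fr_wa F1).
apply: wp_seq; apply: (wp_use (build_spec LG LT w bigW nIx NIx N4 L4' W4)).
move=> s5 F5 [T5 t5].
have N5 : rg s5 rN = 2 ^ H by rewrite (fr_rg F5).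
have C5 : ar s5 aComp = ar s4 aComp by rewrite (fr_ar F5).
have n5 : rg s5 rNn = n by rewrite (fr_rg F5) // (fr_rg F4) // (fr_rg F3).
rewrite -C5 in T5.
apply: wp_seq; apply: (wp_use (dummies_spec LG LT w bigW nIx NIx n_gt1 nN N5 n5 T5)).
move=> s6 F6 [[D1 T6 D6] t6].
have C6 : ar s6 aComp = ar s5 aComp by rewrite (fr_ar F6).
have N6 : rg s6 rN = 2 ^ H by rewrite (fr_rg F6).
have n6 : rg s6 rNn = n by rewrite (fr_rg F6).
have bk6 : bk n s6 ml.
  case: bk3 => q1 q2 q3 q4; split=> //.
  - by rewrite (fr_rg F6) // (fr_rg F5) // (fr_rg F4).
  - by rewrite !(fr_ar F6) // !(fr_ar F5) // !(fr_ar F4) // (fr_wa F6) // (fr_wa F5) // (fr_wa F4).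
  - by move=> r; rewrite (fr_ar F6) // (fr_ar F5) // (fr_ar F4).
have keep a : a \in [:: aVert; aPp] -> ar s6 a = ar s2 a.
  rewrite !inE => /orP[] /eqP->;
  by rewrite (fr_ar F6) // (fr_ar F5) // (fr_ar F4) // (fr_ar F3).
have T6' : wr s6 vThr = (beta + beta)%R.
  by rewrite (fr_wr F6) // (fr_wr F5) // (fr_wr F4) // (fr_wr F3).
have I5 : wr s5 vInf = (beta + beta + w00)%R.
  by rewrite (fr_wr F5) // (fr_wr F4) // (fr_wr F3).
rewrite I5 in D6; rewrite I2 in mvE.
have o6 : out s6 = [::].
  by rewrite (fr_out F6) // (fr_out F5) // (fr_out F4) // (fr_out F3) // (fr_out F2) // (fr_out F1).
have c6 p : p < 2 ^ H -> [/\ ar s6 aComp p = p, ar s6 aNxt p = p & ar s6 aCsz p = 1].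
  by move=> pN; have [? ? ? _ _] := L4 p pN; rewrite !(fr_ar F6) // !(fr_ar F5).
have szI : size ml < Ix by apply: leq_ltn_trans sz massIx.
rewrite -C6 in T6 *.
have pp6 x : 0 < x < n -> ar s6 aPp x < n by rewrite keep //; apply: (pp_ltn hl).
have pos : forall e p, 0 < e < n -> (p == 0) || (n <= p) -> (0 <= mv ml e p)%R.
  have i0 : (0 <= beta + beta + w00)%R := addr_ge0 (addr_ge0 beta_ge0 beta_ge0) (ltW w0).
  by move=> e p _ _; rewrite mvE; apply: (matrix_sum_ge0 LT w_gt0 aG _ _ e p i0).
apply: (wp_use (rows_spec LG LT w bigW nIx NIx nN N6 n6 bk6 szI T6' T6 D6 c6 o6 pp6 _ pos)).
  by rewrite ltrDl.
move=> s7 F7 [fl [cl [B7 O7 M7 t7]]]; split.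
  rewrite O7 !keep //.
  apply: (built_outputs (M := mv ml) (n_gt0 := n0) gE stT aT hl (ltnW nN) _ B7 M7) => x y hx hy xy.
  rewrite mvE; exact: (matrix_le gE w_gt0 stT aG aT hl).
exists H; first by case/andP: NH.
have t7' := leq_mul (leqnn H.+1) sz.
move: t1 t2 t3 t4 t5 t6 t7 t7'; rewrite /s0 /=.
move: (H.+2 * (2 ^ H * H)) (H.+1 * size ml) (H.+1 * (npaths LG n * (Cm * (Cm + 2)))).
move: (npaths LG n * (2 * Lg + Cm + Cm * Cm).+1) (2 ^ H) (\sum_(0 <= v < n) _).
move: (tk s1) (tk s2) (tk s3) (tk s4) (tk s5) (tk s6) (tk s7); clear => *; lia.
Qed.

End Body.

(** * Word size and final time bound *)

Lemma sim_start (R : realType) W n (beta : R) : n < 2 ^ W ->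
  sim W (start_state n beta) (init n beta).
Proof.
by move=> nW; split=> //= x; case: eqP => // _; rewrite expn_gt0.
Qed.

Lemma Hedges_set0 (R : realType) n (E T : {set {set 'I_n}}) (w : {set 'I_n} -> R) (beta : R) :
  (forall e, e \in E -> (0 < w e)%R) -> (forall e, e \in T -> #|e| = 2) ->
  n < 2 \/ (beta < 0)%R -> Hedges E T w beta = set0.
Proof.
move=> w_gt0 cT H; apply/setP=> z; rewrite inE; apply/negbTE/imset2P => -[e f eT].
rewrite inE => /andP[_ /and3P[_ le _]] _.
case: H => [n2|b0]; first by have := max_card (mem e); rewrite cT // card_ord; lia.
by have := cost_ge0 T w_gt0 e f; lra.
Qed.

(** With [q = 2 ^ (L + 1)] there are at most [36 * q ^ 4] masses, so [256 * q ^ 5] indices are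
    ample. Seven bits go to the factor 128 and eight to 256; [5 (L + 1) + 15 <= 20 (L + 1)], an
    equality at [L = 0], explains the 20. *)
Lemma word_room n : exists Ix,
  [/\ 128 * Ix.+1 <= 2 ^ word_size 20 n, 0 < n -> 4 * n.+4 <= Ix, 8 * n <= Ix
    & n * n.+1 * ((4 * trunc_log 2 n + 2) * (4 * trunc_log 2 n + 2 + 2)) < Ix].
Proof.
set L := trunc_log 2 n; rewrite /word_size -/L.
have nq : n < 2 ^ L.+1 by apply: trunc_log_ltn.
have Lq : L < 2 ^ L.+1 by apply: (@ltn_trans (2 ^ L)); [apply: ltn_expl | rewrite ltn_exp2l].
have q0 : 1 < 2 ^ L.+1 by rewrite (ltn_exp2l 0).
exists (2 ^ (20 * L.+1 - 7)).-1.
rewrite prednK ?expn_gt0 // -(expnD 2 7) subnKC; last by lia.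
have le : 256 * (2 ^ L.+1) ^ 5 <= 2 ^ (20 * L.+1 - 7).
  by rewrite -expnM -(expnD 2 8) leq_exp2l //; lia.
move: (2 ^ (20 * L.+1 - 7)) le => X; move: (2 ^ L.+1) nq Lq q0 => q nq Lq q0 le.
have q1 : q ^ 5 = q * q * (q * q) * q by rewrite !expnS expn0; ring.
have e1 : n * n.+1 <= q * q by apply: leq_mul; lia.
have e2 : (4 * L + 2) * (4 * L + 2 + 2) <= 36 * (q * q).
  have -> : 36 * (q * q) = (6 * q) * (6 * q) by ring.
  by apply: leq_mul; lia.
have e3 : n * n.+1 * ((4 * L + 2) * (4 * L + 2 + 2)) <= 36 * (q * q * (q * q)).
  by apply: leq_trans (leq_mul e1 e2) _; rewrite mulnCA.
have e4 : q * q * (q * q) <= q * q * (q * q) * q by rewrite leq_pmulr; lia.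
have e5 : q <= q * q * (q * q) * q by rewrite leq_pmull // !muln_gt0; lia.
rewrite q1 in le; move: (q * q * (q * q) * q) e4 e5 le => B; move: (q * q * (q * q)) e3 => D.
by move: (n * n.+1 * _) => A; clear -nq q0 => *; split; lia.
Qed.

(** The dominant term loads the masses: [O(m)] paths, [O(L ^ 2)] masses each, [O(L)] tree levels per
    mass. As [L >= 1], lower order terms are absorbed; the three products use 180, 576 and 32 of the
    constant, and the rest covers the linear terms. *)
Lemma ticks_le n m L H p dT N : 1 < n -> 0 < L -> n <= 2 * m -> p <= 4 * m -> dT <= m * 2 ->
  N <= 2 * n -> H <= L.+1 ->
  (4 * n + dT + H + (n + p * (2 * L + (4 * L + 2) + (4 * L + 2) * (4 * L + 2)).+1) + N + N + 3 * H
   + 2 * n + H.+1 * (p * ((4 * L + 2) * (4 * L + 2 + 2))) + H.+2 * (N * H)).+1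
  <= 1000 * (m * L ^ 4).
Proof.
move=> n1 L0 nm pm dm Nn HL; have m0 : 0 < m by lia.
have a1 : m <= m * L ^ 4 by rewrite leq_pmulr // expn_gt0 L0.
have L2 : L ^ 2 <= L ^ 4 by rewrite leq_pexp2l.
have L3 : L ^ 3 <= L ^ 4 by rewrite leq_pexp2l.
have L1 : L <= L ^ 4 by rewrite -[X in X <= _]expn1 leq_pexp2l.
have LL : L <= L * L by rewrite leq_pmulr.
have a2 : L <= m * L ^ 4 by apply: leq_trans L1 _; rewrite leq_pmull.
have c1 : (2 * L + (4 * L + 2) + (4 * L + 2) * (4 * L + 2)).+1 <= 45 * L ^ 2.
  have : (4 * L + 2) * (4 * L + 2) <= (6 * L) * (6 * L) by apply: leq_mul; lia.
  have -> : (6 * L) * (6 * L) = 36 * L ^ 2 by rewrite -mulnn; ring.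
  by rewrite -mulnn; move: (_ * (4 * L + 2)) (L * L) LL => A B; lia.
have c2 : (4 * L + 2) * (4 * L + 2 + 2) <= 48 * L ^ 2.
  have -> : 48 * L ^ 2 = (6 * L) * (8 * L) by rewrite -mulnn; ring.
  by apply: leq_mul; lia.
have c3 : p * (2 * L + (4 * L + 2) + (4 * L + 2) * (4 * L + 2)).+1 <= 180 * (m * L ^ 4).
  apply: leq_trans (leq_mul pm c1) _.
  have -> : 4 * m * (45 * L ^ 2) = 180 * (m * L ^ 2) by ring.
  by rewrite leq_mul2l leq_mul2l L2 !orbT.
have c4 : H.+1 * (p * ((4 * L + 2) * (4 * L + 2 + 2))) <= 576 * (m * L ^ 4).
  have h1 : H.+1 <= 3 * L by lia.
  apply: leq_trans (leq_mul h1 (leq_mul pm c2)) _.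
  have -> : 3 * L * (4 * m * (48 * L ^ 2)) = 576 * (m * L ^ 3) by rewrite expnS; ring.
  by rewrite leq_mul2l leq_mul2l L3 !orbT.
have c5 : H.+2 * (N * H) <= 32 * (m * L ^ 4).
  have h1 : H.+2 <= 4 * L by lia.
  have h2 : H <= 2 * L by lia.
  have h3 : N <= 4 * m by lia.
  apply: leq_trans (leq_mul h1 (leq_mul h3 h2)) _.
  have -> : 4 * L * (4 * m * (2 * L)) = 32 * (m * L ^ 2) by rewrite -mulnn; ring.
  by rewrite leq_mul2l leq_mul2l L2 !orbT.
by move: (m * L ^ 4) (H.+1 * _) (H.+2 * _) (p * _) c3 c4 c5 a1 a2 {L1 L2 L3 c1 c2 LL} => X A B D; lia.
Qed.

Lemma wp_guard (R : realType) W n Ix (LG LT : adjlists n) (w : {set 'I_n} -> R) c Q s :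
  (2 <= rg s rNn -> (0 <= wr s vB)%R -> wp W Ix LG LT w c Q s) ->
  (rg s rNn < 2 \/ (wr s vB < 0)%R -> Q s) ->
  wp W Ix LG LT w (Ife (Cn 2 <=~ $rNn) (Ifw Wz (Wv vB) c Skip) Skip) Q s.
Proof.
move=> yes no; wps; split=> //; rewrite lt0b; case: (leqP 2 (rg s 0)) => n2; last by apply: no; left.
split=> //; case: ifP => [b0|/negbT]; first exact: yes.
by rewrite -ltNge => b0; apply: no; right.
Qed.

Theorem theorem9 (R : realType) :
  exists (P : program) (k C : nat), 0 < k /\
    forall (n : nat) (E T : {set {set 'I_n}}) (w : {set 'I_n} -> R) (beta : R)
           (LG LT : adjlists n),
      is_graph [set: 'I_n] E ->
      connected_graph [set: 'I_n] E ->
      (forall e, e \in E -> (0 < w e)%R) ->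
      spanning_tree [set: 'I_n] E T ->
      adjlists_of E LG ->
      adjlists_of T LT ->
      exists (t : nat) (F : {set {set {set 'I_n}}}),
        let c := run P (word_size k n) LG LT w beta t in
        [/\ halted P c,
            outputs (output c) F,
            spanning_forest T (Hedges E T w beta) F
          & 1 < n -> t <= C * (#|E| * trunc_log 2 n ^ 4)].
Proof.
(* The word factor comes from [word_room]; the time constant is the code length, the price of a
   tick, times the constant of [ticks_le]. *)
exists (cc 0 c_main), 20, (size (cc 0 c_main) * 1000); split=> //.
move=> n E T w beta LG LT gE cE w_gt0 stT aG aT.
have [Ix [bigW nIx treeIx massIx]] := word_room n.
set W := word_size 20 n in bigW *; set P := cc 0 c_main.
set L := trunc_log 2 n in massIx *.
have nW : n < 2 ^ W by lia.
have degS g a : query_deg (lists LG LT g) a < 2 ^ W.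
  rewrite query_degE; apply: leq_ltn_trans nW; apply: (size_nb_le aG aT).
  by case: g; [left | right].
have nbrS g a i : query_nbr (lists LG LT g) a i < 2 ^ W.
  rewrite query_nbrE; case: (ltnP i (size (nb (lists LG LT g) a))) => hi.
    by apply: ltn_trans nW; apply: nb_lt (mem_nth 0 hi).
  by rewrite nth_default // expn_gt0.
suff [s' X [[F oF sF] tF]] : exists2 s', exec W Ix LG LT w c_main (start_state n beta) s'
    & (exists2 F, outputs (out s') F & spanning_forest T (Hedges E T w beta) F) /\
      (1 < n -> (tk s').+1 <= 1000 * (#|E| * L ^ 4)).
  have wf : wfc c_main by vm_compute.
  have cP : code_at P 0 (cc 0 c_main) by move=> i; rewrite add0n.
  have [t [S pcE _ tle]] := exec_simulated bigW degS nbrS X wf cP (erefl : pc (init n beta) = 0) (sim_start beta nW).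
  exists t, F; rewrite /run; split=> //.
  - by rewrite /halted pcE add0n.
  - by rewrite (sim_out S).
  - move=> n1; apply: leq_trans tle _; rewrite -mulnA leq_mul2l; apply/orP; right.
    by rewrite subn0; apply: tF.
apply/wpP; rewrite /c_main.
have triv : n < 2 \/ (beta < 0)%R ->
  (exists2 F, outputs [::] F & spanning_forest T (Hedges E T w beta) F) /\
      (1 < n -> 1 <= 1000 * (#|E| * L ^ 4)).
  move=> H; split; last first.
    (* Even an idle run takes machine steps, so the bound must be positive: [1 < n] forces an edge
       and [0 < L]. *)
    move=> n1; rewrite muln_gt0 muln_gt0 expn_gt0 /=; have := order_le gE stT aG n1.
    have : 0 < L by rewrite trunc_log_gt0.
    by move=> -> h; rewrite andbT lt0n; apply/eqP=> e0; move: h; rewrite e0; lia.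
  exists set0; first by exists [::]; split=> //=; apply/setP=> z; rewrite !inE.
  rewrite (Hedges_set0 w_gt0 (card_tree_edge gE stT) H).
  by split=> //; exact: acyclic0.
apply: wp_guard => [|]; [rewrite /start_state /= => n2 b0 | exact: triv].
have mIx : npaths LG n * ((4 * L + 2) * (4 * L + 2 + 2)) < Ix.
  by apply: leq_ltn_trans massIx; apply: leq_mul => //; apply: (npaths_le_sqr aG aT).
have n0 : 0 < n by lia.
apply: (wp_use (body_spec gE w_gt0 stT aG aT n2 b0 bigW (nIx n0) treeIx erefl mIx)).
move=> s' _ [FF [H HN tH]]; split=> // _.
apply: leq_trans (tH : (tk s').+1 <= _.+1) _.
apply: (@ticks_le n) => //.
- by rewrite trunc_log_gt0.
- exact: order_le gE stT aG n2.
- exact: npaths_le_edges gE stT aG n2.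
- exact: sum_tree_degrees_le gE stT aG aT.
- by have := trunc_log_max (isT : 1 < 2) HN; rewrite mul2n trunc_log2_double.
Qed.
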